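(* Let $U\in\mathcal U$, let $\vartheta^-\neq\vartheta^+$ belong to $\Theta$, let $\alpha\in(0,2)$, and consider a potential $V(x)=\dfrac{U(\vartheta)}{r^\alpha}+W(x)$ with $V\in C^1(\mathbb R^2\setminus\{0\})$ such that, for some $\alpha'<\alpha$, $$\lim_{r\to0}r^{\alpha'}\left(W(x)+r|\nabla W(x)|\right)=0,\qquad r=|x|.$$ Assume $\alpha=\bar\alpha(\vartheta^-,\vartheta^+,U)$. Given any pair of points $x_1=(r_1,\varphi_1)$, $x_2=(r_2,\varphi_2)$, $r_1,r_2>0$, in the open sector $(\vartheta^-,\vartheta^+)$, all fixed-time Bolza minimizers for $V$ associated to $x_1,x_2$ and lying within the sector $[\vartheta^-+\varepsilon,\vartheta^+-\varepsilon]$ for some $\varepsilon>0$ are collisionless.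
   Context: Fix $0\le\vartheta_1\le\vartheta_2<2\pi$. $\mathcal U=\mathcal U_{\vartheta_1\vartheta_2}$ is the set of $2\pi$-periodic $U\in C^2(\mathbb R)$ with $U(\vartheta)\ge U(\vartheta_1)=U(\vartheta_2)>0$ for all $\vartheta$ and $U''(\vartheta_i)>0$, $i=1,2$. $\Theta=\{\vartheta_i+2n\pi:\ n\in\mathbb Z,\ i\in\{1,2\}\}$. For $\alpha\in(0,2)$, $(U,\alpha)$ denotes the potential $U(\vartheta)/r^\alpha$ on $\mathbb R^2\setminus\{0\}$, where $x=(r\cos\vartheta,r\sin\vartheta)$. Planar paths are written in polar coordinates $x=(r,\vartheta)$, with $r=|x|$ and $\vartheta$ a real-valued (lifted) angle, continuous in time on intervals where $r>0$ (so angles differing by $2\pi$ are distinguished, and no relation is imposed between values of the angle before and after an instant where $r=0$). $H^1$ regularity refers to the planar path. The action for a potential $V$ is $\mathcal A([a,b];x)=\int_a^b\left(\tfrac12|\dot x(t)|^2+V(x(t))\right)dt$. Definition of $\bar\alpha$. A parabolic trajectory associated with $\vartheta^-\ne\vartheta^+$ and $(U,\alpha)$ is a path $x=(r,\vartheta)$, $t\in\mathbb R$, with $\min_{\mathbb R} r>0$, solving $\ddot x=\nabla V_0(x)$ and $\tfrac12|\dot x|^2=V_0(x)$ for all $t$, where $V_0=U(\vartheta)/r^\alpha$, with $r(t)\to+\infty$ and $\vartheta(t)\to\vartheta^\pm$ as $t\to\pm\infty$. For $U\in\mathcal U$ and $\vartheta^-\neq\vartheta^+\in\Theta$ there is at most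 one $\alpha\in(0,2)$ for which such a trajectory exists; $\bar\alpha(\vartheta^-,\vartheta^+,U)$ is that value of $\alpha$ if it exists, and $0$ otherwise. Bolza minimizers. For $t_1<t_2$, $x=(r,\vartheta)\in H^1(t_1,t_2)$ is a fixed-time Bolza minimizer associated to the ends $x_1=(r_1,\varphi_1)$, $x_2=(r_2,\varphi_2)$ if $r(t_i)=r_i$, $\vartheta(t_i)=\varphi_i$, $i=1,2$, and $\mathcal A([t_1,t_2];x)\le\mathcal A([t_1,t_2];z)$ for every $z=(\rho,\zeta)\in H^1(t_1,t_2)$ with $\rho(t_i)=r_i$, $\zeta(t_i)=\varphi_i$, $i=1,2$. It is collisionless if $\min_{[t_1,t_2]}r>0$. It lies within a closed angular sector if $\vartheta(t)$ belongs to the corresponding interval for every $t$ with $r(t)>0$. The sectors are written for $\vartheta^-<\vartheta^+$; if $\vartheta^+<\vartheta^-$ exchange the roles of the two angles in the description of the sectors.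
   Formalization: The smallness condition is taken with |W(x)| in place of W(x): as written, W=-1/r with α<1 gives W+r|∇W|=0, yet a linear collision path has action -∞ and is a colliding minimizer. *)

(* Defs.v *)
From mathcomp Require Import all_boot all_order all_algebra.
From mathcomp Require Import all_classical all_reals all_analysis.

Set Implicit Arguments.
Unset Strict Implicit.
Unset Printing Implicit Defensive.

Import Order.TTheory GRing.Theory Num.Theory.
Import numFieldNormedType.Exports.

Local Open Scope ring_scope.
Local Open Scope classical_set_scope.

Section PlanarPotentials.
Context {R : realType}.

(* The library norm on R * R is the max norm, hence a separate Euclidean norm;
   the topologies agree. *)
Definition enorm (x : R * R) : R := Num.sqrt (x.1 ^+ 2 + x.2 ^+ 2).

Definition polar (r a : R) : R * R := (r * cos a, r * sin a).

(* Principal argument in (-pi, pi]; junk at the origin. *)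
Definition arg (x : R * R) : R :=
  if 0 <= x.2 then acos (x.1 / enorm x) else - acos (x.1 / enorm x).

Lemma polar_arg (x : R * R) : x != 0 -> polar (enorm x) (arg x) = x.
Proof.
case: x => a b; rewrite /polar /arg /enorm /= => ab0.
have s0 : 0 < a ^+ 2 + b ^+ 2.
  rewrite lt_neqAle addr_ge0 ?sqr_ge0 // andbT eq_sym paddr_eq0 ?sqr_ge0 //.
  by rewrite !sqrf_eq0.
set s := Num.sqrt _.
have sp : 0 < s by rewrite sqrtr_gt0.
have s2 : s ^+ 2 = a ^+ 2 + b ^+ 2 by rewrite sqr_sqrtr// ltW.
have las : `|a / s| <= 1.
  rewrite normrM normfV (gtr0_norm sp) ler_pdivrMr// mul1r.
  by rewrite -sqrtr_sqr ler_wsqrtr// lerDl sqr_ge0.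
have ias : -1 <= a / s <= 1 by rewrite -ler_norml.
have sb : s * sin (acos (a / s)) = `|b|.
  rewrite sin_acos// -[X in X * _](gtr0_norm sp) -sqrtr_sqr -sqrtrM ?sqr_ge0//.
  rewrite mulrBr mulr1 expr_div_n mulrCA divff ?sqrf_eq0 ?gt_eqF// mulr1 s2.
  by rewrite addrAC subrr add0r sqrtr_sqr.
have ca : s * cos (acos (a / s)) = a.
  by rewrite acosK ?in_itv//= mulrC divfK// gt_eqF.
case: ifPn => [b0|]; first by rewrite ca sb ger0_norm.
by rewrite -ltNge => b0; rewrite cosN sinN mulrN ca sb ltr0_norm// opprK.
Qed.

(* The potential U(theta) / r^alpha, for a 2pi-periodic U; junk at the
   origin. *)
Definition homog_pot (U : R -> R) (alpha : R) (x : R * R) : R :=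
  U (arg x) / enorm x `^ alpha.

Definition grad (f : R * R -> R) (x : R * R) : R * R :=
  ('D_(1, 0) f x, 'D_(0, 1) f x).

Definition C1_punctured (f : R * R -> R) : Prop :=
  forall x, x != 0 -> differentiable f x /\ {for x, continuous (grad f)}.

Definition C2 (f : R -> R) : Prop :=
  [/\ forall t, derivable f t 1, forall t, derivable f^`() t 1
    & continuous f^`(2)].

Definition calU (theta1 theta2 : R) (U : R -> R) : Prop :=
  [/\ C2 U, forall t, U (t + 2 * pi) = U t,
      forall t, U theta1 <= U t, U theta1 = U theta2 /\ 0 < U theta1
    & 0 < U^`(2) theta1 /\ 0 < U^`(2) theta2].

Definition Theta (theta1 theta2 : R) : set R :=
  [set a | exists n : int,
     a = theta1 + 2 * n%:~R * pi \/ a = theta2 + 2 * n%:~R * pi].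

(* The minimum of f over A is attained and positive. *)
Definition has_pos_min (A : set R) (f : R -> R) : Prop :=
  exists t0, [/\ A t0, 0 < f t0 & forall t, A t -> f t0 <= f t].

Definition parabolic_trajectory (U : R -> R) (alpha thm thp : R)
    (r th : R -> R) : Prop :=
  let x : R -> R * R := fun t => polar (r t) (th t) in
  let V0 := homog_pot U alpha in
  [/\ has_pos_min setT r /\ continuous th,
      forall t, [/\ derivable x t 1, derivable x^`() t 1
                  & x^`(2) t = grad V0 (x t)],
      forall t, 2^-1 * enorm (x^`() t) ^+ 2 = V0 (x t),
      r @ -oo --> +oo /\ r @ +oo --> +oo
    & th @ -oo --> thm /\ th @ +oo --> thp].

(* For U in the class calU at most one alpha qualifies, so that the choice
   made by xget is immaterial. *)
Definition alpha_bar (thm thp : R) (U : R -> R) : R :=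
  xget 0 [set alpha | 0 < alpha < 2 /\
    exists r th, parabolic_trajectory U alpha thm thp r th].

(* f is (the continuous representative of) an element of H^1(a, b), with
   weak derivative g in L^2(a, b). *)
Definition H1_deriv (a b : R) (f g : R -> R) : Prop :=
  [/\ measurable_fun `[a, b] g,
      lebesgue_measure.-integrable `[a, b] (fun t => (g t ^+ 2)%:E)
    & forall t, t \in `[a, b]%R ->
        f t = f a + Rintegral lebesgue_measure `[a, t] g].

(* (r, th) is a path on [a, b] in lifted polar coordinates, whose planar path
   is in H^1 with velocity v. The angle is unconstrained where r vanishes, so
   its values before and after a collision are unrelated. *)
Definition H1_path (a b : R) (r th : R -> R) (v : R -> R * R) : Prop :=
  [/\ forall t, t \in `[a, b]%R -> 0 <= r t,
      {within [set t | t \in `[a, b]%R /\ 0 < r t], continuous th},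
      H1_deriv a b (fun t => (polar (r t) (th t)).1) (fun t => (v t).1)
    & H1_deriv a b (fun t => (polar (r t) (th t)).2) (fun t => (v t).2)].

(* The potential is +oo at the collision. *)
Definition pot_ext (V : R * R -> R) (x : R * R) : \bar R :=
  if x == 0 then +oo%E else (V x)%:E.

(* The value does not depend on the representative v of the weak derivative
   of x. *)
Definition action (V : R * R -> R) (a b : R) (x v : R -> R * R) : \bar R :=
  (\int[lebesgue_measure]_(t in `[a, b])
     ((2^-1 * enorm (v t) ^+ 2)%:E + pot_ext V (x t)))%E.

Definition admissible (t1 t2 r1 phi1 r2 phi2 : R) (r th : R -> R)
    (v : R -> R * R) : Prop :=
  [/\ H1_path t1 t2 r th v, r t1 = r1 /\ th t1 = phi1
    & r t2 = r2 /\ th t2 = phi2].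

Definition bolza_minimizer (V : R * R -> R) (t1 t2 r1 phi1 r2 phi2 : R)
    (r th : R -> R) : Prop :=
  exists2 v, admissible t1 t2 r1 phi1 r2 phi2 r th v &
    forall rho zeta w, admissible t1 t2 r1 phi1 r2 phi2 rho zeta w ->
      (action V t1 t2 (fun t => polar (r t) (th t)) v <=
       action V t1 t2 (fun t => polar (rho t) (zeta t)) w)%E.

Definition collisionless (t1 t2 : R) (r : R -> R) : Prop :=
  has_pos_min `[t1, t2] r.

Definition within_sector (t1 t2 a b : R) (r th : R -> R) : Prop :=
  forall t, t \in `[t1, t2]%R -> 0 < r t -> th t \in `[a, b]%R.

End PlanarPotentials.

(* Main.v *)
From HB Require Import structures.
Require Import Defs.
From mathcomp Require Import all_boot all_order all_algebra.
From mathcomp Require Import all_classical all_reals all_analysis.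
From mathcomp Require Import measurable_realfun ring lra.
Set Implicit Arguments.
Unset Strict Implicit.
Unset Printing Implicit Defensive.
Import Order.TTheory GRing.Theory Num.Theory.
Import numFieldNormedType.Exports.
Local Open Scope ring_scope.
Local Open Scope classical_set_scope.

(* Write [ga = 1 - al / 2]. Along the given parabolic trajectory, in McGehee
   coordinates v = r^(al/2) r', w = r^(1+al/2) th', one has v^2 + w^2 = 2 U and
   v is nondecreasing with v^2 <= 2 min U, so that w can only vanish where th
   is thm or thp: the trajectory and its rescalings foliate the open sector.
   Hence S = r^ga u(th), where u = v / ga as a function of the angle (u' = w),
   solves |grad S|^2 = 2 U / r^al, and an arc of a leaf from p to q has action
   |S(q) - S(p)|. As w > 0 inside the sector, u and -u can both be increased to
   strict subsolutions, which calibrate the two branches of a path that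
   collides between p and q: its action is at least
   |S(q) - S(p)| + c (|p|^ga + |q|^ga). Let p and q be the last and first points
   of a colliding minimizer on the leaf of scale lam around a collision.
   Replacing the piece in between by an arc of that leaf saves at least
   d lam^ga; the resulting change of duration, absorbed by an affine change of
   time in the rest of the path, costs O(lam^(ga + al)), and the perturbation W
   an arbitrarily small multiple of lam^ga. *)

(** * Polar coordinates and derivatives of the homogeneous potential *)

Section Polar.
Context {R : realType}.
Implicit Types (U f g : R -> R) (x y : R * R).

(** The exact calibration by [S] only yields a tie: in the homogeneous problem a colliding path
    costs at least |S(q) - S(p)|, which is what the arc costs, and a tie does not survive the errors
    due to [W] and to the change of duration. Strictness breaks it. A small positive correction
    whose slope is opposite to that of [u], or of [- u], lowers |grad|^2 at first order because [w]
    is bounded below on the closed smaller sector; near the boundary angles no such bound is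
    available, whence the margin [eps]. Both subsolutions, multiplied by r^ga, vanish at the origin,
    so each branch is estimated by itself and the angles before and after the collision need no
    relation. The ends p and q are taken on one leaf, not on one circle, so that an arc of that leaf
    joins them. On the orders: the arc lasts a multiple of lam^(1 + al/2), and 1 + al/2 = ga + al;
    on the colliding piece the potential is at least a multiple of lam^(-al), so its duration is at
    most a multiple of lam^al times its action. *)

Lemma enorm_polar (r a : R) : 0 <= r -> enorm (polar r a) = r.
Proof.
move=> r0; rewrite /enorm /polar /= !exprMn -mulrDr cos2Dsin2 mulr1.
by rewrite sqrtr_sqr ger0_norm.
Qed.

Lemma enorm_ge0 x : 0 <= enorm x.
Proof. exact: sqrtr_ge0. Qed.

Lemma sqr_enorm x : enorm x ^+ 2 = x.1 ^+ 2 + x.2 ^+ 2.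
Proof. by rewrite sqr_sqrtr// addr_ge0// sqr_ge0. Qed.

Lemma polar_eq0 (r a : R) : (polar r a == 0) = (r == 0).
Proof.
apply/eqP/eqP => [|->]; last by rewrite /polar !mul0r.
case=> h1 h2; have := cos2Dsin2 a => h.
have : r ^+ 2 = 0.
  rewrite -[LHS]mulr1 -h mulrDr -!exprMn h1 h2; ring.
by move/eqP; rewrite sqrf_eq0 => /eqP.
Qed.

Lemma enorm_gt0 x : (0 < enorm x) = (x != 0).
Proof.
rewrite sqrtr_gt0 lt_neqAle addr_ge0 ?sqr_ge0// andbT eq_sym.
rewrite paddr_eq0 ?sqr_ge0// !sqrf_eq0; case: x => a b /=.
by rewrite xpair_eqE.
Qed.

Lemma periodic_int U (T : R) (hU : forall t, U (t + T) = U t) (n : int) (a : R) :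
  U (a + n%:~R * T) = U a.
Proof.
case: n => n; first by rewrite mulr_natl (periodicn hU).
rewrite NegzE mulrNz mulNr -[a in RHS](subrK (n.+1%:~R * T)).
by rewrite [n.+1%:~R * T]mulr_natl (periodicn hU).
Qed.

(** Two angles of one point differ by a [d] with [cos d = 1]. The remainder [e] of [d] modulo
    [2 * pi] must vanish, since [e] or [2 * pi - e] lies in [[0, pi]], where [cos] is injective. *)
Lemma periodic_cos1 U (hU : forall t, U (t + 2 * pi) = U t) (d a : R) :
  cos d = 1 -> U (a + d) = U a.
Proof.
move=> cd; have pi0 := @pi_gt0 R.
have p0 : 0 < 2 * pi :> R by rewrite mulr_gt0.
pose n := Num.floor (d / (2 * pi)).
pose e := d - n%:~R * (2 * pi).
have de : d = e + n%:~R * (2 * pi) by rewrite /e subrK.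
have := Num.Theory.floor_itv (d / (2 * pi)); rewrite -/n => /andP[n1 n2].
have e0 : 0 <= e by rewrite subr_ge0 -ler_pdivlMr.
have e1 : e < 2 * pi.
  rewrite ltrBlDr -[X in X + _]mul1r -mulrDl -ltr_pdivrMr//.
  by rewrite intrD addrC in n2.
have ce : cos e = 1.
  have := periodic_int (U := cos) (T := 2 * pi) _ n e; rewrite -de cd => -> //.
  by move=> t; rewrite mulr_natl cosD2pi.
suff e00 : e = 0 by rewrite de addrA addrAC e00 addr0 periodic_int.
have [epi|epi] := leP e pi.
  by apply: cos_inj; rewrite ?in_itv/= ?e0 ?epi ?lexx ?pi_ge0// ce cos0.
have : 2 * pi - e = 0.
  apply: cos_inj; rewrite ?in_itv/= ?lexx ?pi_ge0 ?cos0//.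
    by apply/andP; split; lra.
  by rewrite cosB mulr_natl cos2pi sin2pi ce; ring.
lra.
Qed.

Lemma homog_pot_polar U (hU : forall t, U (t + 2 * pi) = U t) (al r a : R) :
  0 < r -> homog_pot U al (polar r a) = U a / r `^ al.
Proof.
move=> r0; rewrite /homog_pot enorm_polar ?ltW//; congr (_ / _).
have x0 : polar r a != 0 by rewrite polar_eq0 gt_eqF.
have := polar_arg x0; rewrite enorm_polar ?ltW//; set b := arg _ => -[h1 h2].
have cab : cos b = cos a by apply: (mulfI (lt0r_neq0 r0)).
have sab : sin b = sin a by apply: (mulfI (lt0r_neq0 r0)).
have := periodic_cos1 hU (d := a - b) b.
rewrite addrCA subrr addr0 => ->//.
by rewrite cosB cab sab -!expr2 cos2Dsin2.
Qed.

Lemma is_derive_dir (f : R * R -> R) (a v : R * R) (df : R) :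
  is_derive (0 : R) 1 (fun h => f (h *: v + a)) df -> is_derive a v f df.
Proof.
move=> [d1 d2].
have E : (fun h : R => h^-1 *: ((f \o shift a) (h *: v) - f a)) =
   (fun h : R => h^-1 *: (((fun h : R => f (h *: v + a)) \o shift 0) (h *: 1) -
      (fun h : R => f (h *: v + a)) 0)).
  by apply/funext => h /=; rewrite scale0r add0r addr0 /GRing.scale/= mulr1.
by split; [rewrite /derivable E| rewrite /derive E].
Qed.

End Polar.

Section Derivatives.
Context {R : realType}.
Implicit Types f g : R -> R.
Notation D s f l := (is_derive (s : R) (1 : R) (f : R -> R) (l : R)).

Lemma isD_eq s f a b : D s f a -> a = b -> D s f b.
Proof. by move=> h <-. Qed.

Lemma isD_cst s (c : R) : D s (fun=> c) 0.
Proof. exact: is_derive_cst. Qed.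

Lemma isD_id s : D s (fun t => t) 1.
Proof. exact: is_derive_id. Qed.

Lemma isD_add s f g a b : D s f a -> D s g b -> D s (fun t => f t + g t) (a + b).
Proof. by move=> h1 h2; exact: is_deriveD. Qed.

Lemma isD_opp s f a : D s f a -> D s (fun t => - f t) (- a).
Proof. by move=> h1; exact: is_deriveN. Qed.

Lemma isD_mul s f g a b : D s f a -> D s g b ->
  D s (fun t => f t * g t) (a * g s + f s * b).
Proof.
move=> h1 h2; apply: (isD_eq (is_deriveM h1 h2)).
by rewrite /GRing.scale/= addrC [g s * a]mulrC.
Qed.

Lemma isD_sqr s f a : D s f a -> D s (fun t => f t ^+ 2) (2 * f s * a).
Proof.
move=> h; have -> : (fun t => f t ^+ 2) = (fun t => f t * f t).
  by apply/funext => t; rewrite expr2.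
by apply: (isD_eq (isD_mul h h)); ring.
Qed.

Lemma isD_comp s f g a b : D s f a -> D (f s) g b -> D s (fun t => g (f t)) (b * a).
Proof. by move=> h1 h2; exact: is_derive1_comp h2 h1. Qed.

Lemma isD_scale s f a (c : R) : D s f a -> D s (fun t => c * f t) (c * a).
Proof.
move=> h; apply: (isD_eq (isD_mul (isD_cst s c) h)).
by rewrite mul0r add0r.
Qed.

Lemma isD_inv s f a : D s f a -> f s != 0 -> D s (fun t => (f t)^-1) (- a / f s ^+ 2).
Proof.
move=> h h0; apply: (isD_eq (is_deriveV h0 h)).
by rewrite /GRing.scale/= mulrC mulrN mulNr.
Qed.

Lemma isD_powR s f a (p : R) : D s f a -> 0 < f s ->
  D s (fun t => f t `^ p) (p * f s `^ (p - 1) * a).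
Proof.
by move=> h h0; exact: (isD_comp h (g := fun x => x `^ p) (is_derive1_powR p h0)).
Qed.

Lemma isD_sqrt s f a : D s f a -> 0 < f s ->
  D s (fun t => Num.sqrt (f t)) ((2 * Num.sqrt (f s))^-1 * a).
Proof. by move=> h h0; exact: (isD_comp h (is_derive1_sqrt h0)). Qed.

Lemma isD_cos s f a : D s f a -> D s (fun t => cos (f t)) (- sin (f s) * a).
Proof. by move=> h; exact: (isD_comp h (is_derive_cos (f s))). Qed.

Lemma isD_sin s f a : D s f a -> D s (fun t => sin (f t)) (cos (f s) * a).
Proof. by move=> h; exact: (isD_comp h (is_derive_sin (f s))). Qed.

Lemma isD_atan s f a : D s f a -> D s (fun t => atan (f t)) ((1 + f s ^+ 2)^-1 * a).
Proof. by move=> h; exact: (isD_comp h (is_derive1_atan (f s))). Qed.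

Lemma isD_expR s f a : D s f a -> D s (fun t => expR (f t)) (expR (f s) * a).
Proof. by move=> h; exact: (isD_comp h (is_derive_expR (f s))). Qed.

Lemma isD_near s f g a : (\near s, f s = g s) -> D s f a -> D s g a.
Proof. by move=> h1 h2; exact: near_eq_is_derive h1 h2. Qed.

Lemma isD_continuous s f a : D s f a -> {for s, continuous f}.
Proof. by case=> + _ => /derivable1_diffP/differentiable_continuous. Qed.

(* Rotating the frame by [a] and using the arctangent gives a local branch of
   the angle. *)
Lemma polar_atan (X Y a : R) : 0 < X ->
  polar (Num.sqrt (X ^+ 2 + Y ^+ 2)) (a + atan (Y / X)) =
  (X * cos a - Y * sin a, X * sin a + Y * cos a).
Proof.
move=> X0; set z := Y / X.
have Xn : X != 0 by rewrite gt_eqF.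
have tz := atanK z.
have cz : cos (atan z) = X / Num.sqrt (X ^+ 2 + Y ^+ 2).
  rewrite cos_atan.
  have -> : X ^+ 2 + Y ^+ 2 = X ^+ 2 * (1 + z ^+ 2) by rewrite /z; field.
  rewrite sqrtrM ?sqr_ge0// sqrtr_sqr gtr0_norm// invfM mulrA divff// mul1r//.
have S0 : 0 < Num.sqrt (X ^+ 2 + Y ^+ 2).
  by rewrite sqrtr_gt0 ltr_pwDl ?exprn_gt0 ?sqr_ge0.
have sz : sin (atan z) = Y / Num.sqrt (X ^+ 2 + Y ^+ 2).
  have c0 : cos (atan z) != 0.
    by rewrite cz mulf_neq0 ?invr_eq0 ?gt_eqF.
  have : sin (atan z) = z * cos (atan z) by rewrite -{2}tz /tan divfK.
  by move=> ->; rewrite cz mulrA /z divfK.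
rewrite /polar cosD sinD cz sz.
by congr pair; field; rewrite gt_eqF.
Qed.

End Derivatives.
Section Potential.
Context {R : realType}.
Implicit Types U : R -> R.

(** The cut of [arg] is avoided: in the frame rotated by [a], the line through the point has the
    smooth angle [a + atan (Y / X)] and radius [rho], and periodicity of [U] makes the choice of
    branch immaterial. *)
Lemma homog_pot_is_derive U (hU : forall t, U (t + 2 * pi) = U t)
  (al r a p q dU : R) : 0 < r -> is_derive a 1 U dU ->
  is_derive (polar r a) (p, q) (homog_pot U al)
   (dU * (q * cos a - p * sin a) / r / r `^ al
     - al * U a * (p * cos a + q * sin a) / r / r `^ al).
Proof.
move=> r0 dUa; apply: is_derive_dir.
pose pr := p * cos a + q * sin a.
pose pt := q * cos a - p * sin a.
pose X h := r + h * pr.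
pose Y h := h * pt.
pose rho h := Num.sqrt (X h ^+ 2 + Y h ^+ 2).
have X0 : X 0 = r by rewrite /X mul0r addr0.
have Y0 : Y 0 = 0 by rewrite /Y mul0r.
have rho0 : rho 0 = r.
  by rewrite /rho X0 Y0 expr0n addr0 sqrtr_sqr gtr0_norm.
have dX : is_derive (0 : R) 1 X pr.
  apply: (isD_eq (isD_add (isD_cst 0 r) (isD_mul (isD_id 0) (isD_cst 0 pr)))).
  by ring.
have dY : is_derive (0 : R) 1 Y pt.
  apply: (isD_eq (isD_mul (isD_id 0) (isD_cst 0 pt))).
  by ring.
have X0n : X 0 != 0 by rewrite X0 gt_eqF.
have drho : is_derive (0 : R) 1 rho pr.
  have S0 : 0 < X 0 ^+ 2 + Y 0 ^+ 2.
    by rewrite X0 Y0 expr0n addr0 exprn_gt0.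
  apply: (isD_eq (isD_sqrt (isD_add (isD_sqr dX) (isD_sqr dY)) S0)).
  rewrite X0 Y0 !(mul0r, mulr0, addr0) expr0n addr0 sqrtr_sqr gtr0_norm//.
  by field; rewrite gt_eqF.
have dth : is_derive (0 : R) 1 (fun h => a + atan (Y h / X h)) (pt / r).
  apply: (isD_eq (isD_add (isD_cst 0 a) (isD_atan (isD_mul dY (isD_inv dX X0n))))).
  rewrite Y0 X0; field; by rewrite gt_eqF.
have th0 : a + atan (Y 0 / X 0) = a by rewrite Y0 mul0r atan0 addr0.
have dmain : is_derive (0 : R) 1
   (fun h => U (a + atan (Y h / X h)) * (rho h `^ al)^-1)
   (dU * pt / r / r `^ al - al * U a * pr / r / r `^ al).
  have dU0 : is_derive (a + atan (Y 0 / X 0)) 1 U dU by rewrite th0.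
  have r0' : 0 < rho 0 by rewrite rho0.
  have rn : rho 0 `^ al != 0 by rewrite gt_eqF// powR_gt0.
  apply: (isD_eq (isD_mul (isD_comp dth dU0) (isD_inv (isD_powR al drho r0') rn))).
  rewrite /= th0 rho0.
  have -> : r `^ (al - 1) = r `^ al / r.
    by rewrite powRB ?powRr1 ?(ltW r0)// (gt_eqF r0) implybT.
  have : 0 < r `^ al by rewrite powR_gt0.
  move=> /lt0r_neq0 h; field; by rewrite h gt_eqF.
apply: isD_near dmain.
have : \forall h \near (0 : R), 0 < X h.
  have cX : X h @[h --> (0 : R)] --> X 0 := isD_continuous dX.
  by apply: (cvgr_gt _ cX); rewrite X0.
apply: filterS => h Xh.
have -> : h *: (p, q) + polar r a =
   (X h * cos a - Y h * sin a, X h * sin a + Y h * cos a).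
  have c2 := cos2Dsin2 a.
  rewrite /polar /X /Y /pr /pt; congr pair.
    change (h * p + r * cos a = (r + h * (p * cos a + q * sin a)) * cos a -
      h * (q * cos a - p * sin a) * sin a).
    rewrite -[h * p]mulr1 -c2; ring.
  change (h * q + r * sin a = (r + h * (p * cos a + q * sin a)) * sin a +
      h * (q * cos a - p * sin a) * cos a).
  rewrite -[h * q]mulr1 -c2; ring.
rewrite -polar_atan// homog_pot_polar// sqrtr_gt0.
by rewrite ltr_pwDl ?exprn_gt0 ?sqr_ge0.
Qed.

(** Euler's identity for a function homogeneous of degree [- al]; along a trajectory it evaluates x
    . x''. *)
Lemma homog_pot_euler U (hU : forall t, U (t + 2 * pi) = U t)
  (dU : forall t, derivable U t 1) (al r a : R) : 0 < r ->
  (polar r a).1 * (grad (homog_pot U al) (polar r a)).1 +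
  (polar r a).2 * (grad (homog_pot U al) (polar r a)).2 =
  - al * homog_pot U al (polar r a).
Proof.
move=> r0; have dUa := DeriveDef (dU a) erefl.
have gE (f : R * R -> R) x : grad f x = ('D_(1, 0) f x, 'D_(0, 1) f x) by [].
have [_ e1] := homog_pot_is_derive hU al 1 0 r0 dUa.
have [_ e2] := homog_pot_is_derive hU al 0 1 r0 dUa.
rewrite gE {}e1 {}e2.
rewrite homog_pot_polar// /polar /=.
have rn : r `^ al != 0 by rewrite gt_eqF// powR_gt0.
have c2 := cos2Dsin2 a.
transitivity (- al * (U a / r `^ al) * (cos a ^+ 2 + sin a ^+ 2)); last first.
  by rewrite c2 mulr1.
field; by rewrite rn gt_eqF.
Qed.

End Potential.

(** * The parabolic trajectory and the leaves of its foliation *)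

Section MeanValue.
Context {R : realType}.
Implicit Types f df : R -> R.

Lemma isD_MVT f df (a b : R) : a < b ->
  (forall t, t \in `[a, b]%R -> is_derive t 1 f (df t)) ->
  exists2 c, c \in `]a, b[%R & f b - f a = df c * (b - a).
Proof.
move=> ab h.
have h1 : forall t, t \in `]a, b[%R -> is_derive t 1 f (df t).
  by move=> t tab; apply: h; exact: subset_itv_oo_cc tab.
have h2 : {within `[a, b], continuous f}.
  by apply: derivable_within_continuous => t /h [].
exact: (MVT ab h1 h2).
Qed.

Lemma isD_le f df (a b : R) : a <= b ->
  (forall t, t \in `[a, b]%R -> is_derive t 1 f (df t)) ->
  (forall t, t \in `[a, b]%R -> 0 <= df t) -> f a <= f b.
Proof.
rewrite le_eqVlt => /predU1P[->//|ab] h h0.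
have [c /subset_itv_oo_cc cab e] := isD_MVT ab h.
by rewrite -subr_ge0 e mulr_ge0 ?h0// subr_ge0 ltW.
Qed.

Lemma isD_lt f df (a b : R) : a < b ->
  (forall t, t \in `[a, b]%R -> is_derive t 1 f (df t)) ->
  (forall t, t \in `[a, b]%R -> 0 < df t) -> f a < f b.
Proof.
move=> ab h h0.
have [c /subset_itv_oo_cc cab e] := isD_MVT ab h.
by rewrite -subr_gt0 e mulr_gt0 ?h0// subr_gt0.
Qed.

Lemma isD_fst (x : R -> R * R) (t : R) : derivable x t 1 ->
  is_derive t 1 (fun t => (x t).1) (x^`() t).1.
Proof.
move=> dx.
have dx' : h^-1 *: ((x \o shift t) (h *: 1) - x t) @[h --> 0^'] --> 'D_1 x t.
  exact: dx.
have c : h^-1 *: (((fun t => (x t).1) \o shift t) (h *: 1) - (x t).1) @[h --> 0^'] -->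
   (x^`() t).1.
  rewrite derive1E.
  have -> : (fun h : R => h^-1 *: (((fun t => (x t).1) \o shift t) (h *: 1) - (x t).1)) =
     (fun h => fst (h^-1 *: ((x \o shift t) (h *: 1) - x t))) by [].
  by apply: continuous_cvg dx'; exact: cvg_fst.
split; first by apply/cvg_ex; eexists; exact: c.
exact: (cvg_lim _ c).
Qed.

Lemma isD_snd (x : R -> R * R) (t : R) : derivable x t 1 ->
  is_derive t 1 (fun t => (x t).2) (x^`() t).2.
Proof.
move=> dx.
have dx' : h^-1 *: ((x \o shift t) (h *: 1) - x t) @[h --> 0^'] --> 'D_1 x t.
  exact: dx.
have c : h^-1 *: (((fun t => (x t).2) \o shift t) (h *: 1) - (x t).2) @[h --> 0^'] -->
   (x^`() t).2.
  rewrite derive1E.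
  have -> : (fun h : R => h^-1 *: (((fun t => (x t).2) \o shift t) (h *: 1) - (x t).2)) =
     (fun h => snd (h^-1 *: ((x \o shift t) (h *: 1) - x t))) by [].
  by apply: continuous_cvg dx'; exact: cvg_snd.
split; first by apply/cvg_ex; eexists; exact: c.
exact: (cvg_lim _ c).
Qed.

End MeanValue.

Section Flow.
Context {R : realType}.
Implicit Types U r th v w : R -> R.

(* The McGehee form of the zero-energy equations: [v] and [w] are the radial
   and angular velocities multiplied by [r `^ (al / 2)]. *)
Definition zero_energy_flow U (al : R) r th v w (t : R) :=
  [/\ 0 < r t,
      is_derive t 1 r (v t * r t `^ (- (al / 2))),
      is_derive t 1 th (w t * r t `^ (- (1 + al / 2))),
      is_derive t 1 v ((1 - al / 2) * w t ^+ 2 * r t `^ (- (1 + al / 2)))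
    & v t ^+ 2 + w t ^+ 2 = 2 * U (th t) /\ {for t, continuous w}].

Lemma powR_halves (r al : R) : 0 < r ->
  [/\ r `^ (al / 2) != 0, r `^ al = (r `^ (al / 2)) ^+ 2,
      r `^ (al / 2 - 1) = r `^ (al / 2) / r,
      r `^ (- (al / 2)) = (r `^ (al / 2))^-1
    & r `^ (- (1 + al / 2)) = (r `^ (al / 2))^-1 / r].
Proof.
move=> r0; have rn : r != 0 by rewrite gt_eqF.
have h n1 : n1 + n1 = n1 *+ 2 :> R by rewrite mulr2n.
split.
- by rewrite gt_eqF// powR_gt0.
- by rewrite expr2 -powRD ?rn ?implybT//; congr (_ `^ _); field.
- by rewrite powRB ?rn ?implybT// powRr1// ltW.
- by rewrite powRN.
- by rewrite powRN powRD ?rn ?implybT// powRr1 ?ltW// invfM mulrC.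
Qed.

Lemma parabolic_flow U (hU : forall t, U (t + 2 * pi) = U t)
  (dU : forall t, derivable U t 1) (al thm thp : R) r th :
  parabolic_trajectory U al thm thp r th ->
  exists v w, forall t, zero_energy_flow U al r th v w t.
Proof.
move=> [[[t0 [_ rt0 rmin]] cth] sol en _ _].
have r0 t : 0 < r t by apply: (lt_le_trans rt0); exact: rmin.
set x := fun t => polar (r t) (th t) in sol en.
pose X t := (x t).1; pose Y t := (x t).2.
pose X' : R -> R := fun t => (x^`() t).1; pose Y' : R -> R := fun t => (x^`() t).2.
have dX (t : R) : is_derive t 1 X (X' t) by apply: isD_fst; case: (sol t).
have dY (t : R) : is_derive t 1 Y (Y' t) by apply: isD_snd; case: (sol t).
have dX' (t : R) : is_derive t 1 X' (grad (homog_pot U al) (x t)).1.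
  by case: (sol t) => _ h <-; exact: isD_fst.
have dY' (t : R) : is_derive t 1 Y' (grad (homog_pot U al) (x t)).2.
  by case: (sol t) => _ h <-; exact: isD_snd.
have eu t : X t * (grad (homog_pot U al) (x t)).1 +
   Y t * (grad (homog_pot U al) (x t)).2 = - al * (U (th t) / r t `^ al).
  by rewrite homog_pot_euler// homog_pot_polar.
have energy t : X' t ^+ 2 + Y' t ^+ 2 = 2 * (U (th t) / r t `^ al).
  have := en t; rewrite sqr_enorm -/(X' t) -/(Y' t) homog_pot_polar// => <-.
  by field.
have r2 t : X t ^+ 2 + Y t ^+ 2 = r t ^+ 2.
  by rewrite -[X in _ = X ^+ 2](enorm_polar (th t) (ltW (r0 t))) sqr_enorm.
have dr (t : R) : is_derive t 1 r ((X t * X' t + Y t * Y' t) / r t).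
  have -> : r = fun t => Num.sqrt (X t ^+ 2 + Y t ^+ 2).
    by apply/funext => s; rewrite r2 sqrtr_sqr gtr0_norm.
  have S0 : 0 < X t ^+ 2 + Y t ^+ 2 by rewrite r2 exprn_gt0.
  apply: (isD_eq (isD_sqrt (isD_add (isD_sqr (dX t)) (isD_sqr (dY t))) S0)).
  have : Num.sqrt (X t ^+ 2 + Y t ^+ 2) != 0 by rewrite gt_eqF ?sqrtr_gt0.
  by move=> h; field.
(* [th] is only known to be continuous. Continuity keeps [th s] within [pi / 2] of [th t], where it
   equals [th t + atan (Yr s / Xr s)], a differentiable function of the position. *)
have dth (t : R) : is_derive t 1 th ((X t * Y' t - Y t * X' t) / r t ^+ 2).
  pose Xr s := X s * cos (th t) + Y s * sin (th t).
  pose Yr s := Y s * cos (th t) - X s * sin (th t).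
  have dXr : is_derive t 1 Xr (X' t * cos (th t) + Y' t * sin (th t)).
    apply: (isD_eq (isD_add (isD_mul (dX t) (isD_cst t (cos (th t))))
       (isD_mul (dY t) (isD_cst t (sin (th t)))))).
    ring.
  have dYr : is_derive t 1 Yr (Y' t * cos (th t) - X' t * sin (th t)).
    apply: (isD_eq (isD_add (isD_mul (dY t) (isD_cst t (cos (th t))))
       (isD_opp (isD_mul (dX t) (isD_cst t (sin (th t))))))).
    ring.
  have c2 := cos2Dsin2 (th t).
  have Xrt : Xr t = r t.
    rewrite /Xr /X /Y /x /= -[RHS]mulr1 -c2; ring.
  have Yrt : Yr t = 0.
    rewrite /Yr /X /Y /x /=; ring.
  have Xrt0 : Xr t != 0 by rewrite Xrt gt_eqF.
  have d : is_derive t 1 (fun s => th t + atan (Yr s / Xr s))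
     ((X t * Y' t - Y t * X' t) / r t ^+ 2).
    apply: (isD_eq (isD_add (isD_cst t (th t)) (isD_atan (isD_mul dYr (isD_inv dXr Xrt0))))).
    rewrite Yrt Xrt /X /Y /x /=; field; by rewrite gt_eqF.
  apply: isD_near d.
  have pih : 0 < pi / 2 :> R by rewrite divr_gt0 ?pi_gt0.
  near=> s.
  have hs : `|th t - th s| < pi / 2.
    by near: s; exact: (cvgr_dist_lt th (th t) (cth t)).
  have e1 : Xr s = r s * cos (th s - th t).
    by rewrite /Xr /X /Y /x /= cosB; ring.
  have e2 : Yr s = r s * sin (th s - th t).
    by rewrite /Yr /X /Y /x /= sinB; ring.
  have -> : Yr s / Xr s = tan (th s - th t).
    rewrite e1 e2 /tan invfM mulrACA divff ?mul1r//; by rewrite gt_eqF.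
  rewrite tanK ?subrKC//.
  by rewrite in_itv/= -ltr_norml distrC.
pose gx : R -> R := fun t => (grad (homog_pot U al) (x t)).1.
pose gy : R -> R := fun t => (grad (homog_pot U al) (x t)).2.
have {}dX' (t : R) : is_derive t 1 X' (gx t) := dX' t.
have {}dY' (t : R) : is_derive t 1 Y' (gy t) := dY' t.
have {}eu t : X t * gx t + Y t * gy t = - al * (U (th t) / r t `^ al) := eu t.
clear sol en.
clearbody gx gy X' Y' X Y.
(* Here X X' + Y Y' = r r' and X Y' - Y X' = r^2 th', so these are r^(al/2) r' and r^(1 + al/2)
   th'. *)
pose v t := (X t * X' t + Y t * Y' t) * r t `^ (al / 2 - 1).
pose w t := (X t * Y' t - Y t * X' t) * r t `^ (al / 2 - 1).
exists v, w => t; have rt := r0 t; have rn : r t != 0 by rewrite gt_eqF.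
have [q0 q2 q3 q4 q5] := powR_halves al rt.
set q := r t `^ (al / 2) in q0 q2 q3 q4 q5.
split => //.
- apply: (isD_eq (dr t)); rewrite /v q3 q4; field; by rewrite rn q0.
- apply: (isD_eq (dth t)); rewrite /w q3 q5; field; by rewrite rn q0.
- apply: (isD_eq (isD_mul (isD_add (isD_mul (dX t) (dX' t)) (isD_mul (dY t) (dY' t)))
    (isD_powR (al / 2 - 1) (dr t) rt))).
  have -> : r t `^ (al / 2 - 1 - 1) = q / r t / r t.
    by rewrite powRB ?rn ?implybT// powRr1 ?q3// ltW.
  rewrite /w q3 q5.
  (* Lagrange-Jacobi identity: by Euler's identity and zero energy, x . x'' is [- al / 2] times
     |x'|^2. *)
  have -> : X' t * X' t + X t * gx t + (Y' t * Y' t + Y t * gy t) =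
     (1 - al / 2) * (X' t ^+ 2 + Y' t ^+ 2).
    transitivity (X' t ^+ 2 + Y' t ^+ 2 + (X t * gx t + Y t * gy t)); first by ring.
    by rewrite eu energy; field; rewrite powR_eq0 negb_and rn.
  rewrite (_ : X' t ^+ 2 + Y' t ^+ 2 =
    ((X t * X' t + Y t * Y' t) ^+ 2 + (X t * Y' t - Y t * X' t) ^+ 2) / r t ^+ 2).
    by field; rewrite rn q0.
  rewrite -r2; field.
  by rewrite r2 expf_neq0.
- split.
    transitivity ((X t ^+ 2 + Y t ^+ 2) * (X' t ^+ 2 + Y' t ^+ 2) *
       (q / r t) ^+ 2); first by rewrite /v /w q3; ring.
    rewrite r2 energy q2; field; by rewrite rn q0.
  exact: (isD_continuous (isD_mul (isD_add (isD_mul (dX t) (dY' t))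
    (isD_opp (isD_mul (dY t) (dX' t)))) (isD_powR (al / 2 - 1) (dr t) rt))).
Unshelve. all: by end_near.
Qed.

End Flow.

(** * Hitting times of continuous functions on a segment *)

Section Hitting.
Context {R : realType}.
Implicit Types (f : R -> R) (A : set R).

Lemma within_dist f A (t e : R) : {within A, continuous f} -> A t -> 0 < e ->
  exists2 d : R, 0 < d & forall s, A s -> `|t - s| < d -> `|f t - f s| < e.
Proof.
move=> /subspace_continuousP cf At e0.
have := cvgr_dist_lt f (f t) (cf t At) e e0.
by move=> [d /= d0 H]; exists d => // s As ts; exact: H.
Qed.

Lemma dist_within f A :
  (forall t, A t -> forall e : R, 0 < e ->
    exists2 d : R, 0 < d & forall s, A s -> `|t - s| < d -> `|f t - f s| < e) ->
  {within A, continuous f}.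
Proof.
move=> h; apply/subspace_continuousP => t At; apply/cvgrPdist_lt => e e0.
have [d d0 H] := h t At e e0.
by exists d => //= s ts As; exact: H.
Qed.

Lemma within_comp_itv f A (B : set R) (g : R -> R) :
  (forall t, B t -> A (g t)) -> {within B, continuous g} ->
  {within A, continuous f} -> {within B, continuous (fun t => f (g t))}.
Proof.
move=> BA cg cf; apply: dist_within => t Bt e e0.
have [d d0 H] := within_dist cf (BA t Bt) e0.
have [d' d0' H'] := within_dist cg Bt d0.
exists d' => // s Bs /(H' s Bs); exact: H (BA s Bs).
Qed.

Lemma first_hit f (a b c : R) : a <= b -> {within `[a, b], continuous f} ->
  f a < c -> c <= f b ->
  exists t, [/\ a < t, t <= b, f t = c & forall s, a <= s -> s < t -> f s < c].
Proof.
move=> ab cf fa fb.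
pose S := [set t | t \in `[a, b]%R /\ c <= f t].
have Sb : S b by split; rewrite // in_itv/= ab lexx.
have hS : has_inf S.
  by split; [exists b|exists a => t [/andP[]]].
pose t := inf S.
have at_ : a <= t by apply: lb_le_inf; [exists b|move=> s [/andP[]]].
have tb : t <= b by apply: ge_inf => //; case: hS.
have tab : t \in `[a, b]%R by rewrite in_itv/= at_ tb.
have below s : a <= s -> s < t -> f s < c.
  move=> as_ st; rewrite ltNge; apply/negP => cs.
  have : t <= s.
    apply: ge_inf; first by case: hS.
    by split => //; rewrite in_itv/= as_ (le_trans (ltW st)).
  by rewrite leNgt st.
have ft : c <= f t.
  rewrite leNgt; apply/negP => ftc.
  have e0 : 0 < c - f t by rewrite subr_gt0.
  have [d d0 H] := within_dist cf tab e0.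
  have [s [sab cs] std] := inf_adherent d0 hS.
  have ts : t <= s by apply: ge_inf => //; case: hS.
  have := H s sab; rewrite distrC ger0_norm ?subr_ge0// ltrBlDl => /(_ std).
  by rewrite distrC ltr_norml => /andP[_]; rewrite ltrD2r ltNge cs.
have ta : a < t.
  rewrite lt_neqAle at_ andbT; apply/eqP => ta.
  by move: ft; rewrite -ta leNgt fa.
exists t; split => //; apply/eqP; rewrite eq_le ft andbT.
have cf' : {within `[a, t], continuous f}.
  apply: continuous_subspaceW cf => s /=; rewrite !in_itv/= => /andP[-> st].
  exact: le_trans st tb.
have [|s sat fs] := IVT at_ cf' (v := c).
  by rewrite ge_min (ltW fa)/= le_max ft orbT.
move: sat; rewrite in_itv/= => /andP[as_].
rewrite le_eqVlt => /predU1P[<-|st]; first by rewrite fs.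
by have := below s as_ st; rewrite fs ltxx.
Qed.

Lemma last_hit f (a b c : R) : a <= b -> {within `[a, b], continuous f} ->
  f b < c -> c <= f a ->
  exists t, [/\ a <= t, t < b, f t = c & forall s, t < s -> s <= b -> f s < c].
Proof.
move=> ab cf fb fa.
have [||||t [h1 h2 h3 h4]] := @first_hit (fun t => f (- t)) (- b) (- a) c.
- by rewrite lerN2.
- apply: within_comp_itv cf => [t|].
    by rewrite /= !in_itv/= lerNl lerNr andbC.
  by apply: continuous_subspaceT => t; exact: opp_continuous.
- by rewrite opprK.
- by rewrite opprK.
exists (- t); split => //; [by rewrite lerNr|by rewrite ltrNl|].
move=> s ts sb; have := h4 (- s); rewrite opprK; apply; first by rewrite lerN2.
by rewrite ltrNl.
Qed.

End Hitting.

(** * Sign of the angular velocity inside the sector *)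

Section Heteroclinic.
Context {R : realType}.
Implicit Types U r th v w : R -> R.

(** Reduces a trajectory whose angle decreases from [thm] to [thp] to the increasing case. *)
Lemma flow_reverse U al r th v w t : zero_energy_flow U al r th v w (- t) ->
  zero_energy_flow U al (fun t => r (- t)) (fun t => th (- t))
    (fun t => - v (- t)) (fun t => - w (- t)) t.
Proof.
move=> [r0 dr dth dv [e cw]].
have dN : is_derive t 1 (fun t : R => - t) (-1) := isD_opp (isD_id t).
split => //.
- by apply: (isD_eq (isD_comp dN dr)); ring.
- by apply: (isD_eq (isD_comp dN dth)); ring.
- by apply: (isD_eq (isD_opp (isD_comp dN dv))); ring.
- split; first by rewrite -e; ring.
  apply: cvgN; apply: (@continuous_comp _ _ _ -%R w) => //.
  exact: opp_continuous.
Qed.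

Lemma flow_sector U al thm thp r th v w (a b : R) : 0 < al < 2 ->
  (forall t, {for t, continuous U}) ->
  (forall t, U thm <= U t) -> U thp = U thm -> 0 < U thm ->
  (forall t, zero_energy_flow U al r th v w t) ->
  th @ -oo --> thm -> th @ +oo --> thp -> thm < a -> a < b -> b < thp ->
  exists s0 s1, [/\ s0 < s1, th s0 = a, th s1 = b &
     forall s, s \in `[s0, s1]%R -> 0 < w s /\ a <= th s <= b].
Proof.
move=> /andP[al0 al2] cU Umin Up Um0 fl thN thP ma ab bp.
have g0 : 0 < 1 - al / 2 by rewrite subr_gt0 ltr_pdivrMr// mul1r.
have r0 t : 0 < r t by case: (fl t).
have pr p t : 0 < r t `^ p by rewrite powR_gt0.
have vw t : v t ^+ 2 + w t ^+ 2 = 2 * U (th t) by case: (fl t) => _ _ _ _ [].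
have dv (t : R) : is_derive t 1 v ((1 - al / 2) * w t ^+ 2 * r t `^ (- (1 + al / 2))).
  by case: (fl t).
have dth (t : R) : is_derive t 1 th (w t * r t `^ (- (1 + al / 2))) by case: (fl t).
have vmono s t : s <= t -> v s <= v t.
  move=> st; apply: (isD_le st (fun z _ => dv z)) => z _.
  by rewrite mulr_ge0 ?(ltW (pr _ _))// mulr_ge0 ?sqr_ge0// ltW.
have Ulim (F : set_system R) (l : R) : Filter F -> th x @[x --> F] --> l ->
    U (th x) @[x --> F] --> U l.
  by move=> FF h; apply: (@continuous_cvg _ _ _ F FF th U l) => //; exact: cU.
have vsq t : v t ^+ 2 <= 2 * U (th t) by rewrite -vw lerDl sqr_ge0.
(* At either end [U (th t)] tends to [U thm], so [v ^+ 2 <= 2 * U (th t)] excludes any larger bound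
   from below there. Monotonicity of [v] carries a too large positive value to [+oo] and a too large
   negative one to [-oo]. *)
have vlim (F : set_system R) (l : R) : ProperFilter F -> U l = U thm ->
    th x @[x --> F] --> l -> forall c, 2 * U thm < c ^+ 2 ->
    (\forall t \near F, c ^+ 2 <= v t ^+ 2) -> False.
  move=> FF Ul h c hc nv.
  have := Ulim _ _ (@filter_filter _ _ FF) h; rewrite Ul => hU.
  have nU : \forall t \near F, U (th t) < c ^+ 2 / 2.
    apply: (cvgr_lt (U thm) hU).
    by rewrite ltr_pdivlMr// mulrC.
  have /filter_ex[t [h1 h2]] : \forall t \near F,
      U (th t) < c ^+ 2 / 2 /\ c ^+ 2 <= v t ^+ 2 by exact: filterI.
  have := le_trans h2 (vsq t); rewrite leNgt => /negP; apply.
  by rewrite mulrC -ltr_pdivlMr.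
have vsup t : 0 <= v t -> v t ^+ 2 <= 2 * U thm.
  move=> v0; rewrite leNgt; apply/negP => h.
  apply: (vlim _ _ _ Up thP _ h).
  exists t; split; first exact: num_real.
  by move=> s /ltW /vmono ts; rewrite ler_pXn2r ?nnegrE// (le_trans v0).
have vinf t : v t <= 0 -> v t ^+ 2 <= 2 * U thm.
  move=> v0; rewrite leNgt; apply/negP => h.
  apply: (vlim _ _ _ erefl thN _ h).
  exists t; split; first exact: num_real.
  move=> s /ltW /vmono ts; rewrite -[leLHS]sqrrN -[leRHS]sqrrN.
  by rewrite ler_pXn2r ?nnegrE ?lerN2 ?oppr_ge0// (le_trans ts).
have thconst (lo hi : R) : lo <= hi -> (forall t, t \in `[lo, hi]%R -> w t = 0) ->
    th lo = th hi.
  rewrite le_eqVlt => /predU1P[->//|lh] h.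
  have [c clh e] := isD_MVT lh (fun t _ => dth t).
  move: e; rewrite h ?mul0r; last exact: subset_itv_oo_cc.
  by move/eqP; rewrite subr_eq0 => /eqP.
have weq0 (t : R) : (\forall s \near t, v s = v t) -> w t = 0.
  move=> h; have dc : is_derive t 1 v 0.
    have h' : \forall s \near t, v t = v s by apply: filterS h => s ->.
    exact: isD_near h' (isD_cst t (v t)).
  case: (dv t) => _ e1; case: dc => _ e2.
  have : (1 - al / 2) * w t ^+ 2 * r t `^ (- (1 + al / 2)) = 0 by rewrite -e1 e2.
  move/eqP; rewrite mulf_eq0 (gt_eqF (pr _ _)) orbF mulf_eq0 (gt_eqF g0)/=.
  by rewrite sqrf_eq0 => /eqP.
(* If [w t = 0], then [v t ^+ 2 = 2 * U (th t)] already reaches the extreme value [2 * U thm]. Being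
   monotone, [v] is then constant on a half-line, so [w] vanishes and [th] is constant there,
   against its limit at that end. *)
have wn0 t : thm < th t < thp -> w t != 0.
  move=> /andP[tm tp]; apply/eqP => w0.
  have vt : 2 * U thm <= v t ^+ 2.
    by have := vw t; rewrite w0 expr0n addr0 => ->; rewrite ler_pM2l.
  have [v0|v0] := leP 0 (v t).
    have vc s : t <= s -> v s = v t.
      move=> ts; have vs0 := le_trans v0 (vmono _ _ ts).
      apply/eqP; rewrite eq_le (vmono t s)// andbT.
      rewrite -(@ler_pXn2r _ 2)// ?nnegrE//.
      exact: le_trans (vsup _ vs0) vt.
    have ws s : t < s -> w s = 0.
      move=> ts; apply: weq0.
      have : \forall z \near s, t < z by exact: lt_nbhsr.
      apply: filterS => z tz; rewrite vc ?vc//; exact: ltW.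
    have thc s : t <= s -> th s = th t.
      move=> ts; symmetry; apply: thconst => // z; rewrite in_itv/= => /andP[].
      by rewrite le_eqVlt => /predU1P[<-//|/ws].
    have : \forall s \near +oo, th t < th s by exact: (cvgr_gt thp thP).
    move=> [T [_ hT]]; have := hT (Num.max T t + 1).
    rewrite (le_lt_trans (y := Num.max T t)) ?ltrDl ?le_max ?lexx// => /(_ isT).
    by rewrite thc ?ltxx// ler_wpDr// le_max lexx orbT.
  have vc s : s <= t -> v s = v t.
    move=> ts; have vs0 := le_trans (vmono _ _ ts) (ltW v0).
    apply/eqP; rewrite eq_le (vmono s t)//=.
    rewrite -lerN2 -(@ler_pXn2r _ 2)// ?nnegrE ?oppr_ge0//; last exact: ltW.
    by rewrite !sqrrN (le_trans (vinf _ vs0)).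
  have ws s : s < t -> w s = 0.
    move=> ts; apply: weq0.
    have : \forall z \near s, z < t by exact: lt_nbhsl.
    apply: filterS => z tz; rewrite vc ?vc//; exact: ltW.
  have thc s : s <= t -> th s = th t.
    move=> ts; apply: thconst => // z; rewrite in_itv/= => /andP[_].
    by rewrite le_eqVlt => /predU1P[->//|/ws].
  have : \forall s \near -oo, th s < th t by exact: (cvgr_lt thm thN).
  move=> [T [_ hT]]; have := hT (Num.min T t - 1).
  rewrite (lt_le_trans (y := Num.min T t)) ?ltrBlDr ?ltrDl ?ge_min ?lexx// => /(_ isT).
  by rewrite thc ?ltxx// lerBlDr ler_wpDr// ge_min lexx orbT.
have cth : continuous th by move=> t; exact: isD_continuous (dth t).
have [T0 [_ hT0]] : \forall t \near -oo, th t < a by exact: (cvgr_lt _ thN).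
have [T1 [_ hT1]] : \forall t \near +oo, b < th t by exact: (cvgr_gt _ thP).
pose t0 := Num.min (T0 - 1) (T1 - 1); pose t1 := T1 + 1.
have t00 : th t0 < a by apply: hT0; rewrite gt_min ltrBlDr ltrDl ltr01.
have t11 : b < th t1 by apply: hT1; rewrite ltrDl.
have t01 : t0 <= t1.
  rewrite ge_min; apply/orP; right; rewrite /t1; lra.
(* The first passage at [b], then the last passage at [a] before it: in between [th] stays in
   [[a, b]] although its monotonicity is not known yet. *)
have [s1 [ts1 s1t ths1 below]] := first_hit t01
  (continuous_subspaceT cth) (lt_trans t00 ab) (ltW t11).
have cNth : continuous (fun t => - th t) by move=> t; apply: cvgN; exact: cth.
have [||s0 [ts0 s01 ths0 above]] := last_hit (c := - a) (ltW ts1) (continuous_subspaceT cNth).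
- by rewrite ths1 ltrN2.
- by rewrite lerN2 ltW.
have {}ths0 : th s0 = a by apply: oppr_inj.
have sec s : s \in `[s0, s1]%R -> a <= th s <= b.
  rewrite in_itv/= => /andP[h0 h1]; apply/andP; split.
    move: h0; rewrite le_eqVlt => /predU1P[<-|h0]; first by rewrite ths0.
    by have := above s h0 h1; rewrite ltrN2 => /ltW.
  move: h1; rewrite le_eqVlt => /predU1P[->|h1]; first by rewrite ths1.
  by apply/ltW/below => //; exact: le_trans h0.
have wn s : s \in `[s0, s1]%R -> w s != 0.
  move=> /sec /andP[h1 h2]; apply: wn0.
  by rewrite (lt_le_trans ma h1) (le_lt_trans h2 bp).
exists s0, s1; split => // s ss; split; last exact: sec.
have cw : continuous w by move=> t; case: (fl t) => _ _ _ _ [].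
rewrite ltNge; apply/negP => ws.
(* A positive value of [w] elsewhere would give a zero by the intermediate value theorem; without
   any positive value [th] could not rise from [a] to [b]. *)
have [[z zs wz]|noz] := pselect (exists2 z, z \in `[s0, s1]%R & 0 < w z); last first.
  have := isD_le (ltW s01) (fun t _ => isD_opp (dth t)).
  rewrite ths0 ths1 lerN2 leNgt ab => h.
  suff : false by []; apply: h => t ht.
  rewrite -mulNr mulr_ge0 ?(ltW (pr _ _))// oppr_ge0 leNgt.
  by apply/negP => wt; apply: noz; exists t.
suff [y ys wy] : exists2 y, y \in `[s0, s1]%R & w y = 0.
  by have := wn _ ys; rewrite wy eqxx.
move: ss zs; rewrite !in_itv/= => /andP[ss1 ss2] /andP[zs1 zs2].
have [sz|sz] := leP s z.
  have h0 : Num.min (w s) (w z) <= 0 <= Num.max (w s) (w z).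
    by rewrite ge_min ws/= le_max (ltW wz) orbT.
  have [y] := IVT sz (continuous_subspaceT cw) h0.
  rewrite in_itv/= => /andP[h1 h2] wy; exists y => //.
  by rewrite in_itv/= (le_trans ss1 h1) (le_trans h2 zs2).
have h0 : Num.min (w z) (w s) <= 0 <= Num.max (w z) (w s).
  by rewrite ge_min ws orbT/= le_max (ltW wz).
have [y] := IVT (ltW sz) (continuous_subspaceT cw) h0.
rewrite in_itv/= => /andP[h1 h2] wy; exists y => //.
by rewrite in_itv/= (le_trans zs1 h1) (le_trans h2 ss2).
Unshelve. all: by end_near.
Qed.

End Heteroclinic.

(** * The parabolic trajectory as a graph over the angle *)

Section Leaf.
Context {R : realType}.
Implicit Types U r th v w : R -> R.

Lemma calU_derivable theta1 theta2 U : calU theta1 theta2 U ->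
  forall t : R, derivable U t 1.
Proof. by case=> -[dU _ _] _ _ _ _. Qed.

Lemma calU_continuous theta1 theta2 U : calU theta1 theta2 U ->
  forall t : R, {for t, continuous U}.
Proof.
move=> /calU_derivable dU t.
exact: (isD_continuous (DeriveDef (dU t) erefl)).
Qed.

Lemma calU_Theta theta1 theta2 U (a : R) : calU theta1 theta2 U ->
  Theta theta1 theta2 a -> U a = U theta1.
Proof.
move=> [_ per _ [e _] _] [n [->|->]].
  by rewrite mulrAC mulrC periodic_int.
by rewrite mulrAC mulrC periodic_int.
Qed.

(** A nonzero value is not the default of [xget], hence it is a member of the set. *)
Lemma alpha_bar_parabolic thm thp U : alpha_bar thm thp U != 0 ->
  exists r th, parabolic_trajectory U (alpha_bar thm thp U) thm thp r th.
Proof.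
rewrite /alpha_bar; case: xgetP => [al _ [_ h] _|_ /eqP //]; exact: h.
Qed.

Lemma parabolic_sector theta1 theta2 U thm thp (al a b : R) :
  calU theta1 theta2 U -> Theta theta1 theta2 thm -> Theta theta1 theta2 thp ->
  0 < al < 2 -> al = alpha_bar thm thp U ->
  Num.min thm thp < a -> a < b -> b < Num.max thm thp ->
  exists r th v w, (forall t, zero_energy_flow U al r th v w t) /\
   exists s0 s1, [/\ s0 < s1, th s0 = a, th s1 = b &
     forall s, s \in `[s0, s1]%R -> 0 < w s /\ a <= th s <= b].
Proof.
move=> hU Tm Tp hal eal ma ab bm.
have [_ per Umin [_ U0] _] := hU.
have cU := calU_continuous hU.
have al0 : alpha_bar thm thp U != 0 by rewrite -eal gt_eqF//; case/andP: hal.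
have [r [th par]] := alpha_bar_parabolic al0.
rewrite -eal in par.
have [v [w fl]] := parabolic_flow per (calU_derivable hU) par.
have [_ _ _ _ [thN thP]] := par.
have eUm := calU_Theta hU Tm; have eUp := calU_Theta hU Tp.
have [mp|pm] := leP thm thp.
  rewrite (min_idPl mp) in ma; rewrite (max_idPr mp) in bm.
  exists r, th, v, w; split => //.
  by apply: (flow_sector hal cU) thN thP ma ab bm; rewrite ?eUm ?eUp.
rewrite (min_idPr (ltW pm)) in ma; rewrite (max_idPl (ltW pm)) in bm.
exists (fun t => r (- t)), (fun t => th (- t)), (fun t => - v (- t)), (fun t => - w (- t)).
have fl' t := flow_reverse (fl (- t)).
split => //.
apply: (flow_sector hal cU _ _ _ fl') ma ab bm; rewrite ?eUm ?eUp//.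
  by apply/cvgNy_compNP; rewrite /comp; under eq_fun do rewrite /= opprK.
by apply/cvgy_compNP; rewrite /comp; under eq_fun do rewrite /= opprK.
Qed.

(* The leaf in terms of the angle: [sig] is the passage time, and
   [u = v / (1 - al / 2)] makes [r `^ (1 - al / 2) * u] a solution of the
   Hamilton-Jacobi equation whose characteristics are the rescaled leaves. *)
Lemma leaf_inverse U al r th v w (s0 s1 : R) : 0 < al < 2 -> s0 < s1 ->
  (forall t, zero_energy_flow U al r th v w t) ->
  (forall s, s \in `[s0, s1]%R -> 0 < w s) ->
  exists sig : R -> R, forall phi, th s0 < phi < th s1 ->
    [/\ sig phi \in `]s0, s1[%R, th (sig phi) = phi,
      {for phi, continuous sig} &
      is_derive phi 1 (fun x => v (sig x) / (1 - al / 2)) (w (sig phi))].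
Proof.
move=> /andP[al0 al2] s01 fl w0.
have g0 : 0 < 1 - al / 2 by rewrite subr_gt0 ltr_pdivrMr// mul1r.
have dth (t : R) : is_derive t 1 th (w t * r t `^ (- (1 + al / 2))) by case: (fl t).
have pr t p : 0 < r t `^ p by rewrite powR_gt0; case: (fl t).
have thlt s t : s \in `[s0, s1]%R -> t \in `[s0, s1]%R -> s < t -> th s < th t.
  rewrite !in_itv/= => /andP[h1 h2] /andP[h3 h4] st.
  apply: (isD_lt st (fun t _ => dth t)) => z; rewrite in_itv/= => /andP[sz zt].
  by rewrite mulr_gt0// w0// in_itv/= (le_trans h1 sz) (le_trans zt h4).
have thinj s t : s \in `[s0, s1]%R -> t \in `[s0, s1]%R -> th s = th t -> s = t.
  move=> hs ht e; have [st|ts|//] := ltgtP s t.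
    by have := thlt _ _ hs ht st; rewrite e ltxx.
  by have := thlt _ _ ht hs ts; rewrite e ltxx.
pose sig phi := xget 0 [set s | s \in `[s0, s1]%R /\ th s = phi].
have sigK s : s \in `[s0, s1]%R -> sig (th s) = s.
  move=> hs; rewrite /sig; case: xgetP => [t _ [ht e]|/(_ s)]; last by case.
  exact: thinj.
have cth : continuous th by move=> t; exact: isD_continuous (dth t).
exists sig => phi /andP[h0 h1].
have [s ss ths] : exists2 s, s \in `]s0, s1[%R & th s = phi.
  have hv : Num.min (th s0) (th s1) <= phi <= Num.max (th s0) (th s1).
    by rewrite ge_min (ltW h0) le_max (ltW h1) orbT.
  have [s] := IVT (ltW s01) (continuous_subspaceT cth) hv.
  rewrite in_itv/= => /andP[sa sb] e; exists s => //.
  rewrite in_itv/= !lt_neqAle sa sb !andbT; apply/andP; split; apply/eqP => E.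
    by move: h0; rewrite E e ltxx.
  by move: h1; rewrite -E e ltxx.
have ss' := subset_itv_oo_cc ss.
have es : sig phi = s by rewrite -ths sigK.
have nz : w s * r s `^ (- (1 + al / 2)) != 0.
  by rewrite gt_eqF// mulr_gt0// w0.
have dsig : is_derive phi 1 sig (w s * r s `^ (- (1 + al / 2)))^-1.
  rewrite -ths; apply: is_derive_inverse => //; last first.
    by near=> z; exact: cth.
  have : \forall z \near s, z \in `]s0, s1[%R by exact: near_in_itvoo.
  by apply: filterS => z /subset_itv_oo_cc; exact: sigK.
split; rewrite ?es//; first exact: isD_continuous dsig.
have [_ _ _ dv _] := fl s; rewrite -es in dv.
(* In the quotient v' / th' the powers of [r] cancel and [(1 - al / 2) * w] remains. *)
apply: (isD_eq (isD_mul (isD_comp dsig dv) (isD_cst phi (1 - al / 2)^-1))).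
rewrite es mulr0 addr0.
have p0 : r s `^ (- (1 + al / 2)) != 0 by rewrite gt_eqF.
have ws : w s != 0 by rewrite gt_eqF// w0.
have gn := lt0r_neq0 g0.
set p := r s `^ _ in p0 *; set g := 1 - al / 2 in gn *.
set ww := w s in ws *; clearbody p g ww.
by field; rewrite p0 ws gn.
Unshelve. all: by end_near.
Qed.

End Leaf.

(** * Affine changes of time and concatenation of paths *)

Section Affine.
Context {R : realType}.
Notation mu := (@lebesgue_measure R).
Variables (k c : R).
Hypothesis k0 : 0 < k.

Let phi : measurableTypeR R -> measurableTypeR R := fun t => k * t + c.

Let mphi : measurable_fun setT phi.
Proof.
apply: continuous_measurable_fun => t.
exact: (isD_continuous (isD_add (isD_scale k (isD_id t)) (isD_cst t c))).
Qed.

Let push : {measure set (measurableTypeR R) -> \bar R}.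
Proof. by refine (pushforward mu phi : {measure set _ -> \bar R}); exact: mphi. Defined.

Let kn : {nonneg R} := NngNum (ltW k0).

Let preimage_oc (x y : R) : phi @^-1` `]x, y] = `](x - c) / k, (y - c) / k].
Proof.
apply/seteqP; split => t; rewrite /phi /= !in_itv/=;
  by rewrite ltr_pdivrMr// ler_pdivlMr// ltrBlDr lerBrDr mulrC.
Qed.

Let preimage_cc (a b : R) : phi @^-1` `[k * a + c, k * b + c] = `[a, b].
Proof.
apply/seteqP; split => t; rewrite /phi /= !in_itv/=;
  by rewrite !lerD2r !ler_pM2l.
Qed.

(** By uniqueness of Lebesgue measure only half-open intervals have to be checked. The change of
    variables then is integration against a pushforward, valid for integrands that are merely
    measurable. *)
Let lebesgue_affine (A : set (measurableTypeR R)) : measurable A ->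
  mu A = mscale kn push A.
Proof.
move=> mA; apply: lebesgue_measure_unique => // X /ocitvP[->|[[x y]/= xy ->]].
  by rewrite !measure0.
rewrite /mscale /=/pushforward preimage_oc !lebesgue_measure_itv/= !lte_fin xy.
rewrite ltr_pM2r ?invr_gt0// ltrD2r xy -!EFinB -EFinM; congr EFin.
by field; rewrite gt_eqF.
Qed.

Lemma measurable_affine (a b : R) (f : R -> \bar R) :
  measurable_fun `[k * a + c, k * b + c] f ->
  measurable_fun `[a, b] (fun t => f (k * t + c)).
Proof.
move=> mf; apply: (measurable_comp _ _ mf) => //=.
  move=> _ [t /= tab <-].
  have : (phi @^-1` `[k * a + c, k * b + c]) t by rewrite preimage_cc.
  by [].
exact: measurable_funTS mphi.
Qed.

Lemma ge0_integral_affine (a b : R) (f : R -> \bar R) :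
  measurable_fun `[k * a + c, k * b + c] f ->
  (forall t, t \in `[k * a + c, k * b + c]%R -> (0 <= f t)%E) ->
  (\int[mu]_(t in `[(k * a + c)%R, (k * b + c)%R]) f t =
   k%:E * \int[mu]_(t in `[a, b]) f (k * t + c)%R)%E.
Proof.
move=> mf f0.
rewrite (eq_measure_integral (mscale kn push)); last first.
  by move=> A mA _; exact: lebesgue_affine.
rewrite ge0_integral_mscale//; congr (_ * _)%E.
rewrite ge0_integral_pushforward//; first by rewrite preimage_cc.
by move=> t; rewrite inE => /f0.
Qed.

Lemma integrable_affine (a b : R) (f : R -> \bar R) :
  mu.-integrable `[k * a + c, k * b + c] f ->
  mu.-integrable `[a, b] (fun t => f (k * t + c)).
Proof.
move=> /integrableP[mf finf]; apply/integrableP; split.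
  exact: measurable_affine.
move: finf; rewrite ge0_integral_affine//; last exact: measurableT_comp.
by rewrite !ltey; apply: contra => /eqP ->; rewrite gt0_muley ?lte_fin.
Qed.

Lemma integral_affine (a b : R) (f : R -> \bar R) :
  mu.-integrable `[k * a + c, k * b + c] f ->
  (\int[mu]_(t in `[(k * a + c)%R, (k * b + c)%R]) f t =
   k%:E * \int[mu]_(t in `[a, b]) f (k * t + c)%R)%E.
Proof.
move=> intf; have /integrableP[mf _] := intf.
have intf' := integrable_affine intf.
rewrite integralE [in RHS]integralE muleBr//; last first.
  by apply: fin_num_adde_defr; apply: integrable_pos_fin_num.
rewrite !ge0_integral_affine//.
- have -> := funepos_comp f phi.
  by have -> := funeneg_comp f phi.
- exact: measurable_funeneg.
- exact: measurable_funepos.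
Qed.

End Affine.

(** * Integrals over adjacent segments *)

Section Segments.
Context {R : realType}.
Notation mu := (@lebesgue_measure R).
Implicit Types (f : R -> \bar R) (g : R -> R).

Lemma segment_setU (a b c : R) : a <= b -> b <= c ->
  `[a, c]%classic = `[a, b] `|` `]b, c].
Proof. by move=> ab bc; rewrite -itv_bndbnd_setU// bnd_simp. Qed.

Lemma measurable_segment_cat (a b c : R) f : a <= b -> b <= c ->
  measurable_fun `[a, b] f -> measurable_fun `[b, c] f -> measurable_fun `[a, c] f.
Proof.
move=> ab bc m1 m2; rewrite (segment_setU ab bc); apply/measurable_funU => //.
by split => //; apply: measurable_funS m2 => //; exact: subset_itv_oc_cc.
Qed.

Lemma integral_segment_cat (a b c : R) f : a <= b -> b <= c ->
  measurable_fun `[a, c] f ->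
  (\int[mu]_(t in `[a, c]) f t =
   \int[mu]_(t in `[a, b]) f t + \int[mu]_(t in `[b, c]) f t)%E.
Proof.
move=> ab bc mf; have := mf; rewrite (segment_setU ab bc) => mf'.
rewrite integral_setU//; last first.
  apply/disj_setPS => t [] /=; rewrite !in_itv/= => /andP[_ tb] /andP[bt _].
  by move: (lt_le_trans bt tb); rewrite ltxx.
congr (_ + _)%E; apply: integral_itv_obnd_cbnd.
by move/measurable_funU : mf' => [].
Qed.

Lemma segment_sub (a b a' b' : R) : a <= a' -> b' <= b -> `[a', b'] `<=` `[a, b].
Proof.
move=> h1 h2 t /=; rewrite !in_itv/= => /andP[h3 h4].
by rewrite (le_trans h1 h3) (le_trans h4 h2).
Qed.

Lemma integrable_segmentS (a b a' b' : R) f : a <= a' -> b' <= b ->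
  mu.-integrable `[a, b] f -> mu.-integrable `[a', b'] f.
Proof. by move=> h1 h2; apply: integrableS => //; exact: segment_sub. Qed.

Lemma integral_degenerate (a : R) f : (\int[mu]_(t in `[a, a]) f t = 0)%E.
Proof. by rewrite set_itv1 integral_set1. Qed.

Lemma integral_segment_cst (a b c : R) : a <= b ->
  (\int[mu]_(t in `[a, b]) c%:E = (c * (b - a))%:E)%E.
Proof.
move=> ab; rewrite integral_cst//= lebesgue_measure_itv/= lte_fin.
move: ab; rewrite le_eqVlt => /predU1P[->|->]; last by rewrite EFinM.
by rewrite ltxx mule0 subrr mulr0.
Qed.

Lemma integrable_segment_cst (a b c : R) : mu.-integrable `[a, b] (fun=> c%:E).
Proof.
apply: measurable_bounded_integrable => //.
  by rewrite /= lebesgue_measure_itv/=; case: ifP => // _; rewrite -EFinB ltry.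
by exists `|c|; split => // x xc t _ /=; exact: ltW.
Qed.

Lemma integrable_segment_continuous (a b : R) g :
  {within `[a, b], continuous g} -> mu.-integrable `[a, b] (EFin \o g).
Proof.
by move=> cg; apply: continuous_compact_integrable => //; exact: segment_compact.
Qed.

Lemma integral_FTC (a b : R) F g : a <= b ->
  (forall t, t \in `[a, b]%R -> is_derive t 1 F (g t)) ->
  {within `[a, b], continuous g} ->
  (\int[mu]_(t in `[a, b]) (g t)%:E = (F b - F a)%:E)%E.
Proof.
rewrite le_eqVlt => /predU1P[<- _ _|ab dF cg].
  by rewrite integral_degenerate subrr.
have cF t : t \in `[a, b]%R -> {for t, continuous F}.
  by move=> /dF; exact: isD_continuous.
rewrite (@continuous_FTC2 _ g F a b) ?EFinB//.
  split.
  - by move=> t /subset_itv_oo_cc/dF[].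
  - apply: cvg_at_right_filter; apply: cF; by rewrite in_itv/= lexx ltW.
  - apply: cvg_at_left_filter; apply: cF; by rewrite in_itv/= lexx ltW.
by move=> t /subset_itv_oo_cc/dF[_ <-]; rewrite derive1E.
Qed.

End Segments.

Section Concatenation.
Context {R : realType}.
Notation mu := (@lebesgue_measure R).

(** At [b] the first function wins; this matters for velocities, whose one-sided values at the
    junction are unrelated. *)
Definition cat_at {T : Type} (b : R) (f f' : R -> T) : R -> T :=
  fun t => if t <= b then f t else f' t.

Lemma cat_atl {T : Type} (a b : R) (f f' : R -> T) (t : R) :
  t \in `[a, b]%R -> cat_at b f f' t = f t.
Proof. by rewrite in_itv/= /cat_at => /andP[_ ->]. Qed.

Lemma cat_ator {T : Type} (b c : R) (f f' : R -> T) (t : R) :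
  t \in `]b, c]%R -> cat_at b f f' t = f' t.
Proof. by rewrite in_itv/= /cat_at => /andP[bt _]; rewrite leNgt bt. Qed.

Lemma cat_atr {T : Type} (b c : R) (f f' : R -> T) (t : R) : f b = f' b ->
  t \in `[b, c]%R -> cat_at b f f' t = f' t.
Proof.
rewrite in_itv/= /cat_at => e /andP[bt _]; case: ifPn => // tb.
by have -> : t = b by apply/eqP; rewrite eq_le bt tb.
Qed.

Implicit Types (f g : R -> \bar R).

(** Adding the end point [a] does not affect measurability. Agreement on []a, b]] is all that
    [cat_at] provides on its right-hand piece. *)
Lemma measurable_segment_ext (a b : R) f g :
  (forall t, t \in `]a, b]%R -> f t = g t) ->
  measurable_fun `[a, b] f -> measurable_fun `[a, b] g.
Proof.
move=> e /emeasurable_fun_itv_obnd_cbndP mf.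
apply/emeasurable_fun_itv_obnd_cbndP; apply: eq_measurable_fun mf => t.
by rewrite inE; exact: e.
Qed.

Lemma integral_segment_ext (a b : R) f g :
  (forall t, t \in `]a, b]%R -> f t = g t) ->
  measurable_fun `[a, b] f ->
  (\int[mu]_(t in `[a, b]) f t = \int[mu]_(t in `[a, b]) g t)%E.
Proof.
move=> e mf; have mg := measurable_segment_ext e mf.
rewrite -integral_itv_obnd_cbnd; last exact/emeasurable_fun_itv_obnd_cbndP.
rewrite -[RHS]integral_itv_obnd_cbnd; last exact/emeasurable_fun_itv_obnd_cbndP.
by apply: eq_integral => t; rewrite inE => /e.
Qed.

Lemma measurable_cat_at (a b c : R) f g : a <= b -> b <= c ->
  measurable_fun `[a, b] f -> measurable_fun `[b, c] g ->
  measurable_fun `[a, c] (cat_at b f g).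
Proof.
move=> ab bc mf mg; apply: (measurable_segment_cat ab bc).
  by apply: eq_measurable_fun mf => t; rewrite inE => tab; rewrite (cat_atl _ _ tab).
by apply: measurable_segment_ext mg => t tbc; rewrite (cat_ator _ _ tbc).
Qed.

Lemma integral_cat_at (a b c : R) f g : a <= b -> b <= c ->
  measurable_fun `[a, b] f -> measurable_fun `[b, c] g ->
  (\int[mu]_(t in `[a, c]) cat_at b f g t =
   \int[mu]_(t in `[a, b]) f t + \int[mu]_(t in `[b, c]) g t)%E.
Proof.
move=> ab bc mf mg.
rewrite (integral_segment_cat ab bc); last exact: measurable_cat_at.
congr (_ + _)%E.
  by apply: eq_integral => t; rewrite inE => tab; rewrite (cat_atl _ _ tab).
symmetry; apply: integral_segment_ext => // t tbc.
by rewrite (cat_ator _ _ tbc).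
Qed.

Lemma integrable_cat_at (a b c : R) f g : a <= b -> b <= c ->
  mu.-integrable `[a, b] f -> mu.-integrable `[b, c] g ->
  mu.-integrable `[a, c] (cat_at b f g).
Proof.
move=> ab bc /integrableP[m1 i1] /integrableP[m2 i2].
have m := measurable_cat_at ab bc m1 m2.
apply/integrableP; split => //.
have -> : (fun x => `|cat_at b f g x|%E) =
    cat_at b (fun x => `|f x|%E) (fun x => `|g x|%E).
  by apply/funext => x; rewrite /cat_at; case: ifP.
rewrite (integral_cat_at ab bc); try exact: measurableT_comp.
exact: lte_add_pinfty.
Qed.

End Concatenation.

(** * Functions and paths of class H^1: restriction, concatenation, change of time *)

Section H1.
Context {R : realType}.
Notation mu := (@lebesgue_measure R).
Implicit Types (f g : R -> R).

(** On a bounded segment [1 + g ^+ 2] is integrable, and it dominates [g]. *)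
Lemma H1_deriv_integrable (a b : R) f g : H1_deriv a b f g ->
  mu.-integrable `[a, b] (fun t => (g t)%:E).
Proof.
move=> [mg ig _].
have i1 : mu.-integrable `[a, b] (fun t => 1%:E + (g t ^+ 2)%:E)%E.
  by apply: integrableD => //; exact: integrable_segment_cst.
apply: le_integrable i1 => //; first exact/measurable_EFinP.
move=> t _; rewrite -EFinD !abse_EFin lee_fin.
rewrite (@ger0_norm _ (1 + _)); last by rewrite addr_ge0// sqr_ge0.
rewrite -(real_normK (num_real (g t))); set x := `|g t|.
have := sqr_ge0 (x - 1); have : 0 <= x by exact: normr_ge0.
by move=> x0 h; nra.
Qed.

Lemma H1_deriv_increment (a b s t : R) f g : a <= s -> s <= t -> t <= b ->
  H1_deriv a b f g ->
  (\int[mu]_(x in `[s, t]) (g x)%:E = (f t - f s)%:E)%E.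
Proof.
move=> as_ st tb h; have ig := H1_deriv_integrable h; have [_ _ hf] := h.
have key x : x \in `[a, b]%R ->
    (\int[mu]_(y in `[a, x]) (g y)%:E = (f x - f a)%:E)%E.
  move=> xab; rewrite (hf _ xab) addrAC subrr add0r /Rintegral fineK//.
  apply: integrable_fin_num => //; apply: integrable_segmentS ig => //.
  by move: xab; rewrite in_itv/= => /andP[].
have tab : t \in `[a, b]%R by rewrite in_itv/= (le_trans as_ st).
have sab : s \in `[a, b]%R by rewrite in_itv/= as_ (le_trans st).
have := key t tab; rewrite (integral_segment_cat as_ st); last first.
  by case/integrableP: (integrable_segmentS (lexx a) tb ig).
rewrite (key s sab); set I := integral _ _ _ => e.
have -> : I = ((f s - f a)%:E + I - (f s - f a)%:E)%E.
  by rewrite addeAC subee// add0e.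
by rewrite e -EFinB; congr EFin; ring.
Qed.

Lemma H1_deriv_intro (a b : R) f g : a <= b ->
  measurable_fun `[a, b] g ->
  mu.-integrable `[a, b] (fun t => (g t ^+ 2)%:E) ->
  (forall t, t \in `[a, b]%R ->
    (\int[mu]_(x in `[a, t]) (g x)%:E = (f t - f a)%:E)%E) ->
  H1_deriv a b f g.
Proof.
move=> ab mg ig h; split => // t tab.
by rewrite /Rintegral h//= subrKC.
Qed.

Lemma H1_deriv_sub (a b a' b' : R) f g : a <= a' -> a' <= b' -> b' <= b ->
  H1_deriv a b f g -> H1_deriv a' b' f g.
Proof.
move=> aa ab bb h; have [mg ig _] := h; apply: H1_deriv_intro => //.
- by apply: measurable_funS mg => //; exact: segment_sub.
- exact: integrable_segmentS ig.
- move=> t; rewrite in_itv/= => /andP[at_ tb].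
  by apply: (H1_deriv_increment _ _ _ h) => //; exact: le_trans bb.
Qed.

Lemma measurable_cat_atR (a b c : R) g g' : a <= b -> b <= c ->
  measurable_fun `[a, b] g -> measurable_fun `[b, c] g' ->
  measurable_fun `[a, c] (cat_at b g g').
Proof.
move=> ab bc m1 m2; apply/measurable_EFinP.
have -> : EFin \o cat_at b g g' = cat_at b (EFin \o g) (EFin \o g').
  by apply/funext => t; rewrite /cat_at /=; case: ifP.
by apply: measurable_cat_at => //; exact/measurable_EFinP.
Qed.

Lemma H1_deriv_cat (a b c : R) f g f' g' : a <= b -> b <= c ->
  H1_deriv a b f g -> H1_deriv b c f' g' -> f b = f' b ->
  H1_deriv a c (cat_at b f f') (cat_at b g g').
Proof.
move=> ab bc h h' e; have [mg ig _] := h; have [mg' ig' _] := h'.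
apply: H1_deriv_intro; first exact: le_trans bc.
- exact: measurable_cat_atR.
- have -> : (fun t => (cat_at b g g' t ^+ 2)%:E) =
     cat_at b (fun t => (g t ^+ 2)%:E) (fun t => (g' t ^+ 2)%:E).
    by apply/funext => t; rewrite /cat_at /=; case: ifP.
  exact: integrable_cat_at.
- move=> t; rewrite in_itv/= => /andP[at_ tc].
  have -> : (fun t => (cat_at b g g' t)%:E) =
     cat_at b (fun t => (g t)%:E) (fun t => (g' t)%:E).
    by apply/funext => s; rewrite /cat_at /=; case: ifP.
  have ea : cat_at b f f' a = f a by rewrite /cat_at ab.
  have [tb|/ltW bt] := leP t b.
    rewrite ea /cat_at tb -(H1_deriv_increment (lexx a) at_ tb h).
    apply: eq_integral => s; rewrite inE/= in_itv/= => /andP[_ st].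
    by rewrite (le_trans st tb).
  have mgE := measurable_funS _ (segment_sub (lexx b) tc) mg'.
  rewrite (integral_cat_at ab bt); last 2 first.
  - exact/measurable_EFinP.
  - by apply/measurable_EFinP; exact: mgE.
  rewrite (H1_deriv_increment (lexx a) ab (lexx b) h).
  rewrite (H1_deriv_increment (lexx b) bt tc h') ea.
  rewrite (@cat_atr _ _ b t) ?in_itv/= ?bt ?lexx// -EFinD e.
  by congr EFin; ring.
Qed.

Lemma H1_deriv_affine (k c a b : R) f g : 0 < k -> a <= b ->
  H1_deriv (k * a + c) (k * b + c) f g ->
  H1_deriv a b (fun t => f (k * t + c)) (fun t => k * g (k * t + c)).
Proof.
move=> k0 ab h; have [mg ig _] := h.
have mono (x y : R) : x <= y -> k * x + c <= k * y + c.
  by move=> xy; rewrite lerD2r ler_pM2l.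
have ig' := H1_deriv_integrable h.
apply: H1_deriv_intro => //.
- have /measurable_EFinP m1 : measurable_fun `[a, b] (EFin \o (fun t => g (k * t + c))).
    by apply: (@measurable_affine _ k c k0 a b (EFin \o g)); exact/measurable_EFinP.
  exact: measurable_funM.
- have -> : (fun t => ((k * g (k * t + c)) ^+ 2)%:E) =
     (fun t => (k ^+ 2)%:E * (g (k * t + c) ^+ 2)%:E)%E.
    by apply/funext => t; rewrite exprMn EFinM.
  apply: integrableZl => //.
  exact: (@integrable_affine _ k c k0 a b (fun t => (g t ^+ 2)%:E)).
- move=> t; rewrite in_itv/= => /andP[at_ tb].
  have igt := integrable_segmentS (lexx _) (mono _ _ tb) ig'.
  under eq_integral do rewrite EFinM.
  rewrite integralZl//; last exact: (@integrable_affine _ k c k0 a t (fun t => (g t)%:E)).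
  rewrite -(@integral_affine _ k c k0 a t (fun t => (g t)%:E))//.
  exact: (H1_deriv_increment (lexx _) (mono _ _ at_) (mono _ _ tb) h).
Qed.

Lemma H1_deriv_C1 (a b : R) f g : a <= b ->
  (forall t, t \in `[a, b]%R -> is_derive t 1 f (g t)) ->
  {within `[a, b], continuous g} -> H1_deriv a b f g.
Proof.
move=> ab df cg.
have cg2 : {within `[a, b], continuous (fun t => g t ^+ 2)}.
  have -> : (fun t => g t ^+ 2) = (fun t => g t * g t).
    by apply/funext => t; rewrite expr2.
  by move=> t; apply: cvgM; exact: cg.
apply: H1_deriv_intro => //.
- apply/measurable_EFinP.
  by case/integrableP: (integrable_segment_continuous cg).
- exact: (integrable_segment_continuous cg2).
- move=> t; rewrite in_itv/= => /andP[at_ tb].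
  apply: integral_FTC => //.
    by move=> s; rewrite in_itv/= => /andP[h1 h2]; apply: df;
      rewrite in_itv/= h1 (le_trans h2).
  apply: continuous_subspaceW cg; exact: segment_sub.
Qed.

Lemma H1_deriv_continuous (a b : R) f g : a <= b -> H1_deriv a b f g ->
  {within `[a, b], continuous f}.
Proof.
move=> ab h; have ig := H1_deriv_integrable h; have [_ _ hf] := h.
have c := parameterized_integral_continuous ab ig.
have c' : {within `[a, b], continuous
   (fun t => f a + parameterized_integral mu a t g)}.
  move=> t; apply: cvgD; first exact: cvg_cst.
  exact: c.
apply: subspace_eq_continuous c' => t; rewrite inE => tab.
by symmetry; exact: hf.
Qed.

End H1.

Section Paths.
Context {R : realType}.
Notation mu := (@lebesgue_measure R).
Implicit Types (r th : R -> R) (v : R -> R * R) (V : R * R -> R).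

Lemma H1_path_sub (a b a' b' : R) r th v : a <= a' -> a' <= b' -> b' <= b ->
  H1_path a b r th v -> H1_path a' b' r th v.
Proof.
move=> aa ab bb [r0 cth h1 h2]; split.
- by move=> t /(segment_sub aa bb); exact: r0.
- by apply: continuous_subspaceW cth => t [/(segment_sub aa bb)].
- exact: H1_deriv_sub h1.
- exact: H1_deriv_sub h2.
Qed.

Lemma polar_cat (b : R) r th r' th' :
  (fun t => polar (cat_at b r r' t) (cat_at b th th' t)) =
  cat_at b (fun t => polar (r t) (th t)) (fun t => polar (r' t) (th' t)).
Proof. by apply/funext => t; rewrite /cat_at; case: ifP. Qed.

(** The equality [th b = th' b] keeps the lifted angle continuous across the junction; equality of
    the two points alone would allow a jump by a multiple of [2 * pi]. *)
Lemma H1_path_cat (a b c : R) r th v r' th' v' : a <= b -> b <= c ->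
  H1_path a b r th v -> H1_path b c r' th' v' -> r b = r' b -> th b = th' b ->
  H1_path a c (cat_at b r r') (cat_at b th th') (cat_at b v v').
Proof.
move=> ab bc [r0 cth h1 h2] [r0' cth' h1' h2'] er eth.
have itvl t : t \in `[a, c]%R -> t <= b -> t \in `[a, b]%R.
  by rewrite !in_itv/= => /andP[-> _] ->.
have itvr t : t \in `[a, c]%R -> b <= t -> t \in `[b, c]%R.
  by rewrite !in_itv/= => /andP[_ ->] ->.
split.
- move=> t tac; have [tb|/ltW bt] := leP t b.
    by rewrite /cat_at tb r0// itvl.
  by rewrite (cat_atr er (itvr _ tac bt)) r0'// itvr.
- apply: dist_within => t [tac rt] e e0.
  have L : t <= b -> exists2 d, 0 < d & forall s, s \in `[a, c]%R ->
      0 < cat_at b r r' s -> s <= b -> `|t - s| < d ->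
      `|cat_at b th th' t - cat_at b th th' s| < e.
    move=> tb; rewrite /cat_at tb in rt.
    have [d d0 H] := within_dist cth (conj (itvl _ tac tb) rt) e0.
    exists d => // s sac + sb ts; rewrite /cat_at tb sb => rs.
    exact: H (conj (itvl _ sac sb) rs) ts.
  have Rr : b <= t -> exists2 d, 0 < d & forall s, s \in `[a, c]%R ->
      0 < cat_at b r r' s -> b <= s -> `|t - s| < d ->
      `|cat_at b th th' t - cat_at b th th' s| < e.
    move=> bt; rewrite (cat_atr er (itvr _ tac bt)) in rt.
    have [d d0 H] := within_dist cth' (conj (itvr _ tac bt) rt) e0.
    exists d => // s sac + bs ts.
    rewrite (cat_atr er (itvr _ sac bs)) (cat_atr eth (itvr _ sac bs)).
    rewrite (cat_atr eth (itvr _ tac bt)) => rs.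
    exact: H (conj (itvr _ sac bs) rs) ts.
  have [tb|bt|tb] := ltgtP t b.
  + have [d d0 H] := L (ltW tb).
    exists (Num.min d (b - t)); first by rewrite lt_min d0 subr_gt0.
    move=> s [sac rs]; rewrite lt_min => /andP[ts ts'].
    apply: H => //; move: ts'; rewrite distrC => /ltr_normlP[_]; lra.
  + have [d d0 H] := Rr (ltW bt).
    exists (Num.min d (t - b)); first by rewrite lt_min d0 subr_gt0.
    move=> s [sac rs]; rewrite lt_min => /andP[ts ts'].
    apply: H => //; move: ts' => /ltr_normlP[_]; lra.
  + have tb1 : t <= b by rewrite tb.
    have tb2 : b <= t by rewrite tb.
    have [d d0 H] := L tb1; have [d' d0' H'] := Rr tb2.
    exists (Num.min d d'); first by rewrite lt_min d0.
    move=> s [sac rs]; rewrite lt_min => /andP[ts ts'].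
    by have [sb|/ltW bs] := leP s b; [exact: H|exact: H'].
- rewrite [X in H1_deriv _ _ X _](_ : _ = cat_at b (fun t => (polar (r t) (th t)).1)
    (fun t => (polar (r' t) (th' t)).1)); last first.
    by apply/funext => t; rewrite /cat_at; case: ifP.
  rewrite [X in H1_deriv _ _ _ X](_ : _ = cat_at b (fun t => (v t).1)
    (fun t => (v' t).1)); last first.
    by apply/funext => t; rewrite /cat_at; case: ifP.
  by apply: H1_deriv_cat; rewrite ?er ?eth.
- rewrite [X in H1_deriv _ _ X _](_ : _ = cat_at b (fun t => (polar (r t) (th t)).2)
    (fun t => (polar (r' t) (th' t)).2)); last first.
    by apply/funext => t; rewrite /cat_at; case: ifP.
  rewrite [X in H1_deriv _ _ _ X](_ : _ = cat_at b (fun t => (v t).2)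
    (fun t => (v' t).2)); last first.
    by apply/funext => t; rewrite /cat_at; case: ifP.
  by apply: H1_deriv_cat; rewrite ?er ?eth.
Qed.

Lemma H1_path_affine (k c a b : R) r th v : 0 < k -> a <= b ->
  H1_path (k * a + c) (k * b + c) r th v ->
  H1_path a b (fun t => r (k * t + c)) (fun t => th (k * t + c))
    (fun t => (k * (v (k * t + c)).1, k * (v (k * t + c)).2)).
Proof.
move=> k0 ab [r0 cth h1 h2].
have itv t : t \in `[a, b]%R -> (k * t + c) \in `[k * a + c, k * b + c]%R.
  by rewrite !in_itv/= !lerD2r !ler_pM2l.
split.
- by move=> t /itv; exact: r0.
- apply: (@within_comp_itv _ th _ _ (fun t => k * t + c)) cth.
    by move=> t [/itv].
  apply: continuous_subspaceT => t.
  exact: (isD_continuous (isD_add (isD_scale k (isD_id t)) (isD_cst t c))).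
- exact: (H1_deriv_affine k0 ab h1).
- exact: (H1_deriv_affine k0 ab h2).
Qed.

Definition polar_velocity (r dr th dth : R -> R) (t : R) : R * R :=
  (dr t * cos (th t) - r t * dth t * sin (th t),
   dr t * sin (th t) + r t * dth t * cos (th t)).

Lemma enorm_polar_velocity r dr th dth (t : R) :
  enorm (polar_velocity r dr th dth t) ^+ 2 = dr t ^+ 2 + (r t * dth t) ^+ 2.
Proof.
rewrite sqr_enorm /polar_velocity /=; have c2 := cos2Dsin2 (th t).
by rewrite -[RHS]mulr1 -c2; ring.
Qed.

Lemma H1_path_C1 (a b : R) r dr th dth : a <= b ->
  (forall t, t \in `[a, b]%R -> [/\ 0 <= r t, is_derive t 1 r (dr t) &
    is_derive t 1 th (dth t)]) ->
  {within `[a, b], continuous dr} -> {within `[a, b], continuous dth} ->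
  H1_path a b r th (polar_velocity r dr th dth).
Proof.
move=> ab h cdr cdth.
have cr : {within `[a, b], continuous r}.
  by apply: derivable_within_continuous => t /h[_ []].
have cth : {within `[a, b], continuous th}.
  by apply: derivable_within_continuous => t /h[_ _ []].
have ccos : {within `[a, b], continuous (fun t => cos (th t))}.
  by move=> t; apply: continuous_cvg (cth t); exact: continuous_cos.
have csin : {within `[a, b], continuous (fun t => sin (th t))}.
  by move=> t; apply: continuous_cvg (cth t); exact: continuous_sin.
split.
- by move=> t /h[].
- by apply: continuous_subspaceW cth => t [].
- apply: H1_deriv_C1 => //.
    move=> t /h[_ h1 h2]; rewrite /polar /=.
    apply: (isD_eq (isD_mul h1 (isD_cos h2))); rewrite /polar_velocity/=; ring.
  move=> t; rewrite /polar_velocity /=; apply: cvgB.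
    by apply: cvgM; [exact: cdr|exact: ccos].
  by apply: cvgM; [apply: cvgM; [exact: cr|exact: cdth]|exact: csin].
- apply: H1_deriv_C1 => //.
    move=> t /h[_ h1 h2]; rewrite /polar /=.
    apply: (isD_eq (isD_mul h1 (isD_sin h2))); rewrite /polar_velocity/=; ring.
  move=> t; rewrite /polar_velocity /=; apply: cvgD.
    by apply: cvgM; [exact: cdr|exact: csin].
  by apply: cvgM; [apply: cvgM; [exact: cr|exact: cdth]|exact: ccos].
Qed.

End Paths.

(** * Kinetic and potential parts of the action *)

Section Lagrangian.
Context {R : realType}.
Notation mu := (@lebesgue_measure R).
Implicit Types (r th : R -> R) (v x : R -> R * R) (V : R * R -> R).

Definition kinetic v (t : R) : \bar R := (2^-1 * enorm (v t) ^+ 2)%:E.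

Lemma kinetic_ge0 v t : (0 <= kinetic v t)%E.
Proof. by rewrite lee_fin mulr_ge0 ?sqr_ge0. Qed.

Lemma kinetic_integrable (a b : R) r th v : H1_path a b r th v ->
  mu.-integrable `[a, b] (kinetic v).
Proof.
move=> [_ _ [_ i1 _] [_ i2 _]].
have -> : kinetic v = (fun t => (2^-1)%:E *
    (((v t).1 ^+ 2)%:E + ((v t).2 ^+ 2)%:E))%E.
  by apply/funext => t; rewrite /kinetic sqr_enorm.
by apply: integrableZl => //; exact: integrableD.
Qed.

Lemma H1_path_continuous (a b : R) r th v : a <= b -> H1_path a b r th v ->
  forall t, t \in `[a, b]%R ->
  polar (r s) (th s) @[s --> within `[a, b] (nbhs t)] --> polar (r t) (th t).
Proof.
move=> ab [_ _ h1 h2] t tab.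
have /subspace_continuousP c1 := H1_deriv_continuous ab h1.
have /subspace_continuousP c2 := H1_deriv_continuous ab h2.
exact: cvg_pair (c1 t tab) (c2 t tab).
Qed.

Lemma enorm_continuous : continuous (@enorm R).
Proof.
move=> x; rewrite /enorm; apply: continuous_cvg; first exact: sqrt_continuous.
apply: cvgD.
  rewrite expr2; under eq_fun do rewrite expr2.
  by apply: cvgM; exact: cvg_fst.
rewrite expr2; under eq_fun do rewrite expr2.
by apply: cvgM; exact: cvg_snd.
Qed.

Lemma radius_continuous (a b : R) r th v : a <= b -> H1_path a b r th v ->
  {within `[a, b], continuous r}.
Proof.
move=> ab h; have [r0 _ _ _] := h.
have c : {within `[a, b], continuous (fun t => enorm (polar (r t) (th t)))}.
  apply/subspace_continuousP => t tab.
  by apply: continuous_cvg (H1_path_continuous ab h tab); exact: enorm_continuous.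
apply: subspace_eq_continuous c => t; rewrite inE => tab.
exact: (enorm_polar (th t) (r0 t tab)).
Qed.

Lemma C1_punctured_continuous V (y : R * R) : C1_punctured V -> y != 0 ->
  {for y, continuous V}.
Proof. by move=> h /h[/differentiable_continuous]. Qed.

(** On the zero set of [r] the integrand is constantly [+oo]; on the rest of the segment it is
    continuous. *)
Lemma potential_measurable (a b : R) V r th v : a <= b -> C1_punctured V ->
  H1_path a b r th v ->
  measurable_fun `[a, b] (fun t => pot_ext V (polar (r t) (th t))).
Proof.
move=> ab hV h; have cr := radius_continuous ab h.
have mr : measurable_fun `[a, b] r.
  by apply: subspace_continuous_measurable_fun.
pose Z := `[a, b] `&` r @^-1` [set 0].
pose D := `[a, b] `&` r @^-1` (~` [set 0]).
have mZ : measurable Z by apply: mr => //; exact: measurable_set1.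
have mD : measurable D by apply: mr => //; apply: measurableC; exact: measurable_set1.
have e : `[a, b]%classic = Z `|` D by rewrite -setIUr -preimage_setU setUv preimage_setT setIT.
rewrite e; apply/measurable_funU => //; split.
  apply: (eq_measurable_fun (cst +oo%E)) => //.
  by move=> t; rewrite inE => -[_ /= rt]; rewrite /pot_ext polar_eq0 rt eqxx.
apply: (eq_measurable_fun (EFin \o (fun t => V (polar (r t) (th t))))).
  move=> t; rewrite inE => -[_ /= rt]; rewrite /pot_ext polar_eq0.
  by case: ifPn => // /eqP.
apply/measurable_EFinP; apply: subspace_continuous_measurable_fun => //.
apply/subspace_continuousP => t [tab /= rt].
have := H1_path_continuous ab h tab => c.
have c' : polar (r s) (th s) @[s --> within D (nbhs t)] --> polar (r t) (th t).
  apply: cvg_trans c; apply: cvg_app; apply: within_subset.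
  by move=> s [].
by apply: continuous_cvg c'; apply: C1_punctured_continuous => //; rewrite polar_eq0; apply/eqP.
Qed.

Lemma lagrangian_measurable (a b : R) V r th v : a <= b -> C1_punctured V ->
  H1_path a b r th v ->
  measurable_fun `[a, b] (fun t => (kinetic v t + pot_ext V (polar (r t) (th t)))%E).
Proof.
move=> ab hV h; apply: emeasurable_funD; last exact: (potential_measurable ab hV h).
by case/integrableP: (kinetic_integrable h).
Qed.

Lemma action_cat (a b c : R) V x v x' v' : a <= b -> b <= c ->
  measurable_fun `[a, b] (fun t => (kinetic v t + pot_ext V (x t))%E) ->
  measurable_fun `[b, c] (fun t => (kinetic v' t + pot_ext V (x' t))%E) ->
  (action V a c (cat_at b x x') (cat_at b v v') =
   action V a b x v + action V b c x' v')%E.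
Proof.
move=> ab bc m1 m2; rewrite /action -integral_cat_at//.
by apply: eq_integral => t _; rewrite /cat_at; case: ifP.
Qed.

Lemma action_split (a b : R) V r th v :
  H1_path a b r th v ->
  mu.-integrable `[a, b] (fun t => pot_ext V (polar (r t) (th t))) ->
  action V a b (fun t => polar (r t) (th t)) v =
  (\int[mu]_(t in `[a, b]) kinetic v t +
   \int[mu]_(t in `[a, b]) pot_ext V (polar (r t) (th t)))%E.
Proof. by move=> h ip; rewrite /action -integralD//; exact: kinetic_integrable h. Qed.

(** The kinetic density gains a factor [k ^+ 2], and the change of variables divides both terms by
    [k]. *)
Lemma action_affine (k c a b : R) V r th v : 0 < k -> a <= b ->
  H1_path (k * a + c) (k * b + c) r th v ->
  mu.-integrable `[k * a + c, k * b + c] (fun t => pot_ext V (polar (r t) (th t))) ->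
  action V a b (fun t => polar (r (k * t + c)) (th (k * t + c)))
     (fun t => (k * (v (k * t + c)).1, k * (v (k * t + c)).2)) =
  (k%:E * \int[mu]_(t in `[(k * a + c)%R, (k * b + c)%R]) kinetic v t +
   k^-1%:E * \int[mu]_(t in `[(k * a + c)%R, (k * b + c)%R])
      pot_ext V (polar (r t) (th t)))%E.
Proof.
move=> k0 ab h ip.
have kn : k != 0 by rewrite gt_eqF.
have ik := kinetic_integrable h.
rewrite (integral_affine k0 ip) (integral_affine k0 ik).
rewrite !muleA -!EFinM mulVf// mul1e.
have ik' := integrable_affine k0 ik; have ip' := integrable_affine k0 ip.
rewrite -integralZl// /action -integralD//; last exact: integrableZl.
apply: eq_integral => t _; congr (_ + _)%E.
by rewrite /kinetic -EFinM !sqr_enorm/=; congr EFin; ring.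
Qed.

End Lagrangian.

(** * Replacing a piece of a minimizer by a path of another duration *)

Section Surgery.
Context {R : realType}.
Notation mu := (@lebesgue_measure R).
Implicit Types (r th : R -> R) (v x : R -> R * R) (V : R * R -> R).

(* Since time may be rescaled affinely outside [a, b], replacing the piece on
   [a, b] by a path of another duration costs only a multiple of the
   durations involved. *)
Lemma minimizer_surgery V (t1 t2 r1 phi1 r2 phi2 a b T Ay : R) r th v ry thy vy :
  C1_punctured V ->
  admissible t1 t2 r1 phi1 r2 phi2 r th v ->
  (forall rho zeta w, admissible t1 t2 r1 phi1 r2 phi2 rho zeta w ->
      (action V t1 t2 (fun t => polar (r t) (th t)) v <=
       action V t1 t2 (fun t => polar (rho t) (zeta t)) w)%E) ->
  mu.-integrable `[t1, t2] (fun t => pot_ext V (polar (r t) (th t))) ->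
  t1 < a -> a < b -> b < t2 -> b - a <= (t2 - t1) / 2 ->
  0 <= T -> T <= (t2 - t1) / 2 ->
  H1_path 0 T ry thy vy ->
  mu.-integrable `[0, T] (fun t => pot_ext V (polar (ry t) (thy t))) ->
  ry 0 = r a -> thy 0 = th a -> ry T = r b -> thy T = th b ->
  action V 0 T (fun t => polar (ry t) (thy t)) vy = Ay%:E ->
  (action V a b (fun t => polar (r t) (th t)) v <=
   (Ay + 2 * (fine (\int[mu]_(t in `[t1, t2]) kinetic v t) +
     fine (\int[mu]_(t in `[t1, t2]) `|pot_ext V (polar (r t) (th t))|%E))
     / (t2 - t1) * (b - a + T))%:E)%E.
Proof.
move=> hV [h [e1 e1'] [e2 e2']] hmin ip t1a ab bt2 tau2 T0 T2 hy iy ery ethy erb ethb Aye.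
set L := t2 - t1 in tau2 T2 *; set P := fun t => pot_ext V (polar (r t) (th t)).
have t12 : t1 < t2 by exact: lt_trans t1a (lt_trans ab bt2).
have L0 : 0 < L by rewrite subr_gt0.
have ik := kinetic_integrable h.
have fin (f : R -> \bar R) (x y : R) : t1 <= x -> y <= t2 ->
    mu.-integrable `[t1, t2] f -> (\int[mu]_(t in `[x, y]) f t)%E \is a fin_num.
  move=> h1 h2 hf; apply: integrable_fin_num => //.
  exact: integrable_segmentS hf.
pose I (f : R -> \bar R) (x y : R) := fine (\int[mu]_(t in `[x, y]) f t).
have IE (f : R -> \bar R) (x y : R) : t1 <= x -> y <= t2 ->
    mu.-integrable `[t1, t2] f -> (\int[mu]_(t in `[x, y]) f t)%E = (I f x y)%:E.
  by move=> *; rewrite fineK// fin.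
have tb2 := ltW bt2; have t1b := ltW (lt_trans t1a ab).
have at2 := ltW (lt_trans ab bt2); have t1a1 := ltW t1a.
have Icat (f : R -> \bar R) : mu.-integrable `[t1, t2] f ->
    I f t1 t2 = I f t1 a + I f a b + I f b t2.
  move=> hf; apply: EFin_inj; rewrite !EFinD -!IE// //.
  have /integrableP[mf _] := hf.
  rewrite (integral_segment_cat t1b tb2)//.
  rewrite (integral_segment_cat t1a1 (ltW ab))//.
  by apply: measurable_funS mf => //; exact: segment_sub.
have iaP : mu.-integrable `[t1, t2] (fun t => `|P t|%E) by exact: integrable_abse.
(* The two outer pieces, of total duration [L - (b - a)], are run at the common speed [k] so as to
   fill [L - T]. Below, [A1] fixes [t1], [A3] fixes [t2], and [A2] only translates the new piece to
   [[a', b']]. *)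
pose k := (L - (b - a)) / (L - T).
have LT : 0 < L - T by move: T2 L0; clear; lra.
have Lt : 0 < L - (b - a) by move: tau2 L0; clear; lra.
have k0 : 0 < k by rewrite divr_gt0.
have kn : k != 0 by rewrite gt_eqF.
pose a' := t1 + (a - t1) / k.
have ka' : k * a' + (1 - k) * t1 = a by rewrite /a'; field.
have kt1 : k * t1 + (1 - k) * t1 = t1 by ring.
have kt2 : k * t2 + (1 - k) * t2 = t2 by ring.
pose b' := a' + T.
have kb' : k * b' + (1 - k) * t2 = b.
  have e : k * (L - T) = L - (b - a) by rewrite /k divfK// gt_eqF.
  transitivity (k * a' + (1 - k) * t1 + L - k * (L - T)).
    rewrite /b' /L; ring.
  by rewrite ka' e /L; ring.
have t1a' : t1 <= a' by rewrite lerDl divr_ge0// ?subr_ge0 ltW.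
have a'b' : a' <= b' by rewrite lerDl.
have b't2 : b' <= t2.
  rewrite -(ler_pM2l k0) -(lerD2r ((1 - k) * t2)) kb' kt2; exact: ltW.
pose A1 t := k * t + (1 - k) * t1; pose A2 t := 1 * t + (- a').
pose A3 t := k * t + (1 - k) * t2.
have h1 : H1_path (k * t1 + (1 - k) * t1) (k * a' + (1 - k) * t1) r th v.
  by rewrite ka' kt1; apply: H1_path_sub h => //; apply: ltW => //; exact: lt_trans bt2.
have h3 : H1_path (k * b' + (1 - k) * t2) (k * t2 + (1 - k) * t2) r th v.
  by rewrite kb' kt2; apply: H1_path_sub h => //; apply: ltW => //; exact: lt_trans ab.
have A2a : 1 * a' + (- a') = 0 by ring.
have A2b : 1 * b' + (- a') = T by rewrite /b'; ring.
have h2 : H1_path (1 * a' + (- a')) (1 * b' + (- a')) ry thy vy by rewrite A2a A2b.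
have g1 := H1_path_affine k0 t1a' h1.
have g2 := H1_path_affine ltr01 a'b' h2.
have g3 := H1_path_affine k0 b't2 h3.
have g12 : H1_path t1 b' (cat_at a' (fun t => r (A1 t)) (fun t => ry (A2 t)))
    (cat_at a' (fun t => th (A1 t)) (fun t => thy (A2 t))) _ :=
  H1_path_cat t1a' a'b' g1 g2 (etrans (congr1 r ka') (etrans (esym ery)
    (congr1 ry (esym A2a)))) (etrans (congr1 th ka') (etrans (esym ethy)
    (congr1 thy (esym A2a)))).
have cb (f fy : R -> R) : f a = fy 0 -> fy T = f b ->
    cat_at a' (fun t => f (A1 t)) (fun t => fy (A2 t)) b' = f (A3 b').
  move=> ea eb; rewrite (@cat_atr _ _ _ b') ?in_itv/= ?a'b' ?lexx//.
    by rewrite /A2 A2b /A3 kb'.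
  by rewrite /A1 /A2 ka' A2a.
have t1b' : t1 <= b' by exact: le_trans a'b'.
have g := H1_path_cat t1b' b't2 g12 g3 (cb r ry (esym ery) erb) (cb th thy (esym ethy) ethb).
have adm := hmin _ _ _ (And3 g _ _).
have {adm} := adm (conj _ _) (conj _ _).
have c1 (f fy : R -> R) : cat_at b' (cat_at a' (fun t => f (A1 t)) (fun t => fy (A2 t)))
    (fun t => f (A3 t)) t1 = f t1.
  by rewrite /cat_at t1b' t1a' /A1 kt1.
have c2 (f fy : R -> R) : f a = fy 0 -> fy T = f b ->
    cat_at b' (cat_at a' (fun t => f (A1 t)) (fun t => fy (A2 t)))
    (fun t => f (A3 t)) t2 = f t2.
  move=> ea eb; rewrite (@cat_atr _ _ b' t2) ?in_itv/= ?b't2 ?lexx//.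
    by rewrite /A3 kt2.
  exact: cb.
move=> /(_ (etrans (c1 r ry) e1) (etrans (c1 th thy) e1')).
move=> /(_ (etrans (c2 r ry (esym ery) erb) e2) (etrans (c2 th thy (esym ethy) ethb) e2')).
rewrite polar_cat polar_cat.
have m1 := lagrangian_measurable t1a' hV g1.
have m2 := lagrangian_measurable a'b' hV g2.
have m3 := lagrangian_measurable b't2 hV g3.
have m12 := lagrangian_measurable t1b' hV g12.
rewrite action_cat//; last first.
  apply: eq_measurable_fun m12 => t _; congr (_ + _)%E; congr pot_ext.
  by rewrite /cat_at; case: ifP.
rewrite action_cat//.
have iP1 : mu.-integrable `[k * t1 + (1 - k) * t1, k * a' + (1 - k) * t1] P.
  by rewrite kt1 ka'; apply: integrable_segmentS ip => //; exact: ltW (lt_trans ab bt2).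
have iP3 : mu.-integrable `[k * b' + (1 - k) * t2, k * t2 + (1 - k) * t2] P.
  by rewrite kt2 kb'; apply: integrable_segmentS ip => //; exact: ltW (lt_trans t1a ab).
rewrite (action_affine k0 t1a' h1 iP1) (action_affine k0 b't2 h3 iP3).
have iy2 : mu.-integrable `[1 * a' + (- a'), 1 * b' + (- a')]
    (fun t => pot_ext V (polar (ry t) (thy t))) by rewrite A2a A2b.
rewrite (action_affine ltr01 a'b' h2 iy2) invr1 !mul1e A2a A2b -action_split// Aye.
rewrite action_split// (action_split (H1_path_sub (ltW t1a) (ltW ab) (ltW bt2) h)); last first.
  exact: integrable_segmentS ip.
rewrite !kt1 !kt2 !ka' !kb'.
rewrite !(IE (kinetic v))// !(IE (fun t => pot_ext V (polar (r t) (th t))))//.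
rewrite -!EFinM -!EFinD !lee_fin (Icat _ ik) (Icat _ ip).
have K0 (x y : R) : 0 <= I (kinetic v) x y.
  by apply: fine_ge0; apply: integral_ge0 => t _; exact: kinetic_ge0.
have Pa (x y : R) : t1 <= x -> y <= t2 -> `|I P x y| <= I (fun t => `|P t|%E) x y.
  move=> xx yy; rewrite -lee_fin -abse_EFin -!IE//.
  apply: le_abse_integral => //.
  by have /integrableP[mf _] := ip; apply: measurable_funS mf => //; exact: segment_sub.
have Pa0 (x y : R) : 0 <= I (fun t => `|P t|%E) x y.
  by apply: fine_ge0; apply: integral_ge0.
rewrite /= (IE (fun t => `|P t|%E))// -/(I _ t1 t2) (Icat _ iaP) /=.
have := K0 a b; have := Pa0 a b; have := K0 t1 a; have := K0 b t2.
have := Pa t1 a (lexx _) at2; have := Pa b t2 t1b (lexx _).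
rewrite -/P; move: (I (kinetic v) t1 a) (I (kinetic v) a b) (I (kinetic v) b t2)
  (I P t1 a) (I P a b) (I P b t2) (I (fun t => `|P t|%E) t1 a)
  (I (fun t => `|P t|%E) a b) (I (fun t => `|P t|%E) b t2).
move=> K1 K2 K3 P1 P2 P3 p1 p2 p3 hp3 hp1 hK3 hK1 hp2 hK2 hA.
set e := 2 * (b - a + T) / L.
have e0 : 0 <= e by rewrite /e mulr_ge0 ?invr_ge0 ?(ltW L0)// mulr_ge0// addr_ge0// subr_ge0 ltW.
have ek (x y : R) : 0 <= x -> 0 <= y -> x <= L / 2 -> y <= L / 2 -> x + y = b - a + T ->
    `|(L - x) / (L - y) - 1| <= e.
  move=> x0 y0 xL yL exy; have Ly : 0 < L - y by move: yL L0; clear; lra.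
  have -> : (L - x) / (L - y) - 1 = (y - x) / (L - y) by field; rewrite gt_eqF.
  rewrite normrM normfV (gtr0_norm Ly) ler_pdivrMr// /e -exy.
  have : `|y - x| <= x + y by move: x0 y0; clear => *; rewrite ler_norml; apply/andP; split; lra.
  move=> h'; apply: (le_trans h').
  rewrite mulrAC ler_pdivlMr// -subr_ge0.
  rewrite (_ : _ - _ = (x + y) * (L - 2 * y)); last by ring.
  by apply: mulr_ge0; [exact: addr_ge0|move: yL; clear; lra].
have tau0 : 0 <= b - a by rewrite subr_ge0 ltW.
have k1 : `|k - 1| <= e by apply: ek.
have k2 : `|k^-1 - 1| <= e by rewrite /k invf_div; apply: ek => //; ring.
have M1 : (k - 1) * (K1 + K3) <= e * (K1 + K3).
  by rewrite ler_wpM2r ?addr_ge0// (le_trans (ler_norm _)).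
have M2 : (k^-1 - 1) * (P1 + P3) <= e * (p1 + p3).
  rewrite (le_trans (ler_norm _))// normrM ler_pM//.
  by rewrite (le_trans (ler_normD _ _))// lerD.
have -> : 2 * (K1 + K2 + K3 + (p1 + p2 + p3)) / L * (b - a + T) =
   e * (K1 + K3) + e * (p1 + p3) + e * (K2 + p2) by rewrite /e; ring.
have M3 : 0 <= e * (K2 + p2) by rewrite mulr_ge0// addr_ge0.
move: hA M1 M2; move: M3; clear; rewrite !mulrBl !mul1r; lra.
Qed.

End Surgery.

(** * Finiteness of the potential energy of a minimizer *)

Section Integrability.
Context {R : realType}.
Notation mu := (@lebesgue_measure R).
Implicit Types (r th : R -> R) (v : R -> R * R) (x : R * R) (V : R * R -> R).

Lemma C1_punctured_bounded V (p M : R) : C1_punctured V -> 0 < p ->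
  exists B, forall x, p <= enorm x <= M -> `|V x| <= B.
Proof.
move=> hV p0; pose A := [set x : R * R | p <= enorm x <= M].
have cA : compact A.
  apply: (@subclosed_compact _ _ (`[- M, M] `*` `[- M, M])).
  - have -> : A = enorm @^-1` `[p, M].
      by apply/seteqP; split => x; rewrite /A /= in_itv.
    apply: preimage_closed; last exact: itv_closed.
    by move=> x _; exact: enorm_continuous.
  - by apply: compact_setX; exact: segment_compact.
  - move=> [a b] /andP[_ /= h]; split => /=; rewrite in_itv/= -ler_norml;
      apply: le_trans h; rewrite -sqrtr_sqr ler_wsqrtr//.
    + by rewrite lerDl sqr_ge0.
    + by rewrite lerDr sqr_ge0.
have cV : {within A, continuous V}.
  apply/subspace_continuousP => x /andP[px _].
  apply: cvg_within_filter; apply: C1_punctured_continuous => //.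
  by rewrite -enorm_gt0; exact: lt_le_trans px.
have [B [_ hB]] := compact_bounded (continuous_compact cV cA).
exists (B + 1) => x hx; apply: hB; first by rewrite ltrDl.
by exists x.
Qed.

Lemma potential_integrable_pos (a b : R) V r th v : a <= b -> C1_punctured V ->
  H1_path a b r th v -> (forall t, t \in `[a, b]%R -> 0 < r t) ->
  mu.-integrable `[a, b] (fun t => pot_ext V (polar (r t) (th t))).
Proof.
move=> ab hV h r0.
have c : {within `[a, b], continuous (fun t => V (polar (r t) (th t)))}.
  apply/subspace_continuousP => t tab.
  apply: continuous_cvg (H1_path_continuous ab h tab).
  by apply: C1_punctured_continuous => //; rewrite polar_eq0 gt_eqF// r0.
apply: eq_integrable (integrable_segment_continuous c) => // t.
by rewrite inE => tab; rewrite /pot_ext polar_eq0 gt_eqF//= r0.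
Qed.

(** Away from the origin [V] may be negative, but there the path stays in a compact annulus. *)
Lemma potential_lower_bound (a b : R) V r th v : a <= b -> C1_punctured V ->
  H1_path a b r th v ->
  (exists2 p, 0 < p & forall x, 0 < enorm x < p -> 0 <= V x) ->
  exists2 B, 0 <= B & forall t, t \in `[a, b]%R ->
    ((- B)%:E <= pot_ext V (polar (r t) (th t)))%E.
Proof.
move=> ab hV h [p p0 Vp].
have cr := radius_continuous ab h; have [r0 _ _ _] := h.
have [c _ rM] := EVT_max ab cr.
have [B hB] := C1_punctured_bounded (r c) hV p0.
exists `|B| => // t tab; rewrite /pot_ext polar_eq0.
case: ifPn => [_|rt]; first exact: leey.
have rt0 : 0 < r t by rewrite lt_neqAle eq_sym rt r0.
rewrite lee_fin; have [tp|tp] := ltP (r t) p.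
  rewrite (le_trans (y := 0)) ?oppr_le0// Vp// enorm_polar ?r0//.
  by rewrite rt0.
rewrite lerNl (le_trans _ (ler_norm B))//.
rewrite (le_trans _ (hB (polar (r t) (th t)) _))//.
  by rewrite -normrN ler_norm.
by rewrite enorm_polar ?r0// tp rM.
Qed.

Lemma integrable_of_lower_bound (a b B : R) (f : R -> \bar R) : a <= b -> 0 <= B ->
  measurable_fun `[a, b] f ->
  (forall t, t \in `[a, b]%R -> ((- B)%:E <= f t)%E) ->
  (\int[mu]_(t in `[a, b]) f t < +oo)%E -> mu.-integrable `[a, b] f.
Proof.
move=> ab B0 mf lb hf; apply/integrableP; split => //.
have fn : (\int[mu]_(t in `[a, b]) f^\- t <= (B * (b - a))%:E)%E.
  rewrite -integral_segment_cst//; apply: ge0_le_integral => //.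
  - by apply: measurable_funeneg.
  - move=> t tab; rewrite funenegE ge_max lee_fin B0 andbT leeNl -EFinN.
    exact: lb.
have fn_fin : (\int[mu]_(t in `[a, b]) f^\- t)%E \is a fin_num.
  rewrite ge0_fin_numE; first exact: le_lt_trans fn (ltry _).
  exact: integral_ge0.
have fp : (\int[mu]_(t in `[a, b]) f^\+ t < +oo)%E.
  move: hf; rewrite integralE lteBlDr// addye//.
  by apply: contraTneq fn_fin => ->.
under eq_integral do rewrite -/((abse \o f) _) fune_abse.
rewrite ge0_integralD//; last 2 first.
- exact: measurable_funepos.
- exact: measurable_funeneg.
by rewrite lte_add_pinfty// ltey_eq fn_fin.
Qed.

(** The competitor whose radius and angle are affine in time avoids the origin, as [r1] and [r2] are
    positive, so the minimal action is finite. The lower bound on the potential turns this into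
    integrability. *)
Lemma minimizer_potential_integrable V (t1 t2 r1 phi1 r2 phi2 : R) r th v :
  C1_punctured V -> t1 < t2 -> 0 < r1 -> 0 < r2 ->
  admissible t1 t2 r1 phi1 r2 phi2 r th v ->
  (forall rho zeta w, admissible t1 t2 r1 phi1 r2 phi2 rho zeta w ->
      (action V t1 t2 (fun t => polar (r t) (th t)) v <=
       action V t1 t2 (fun t => polar (rho t) (zeta t)) w)%E) ->
  (exists2 p, 0 < p & forall x, 0 < enorm x < p -> 0 <= V x) ->
  mu.-integrable `[t1, t2] (fun t => pot_ext V (polar (r t) (th t))).
Proof.
move=> hV t12 r10 r20 [h e1 e2] hmin Vp.
have L0 : 0 < t2 - t1 by rewrite subr_gt0.
pose lin (x y t : R) := x + (y - x) / (t2 - t1) * (t - t1).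
have dlin (x y t : R) : is_derive t 1 (lin x y) ((y - x) / (t2 - t1)).
  apply: (isD_eq (isD_add (isD_cst t x) (isD_scale ((y - x) / (t2 - t1))
    (isD_add (isD_id t) (isD_cst t (- t1)))))).
  by ring.
have lin1 (x y : R) : lin x y t1 = x by rewrite /lin subrr mulr0 addr0.
have lin2 (x y : R) : lin x y t2 = y by rewrite /lin divfK ?gt_eqF// subrKC.
have lin0 (t : R) : t \in `[t1, t2]%R -> 0 < lin r1 r2 t.
  rewrite in_itv/= => /andP[h1 h2].
  have -> : lin r1 r2 t = (r1 * (t2 - t) + r2 * (t - t1)) / (t2 - t1).
    by rewrite /lin; field; rewrite gt_eqF.
  have q1 : 0 <= r1 * (t2 - t) by rewrite mulr_ge0 ?(ltW r10)// subr_ge0.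
  have q2 : 0 <= r2 * (t - t1) by rewrite mulr_ge0 ?(ltW r20)// subr_ge0.
  apply: divr_gt0 => //; have [tt|tt] := ltP t t2.
    by have : 0 < r1 * (t2 - t); [rewrite mulr_gt0// subr_gt0|lra].
  have : 0 < r2 * (t - t1); last by lra.
  by rewrite mulr_gt0// subr_gt0 (lt_le_trans t12).
have ccst (c : R) : {within `[t1, t2], continuous (fun=> c)}.
  by apply: continuous_subspaceT => t; exact: cst_continuous.
have hl : H1_path t1 t2 (lin r1 r2) (lin phi1 phi2) _ := H1_path_C1 (ltW t12)
  (fun t tt => And3 (ltW (lin0 t tt)) (dlin r1 r2 t) (dlin phi1 phi2 t))
  (ccst _) (ccst _).
have := hmin _ _ _ (And3 hl (conj (lin1 _ _) (lin1 _ _)) (conj (lin2 _ _) (lin2 _ _))).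
have ipl := potential_integrable_pos (ltW t12) hV hl lin0.
rewrite (action_split hl ipl) => hle.
have fin : (action V t1 t2 (fun t => polar (r t) (th t)) v < +oo)%E.
  apply: le_lt_trans hle _; apply: lte_add_pinfty.
    by rewrite ltey_eq integrable_fin_num//; exact: kinetic_integrable hl.
  by rewrite ltey_eq integrable_fin_num.
have [B B0 lb] := potential_lower_bound (ltW t12) hV h Vp.
have mL := lagrangian_measurable (ltW t12) hV h.
have iL := integrable_of_lower_bound (ltW t12) B0 mL _ fin.
have {}iL : mu.-integrable `[t1, t2]
    (fun t => (kinetic v t + pot_ext V (polar (r t) (th t)))%E).
  apply: iL => t tt; apply: (le_trans (lb t tt)).
  by rewrite leeDr// kinetic_ge0.
apply: eq_integrable (integrableB _ iL (kinetic_integrable h)) => // t _.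
by rewrite /= addeAC subee// add0e.
Qed.

End Integrability.

(** * Calibration and collisions *)

Section Calibration.
Context {R : realType}.
Notation mu := (@lebesgue_measure R).
Implicit Types (r th : R -> R) (v : R -> R * R) (V : R * R -> R).

(** Law of cosines in half-angle form. For nonnegative radii it is a sum of a radial and an angular
    square, ready for the Cauchy-Schwarz inequality. *)
Lemma polar_dist (r s a b : R) :
  enorm (polar r a - polar s b) ^+ 2 =
  (r - s) ^+ 2 + 4 * r * s * sin ((a - b) / 2) ^+ 2.
Proof.
have e : cos (a - b) = 1 - 2 * sin ((a - b) / 2) ^+ 2.
  rewrite {1}(_ : a - b = (a - b) / 2 *+ 2); last by rewrite mulr2n; field.
  by rewrite cos_mulr2n cos2sin2 mulr2n; ring.
rewrite sqr_enorm /polar /=.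
have c1 := cos2Dsin2 a; have c2 := cos2Dsin2 b.
transitivity (r ^+ 2 * (cos a ^+ 2 + sin a ^+ 2) + s ^+ 2 * (cos b ^+ 2 + sin b ^+ 2)
   - 2 * r * s * cos (a - b)); first by rewrite cosB; ring.
by rewrite c1 c2 e; ring.
Qed.

(** The left side of the last hypothesis is the squared gradient of r^ga f(th) at the point. The
    bound is stated along [(r t, th t)] because [f] depends on the lifted angle and defines no
    function on the plane. *)
Lemma homog_lipschitz (F : set_system R) (ga m f1 : R) (f r th : R -> R) (s : R) :
  Filter F -> r t @[t --> F] --> r s -> th t @[t --> F] --> th s ->
  0 < r s -> is_derive (th s) 1 f f1 -> 0 <= m ->
  (r s `^ (ga - 1)) ^+ 2 * ((ga * f (th s)) ^+ 2 + f1 ^+ 2) < m ^+ 2 ->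
  \forall t \near F, `|r t `^ ga * f (th t) - r s `^ ga * f (th s)| <=
    m * enorm (polar (r t) (th t) - polar (r s) (th s)).
Proof.
move=> FF cr cth r0 df m0 hm.
(* Slope functions that are continuous at the base point turn the increment into the exact sum
   [A t * (r t - r s) + B t * Psi], where [Psi] is the angular term of [polar_dist]; Cauchy-Schwarz
   then compares it with the distance. *)
have /is_derive1_caratheodory[p [hp cp ep]] := is_derive1_powR ga r0.
have /is_derive1_caratheodory[q [hq cq eq]] := df.
have /is_derive1_caratheodory[sg [hsg csg esg]] := is_derive_sin (0 : R).
rewrite cos0 in esg.
have cf := isD_continuous df.
pose d t := (th t - th s) / 2.
have cd : d t @[t --> F] --> (0 : R).
  rewrite -[X in _ --> X](mul0r (2^-1 : R)); apply: cvgM; last exact: cvg_cst.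
  by rewrite -(subrr (th s)); apply: cvgB => //; exact: cvg_cst.
pose A t := p (r t) * f (th t).
pose B t := r s `^ ga * q (th t) / (Num.sqrt (r t * r s) * sg (d t)).
have cA : A t @[t --> F] --> p (r s) * f (th s).
  apply: cvgM; first exact: (continuous_cvg _ cp cr).
  exact: (continuous_cvg _ cf cth).
have cS : Num.sqrt (r t * r s) @[t --> F] --> Num.sqrt (r s * r s).
  apply: continuous_cvg; first exact: sqrt_continuous.
  by apply: cvgM => //; exact: cvg_cst.
have cG : sg (d t) @[t --> F] --> sg 0.
  exact: (continuous_cvg _ csg cd).
have S0 : Num.sqrt (r s * r s) = r s by rewrite -expr2 sqrtr_sqr gtr0_norm.
have cB : B t @[t --> F] --> r s `^ ga * q (th s) / (Num.sqrt (r s * r s) * sg 0).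
  apply: cvgM; first by apply: cvgM; [exact: cvg_cst|exact: (continuous_cvg _ cq cth)].
  apply: cvgV; last exact: cvgM.
  by rewrite S0 esg mulr1 gt_eqF.
have cAB : A t ^+ 2 + B t ^+ 2 @[t --> F] -->
   (p (r s) * f (th s)) ^+ 2 + (r s `^ ga * q (th s) / (Num.sqrt (r s * r s) * sg 0)) ^+ 2.
  under eq_fun do rewrite !expr2; rewrite !expr2.
  by apply: cvgD; apply: cvgM.
have lim_lt : (p (r s) * f (th s)) ^+ 2 +
   (r s `^ ga * q (th s) / (Num.sqrt (r s * r s) * sg 0)) ^+ 2 < m ^+ 2.
  apply: le_lt_trans hm; rewrite ep eq S0 esg mulr1.
  have -> : r s `^ ga = r s `^ (ga - 1) * r s.
    rewrite -[X in _ * X]powRr1 ?ltW// -powRD ?subrK//.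
    by rewrite (gt_eqF r0) implybT.
  rewrite le_eqVlt; apply/orP; left; apply/eqP; field; by rewrite gt_eqF.
have nAB : \forall t \near F, A t ^+ 2 + B t ^+ 2 < m ^+ 2 by exact: (cvgr_lt _ cAB).
have nr : \forall t \near F, 0 < r t by exact: (cvgr_gt _ cr).
have nG : \forall t \near F, 0 < sg (d t).
  by apply: (cvgr_gt _ cG); rewrite esg.
near=> t.
have hAB : A t ^+ 2 + B t ^+ 2 < m ^+ 2 by near: t.
have rt : 0 < r t by near: t.
have gt : 0 < sg (d t) by near: t.
set Q := Num.sqrt (r t * r s).
have Q0 : 0 < Q by rewrite sqrtr_gt0 mulr_gt0.
have Q2 : Q ^+ 2 = r t * r s by rewrite sqr_sqrtr// mulr_ge0// ltW.
pose Psi := 2 * Q * sin (d t).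
have sd : sin (d t) = sg (d t) * d t by have := hsg (d t); rewrite sin0 !subr0.
have e1 : r t `^ ga * f (th t) - r s `^ ga * f (th s) = A t * (r t - r s) + B t * Psi.
  have -> : r t `^ ga * f (th t) - r s `^ ga * f (th s) =
     (r t `^ ga - r s `^ ga) * f (th t) + r s `^ ga * (f (th t) - f (th s)) by ring.
  rewrite hp hq /A /B /Psi sd -/Q /d; field.
  by rewrite (gt_eqF Q0) (gt_eqF gt).
have e2 : enorm (polar (r t) (th t) - polar (r s) (th s)) ^+ 2 = (r t - r s) ^+ 2 + Psi ^+ 2.
  by rewrite polar_dist /Psi 2!exprMn Q2 -/(d t); ring.
rewrite -(@ler_pXn2r _ 2)// ?nnegrE ?mulr_ge0 ?enorm_ge0//.
rewrite real_normK ?num_real// exprMn e1 e2.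
set X := r t - r s.
have CS : (A t * X + B t * Psi) ^+ 2 <= (A t ^+ 2 + B t ^+ 2) * (X ^+ 2 + Psi ^+ 2).
  rewrite -subr_ge0 (_ : _ - _ = (A t * Psi - B t * X) ^+ 2) ?sqr_ge0//; ring.
apply: (le_trans CS); rewrite ler_wpM2r ?(ltW hAB)//.
by rewrite addr_ge0// sqr_ge0.
Unshelve. all: by end_near.
Qed.

(** The velocity is projected on the direction of the displacement [D], and Young's inequality is
    applied to its product with a constant vector of length |m|. *)
Lemma displacement_le (a b s t m : R) r th v : H1_path a b r th v ->
  a <= s -> s <= t -> t <= b ->
  ((m * enorm (polar (r t) (th t) - polar (r s) (th s)))%:E <=
   \int[mu]_(z in `[s, t]) (kinetic v z + (m ^+ 2 / 2)%:E))%E.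
Proof.
move=> h as_ st tb; have hst := H1_path_sub as_ st tb h.
have ik : mu.-integrable `[s, t] (fun z => kinetic v z + (m ^+ 2 / 2)%:E)%E.
  apply: integrableD => //; first exact: kinetic_integrable hst.
  exact: integrable_segment_cst.
have [_ _ h1 h2] := hst.
have i1 := H1_deriv_integrable h1; have i2 := H1_deriv_integrable h2.
have e1 := H1_deriv_increment (lexx s) st (lexx t) h1.
have e2 := H1_deriv_increment (lexx s) st (lexx t) h2.
set D := polar (r t) (th t) - polar (r s) (th s).
have D1 : (polar (r t) (th t)).1 - (polar (r s) (th s)).1 = D.1 by [].
have D2 : (polar (r t) (th t)).2 - (polar (r s) (th s)).2 = D.2 by [].
rewrite D1 in e1; rewrite D2 in e2.
have [D0|D0] := eqVneq (enorm D) 0.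
  rewrite D0 mulr0; apply: integral_ge0 => z _.
  by rewrite adde_ge0 ?kinetic_ge0// lee_fin divr_ge0// sqr_ge0.
pose c1 := m * D.1 / enorm D; pose c2 := m * D.2 / enorm D.
have -> : (m * enorm D)%:E = (\int[mu]_(z in `[s, t])
    (c1%:E * ((v z).1)%:E + c2%:E * ((v z).2)%:E))%E.
  rewrite integralD//; try exact: integrableZl.
  rewrite !integralZl// e1 e2 -!EFinM -EFinD; congr EFin.
  have := sqr_enorm D; rewrite /c1 /c2 => eD.
  transitivity (m * (D.1 ^+ 2 + D.2 ^+ 2) / enorm D); last by field.
  by rewrite -eD; field.
apply: le_integral => //.
  by apply: integrableD => //; exact: integrableZl.
move=> z _; rewrite -!EFinM -!EFinD lee_fin sqr_enorm.
have ec : c1 ^+ 2 + c2 ^+ 2 = m ^+ 2.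
  transitivity (m ^+ 2 * (D.1 ^+ 2 + D.2 ^+ 2) / enorm D ^+ 2).
    by rewrite /c1 /c2; field.
  by rewrite -sqr_enorm mulfK// expf_neq0.
rewrite -ec; have := sqr_ge0 (c1 - (v z).1); have := sqr_ge0 (c2 - (v z).2).
nra.
Qed.

(** A supremum argument. The hypothesis compares [s] with its neighbours, not two neighbours with
    one another, because the available Lipschitz estimates are centred at a point. *)
Lemma local_mono_le (a b : R) (G : R -> R) : a <= b ->
  (forall s, s \in `[a, b]%R -> exists2 d, 0 < d & forall t, t \in `[a, b]%R ->
     `|s - t| < d -> (s <= t -> G s <= G t) /\ (t <= s -> G t <= G s)) ->
  G a <= G b.
Proof.
move=> ab loc.
pose S := [set t | t \in `[a, b]%R /\ G a <= G t].
have Sa : S a by split; rewrite // in_itv/= lexx ab.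
have hS : has_sup S by split; [exists a|exists b => t [/andP[]]].
pose c := sup S.
have ac : a <= c by apply: ub_le_sup => //; case: hS.
have cb : c <= b by apply: ge_sup; [exists a|move=> t [/andP[]]].
have cab : c \in `[a, b]%R by rewrite in_itv/= ac cb.
have [d d0 H] := loc c cab.
have Gc : G a <= G c.
  have [t [tab Gt] ct] := sup_adherent d0 hS.
  have tc : t <= c by apply: ub_le_sup => //; case: hS.
  apply: (le_trans Gt); apply: (H t tab _).2 => //.
  by rewrite ger0_norm ?subr_ge0//; rewrite -/c in ct; lra.
have [cltb|] := ltP c b; last first.
  by move=> bc; have <- : c = b by apply/eqP; rewrite eq_le cb bc.
pose t := Num.min b (c + d / 2).
have ct : c < t by rewrite lt_min cltb ltrDl divr_gt0.
have tab : t \in `[a, b]%R.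
  by rewrite in_itv/= (le_trans ac (ltW ct)) ge_min lexx.
have St : S t.
  split=> //; apply: (le_trans Gc); apply: (H t tab _).1; last exact: ltW.
  rewrite distrC ger0_norm ?subr_ge0 ?(ltW ct)//.
  have : t <= c + d / 2 by rewrite ge_min lexx orbT.
  lra.
have : t <= c by apply: ub_le_sup => //; case: hS.
by rewrite leNgt ct.
Qed.

(** The gradient of r^ga f is shorter than sqrt(2 V), while the Lagrangian is at least sqrt(2 V)
    times the speed. Strictness inserts a constant [m] between the two near each time, which
    replaces a chain rule along an H^1 path by local estimates. *)
Lemma calibration_le (a b ga : R) V r th v (f f1 : R -> R) : a <= b ->
  C1_punctured V -> H1_path a b r th v ->
  (forall t, t \in `[a, b]%R -> [/\ 0 < r t, is_derive (th t) 1 f (f1 (th t)) &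
    (r t `^ (ga - 1)) ^+ 2 * ((ga * f (th t)) ^+ 2 + f1 (th t) ^+ 2) <
      2 * V (polar (r t) (th t))]) ->
  (`|r b `^ ga * f (th b) - r a `^ ga * f (th a)|%:E <=
   action V a b (fun t => polar (r t) (th t)) v)%E.
Proof.
move=> ab hV h hyp.
have r0 t : t \in `[a, b]%R -> 0 < r t by case/hyp.
pose H t := r t `^ ga * f (th t).
pose Lg t := (kinetic v t + pot_ext V (polar (r t) (th t)))%E.
have ip := potential_integrable_pos ab hV h r0.
have iL : mu.-integrable `[a, b] Lg.
  by apply: integrableD => //; exact: kinetic_integrable h.
have cth : {within `[a, b], continuous th}.
  have [_ c _ _] := h; apply: continuous_subspaceW c => t tab.
  by split => //; exact: r0.
have cr := radius_continuous ab h.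
have itvN (s t d : R) : s <= t -> `|s - t| < d -> forall z, s <= z -> z <= t -> `|s - z| < d.
  move=> st std z sz zt; move: std; rewrite !ler0_norm ?subr_le0//; lra.
have loc s : s \in `[a, b]%R -> exists2 d, 0 < d & forall x y,
    x \in `[a, b]%R -> y \in `[a, b]%R -> x <= y -> (x = s \/ y = s) ->
    `|x - y| < d -> (`|H y - H x|%:E <= \int[mu]_(t in `[x, y]) Lg t)%E.
  move=> sab; have [rs dfs Vs] := hyp s sab.
  set l := _ * _ in Vs.
  have l0 : 0 <= l by rewrite mulr_ge0 ?addr_ge0 ?sqr_ge0.
  (* [m ^+ 2] is the midpoint of the squared gradient [l] and of [2 * V]: it bounds the Lipschitz
     constant from above and, nearby, [2 * V] from below. *)
  pose m := Num.sqrt ((l + 2 * V (polar (r s) (th s))) / 2).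
  have m2 : m ^+ 2 = (l + 2 * V (polar (r s) (th s))) / 2.
    rewrite sqr_sqrtr//; apply: divr_ge0 => //; lra.
  have crs : r t @[t --> within `[a, b] (nbhs s)] --> r s.
    by move/subspace_continuousP : cr; exact.
  have cths : th t @[t --> within `[a, b] (nbhs s)] --> th s.
    by move/subspace_continuousP : cth; exact.
  have WF : Filter (within `[a, b] (nbhs s)) by exact: within_filter.
  have lm : l < m ^+ 2 by rewrite m2; lra.
  have n1 := homog_lipschitz WF crs cths rs dfs (sqrtr_ge0 _) lm.
  have n2 : \forall t \near within `[a, b] (nbhs s),
      m ^+ 2 / 2 < V (polar (r t) (th t)).
    have c : V (polar (r t) (th t)) @[t --> within `[a, b] (nbhs s)] -->
        V (polar (r s) (th s)).
      apply: continuous_cvg (H1_path_continuous ab h sab).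
      by apply: C1_punctured_continuous => //; rewrite polar_eq0 gt_eqF.
    by apply: (cvgr_gt _ c); rewrite m2; lra.
  have [d /= d0 Hd] := filterI n1 n2.
  exists d => // x y xab yab xy xsys xyd.
  have xa : a <= x by move: xab; rewrite in_itv/= => /andP[].
      have yb : y <= b by move: yab; rewrite in_itv/= => /andP[].
  have near_s z : x <= z -> z <= y -> `|s - z| < d.
    move=> xz zy; case: xsys => es; rewrite -es.
      exact: itvN xyd _ xz zy.
    rewrite distrC; apply: le_lt_trans xyd.
    by rewrite !ler0_norm ?subr_le0//; lra.
  have zab z : x <= z -> z <= y -> z \in `[a, b]%R.
    by move=> xz zy; rewrite in_itv/= (le_trans xa xz) (le_trans zy yb).
  have step : `|H y - H x| <= m * enorm (polar (r y) (th y) - polar (r x) (th x)).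
    case: xsys => es.
      have [h1 _] := Hd y (near_s y xy (lexx _)) yab.
      by rewrite es.
    have [h1 _] := Hd x (near_s x (lexx _) xy) xab.
    rewrite es distrC; apply: (le_trans h1).
    rewrite le_eqVlt; apply/orP; left; apply/eqP; congr (_ * _).
    by rewrite /enorm/=; congr Num.sqrt; ring.
  apply: (@le_trans _ _ (m * enorm (polar (r y) (th y) - polar (r x) (th x)))%:E).
    by rewrite lee_fin.
  apply: (le_trans (displacement_le m h xa xy yb)).
  apply: le_integral => //.
  - apply: integrableD => //; last exact: integrable_segment_cst.
    exact: kinetic_integrable (H1_path_sub xa xy yb h).
  - exact: integrable_segmentS iL.
  - move=> z; rewrite inE/= in_itv/= => /andP[xz zy]; rewrite leeD2l//.
    rewrite /pot_ext; case: ifP => _; first exact: leey.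
    have [_ /ltW] := Hd z (near_s z xz zy) (zab z xz zy).
    by rewrite lee_fin.
pose Fn t := fine (\int[mu]_(z in `[a, t]) Lg z).
have fin (x y : R) : a <= x -> y <= b -> (\int[mu]_(z in `[x, y]) Lg z)%E \is a fin_num.
  by move=> ax yb; apply: integrable_fin_num => //; exact: integrable_segmentS iL.
have FnE (x y : R) : a <= x -> x <= y -> y <= b ->
    (\int[mu]_(z in `[x, y]) Lg z = (Fn y - Fn x)%:E)%E.
  move=> ax xy yb; rewrite EFinB !fineK ?fin//; last exact: le_trans yb.
  rewrite (integral_segment_cat ax xy); last first.
    by case/integrableP: (integrable_segmentS (lexx a) yb iL).
  rewrite addeAC subee ?add0e// fin//; exact: le_trans yb.
(* The values [1] and [-1] of [e] produce the two halves of the absolute value. *)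
have key (e : R) : `|e| <= 1 -> e * (H b - H a) <= Fn b - Fn a.
  move=> e1.
  have : (fun t => Fn t - e * H t) a <= (fun t => Fn t - e * H t) b.
    apply: (@local_mono_le a b (fun t => Fn t - e * H t) ab) => s sab; have [d d0 Hd] := loc s sab.
    exists d => // t tab std.
    have main x y : x \in `[a, b]%R -> y \in `[a, b]%R -> x <= y ->
        x = s \/ y = s -> `|x - y| < d -> Fn x - e * H x <= Fn y - e * H y.
      move=> xab yab xy xs xyd; have := Hd x y xab yab xy xs xyd.
      have xa : a <= x by move: xab; rewrite in_itv/= => /andP[].
      have yb : y <= b by move: yab; rewrite in_itv/= => /andP[].
      rewrite FnE// lee_fin => h1.
      have : e * (H y - H x) <= `|H y - H x|.
        rewrite (le_trans (ler_norm _))// normrM.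
        by rewrite -[leRHS]mul1r ler_wpM2r.
      rewrite mulrBr; lra.
    split=> [st|ts]; first by apply: main => //; left.
    by apply: main => //; [right|rewrite distrC].
  by rewrite mulrBr /=; lra.
rewrite /action -/Lg (FnE a b)// lee_fin ler_norml.
have := key 1; rewrite normr1 lexx mul1r => /(_ isT) k1.
have := key (-1); rewrite normrN1 lexx mulN1r => /(_ isT) k2.
rewrite /H in k1 k2; apply/andP; split; lra.
Qed.

End Calibration.

(** * Strict subsolutions of the Hamilton-Jacobi equation *)

Section Slack.
Context {R : realType}.

(* The corrections [de * expR (- (sg * K) * phi)] make both [u] and [- u] strict
   subsolutions of the Hamilton-Jacobi equation while increasing them. *)
Lemma strict_subsolutions (A B ga om0 Mu UM : R) (u om U : R -> R) :
  0 < ga -> 0 < om0 -> 0 < UM ->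
  (forall phi, A <= phi <= B -> [/\ is_derive phi 1 u (om phi),
     om0 <= om phi, `|u phi| <= Mu, U phi <= UM &
     (ga * u phi) ^+ 2 + om phi ^+ 2 = 2 * U phi]) ->
  exists c0 kap M, [/\ 0 < c0, 0 < kap & forall sg : R, `|sg| = 1 ->
    exists f f1, forall phi, A <= phi <= B ->
      [/\ is_derive phi 1 f (f1 phi), sg * u phi + c0 <= f phi, `|f phi| <= M &
        (ga * f phi) ^+ 2 + f1 phi ^+ 2 < 2 * (1 - kap) * U phi]].
Proof.
move=> ga0 om00 UM0 hyp.
have [Mu' Mu0 Mul] : exists2 Mu', 0 <= Mu' & Mu <= Mu'.
  by exists `|Mu| => //; exact: ler_norm.
(* Makes the first-order coefficient [ga ^+ 2 * (sg * u phi) - K * om phi] at most [-1]. The sign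
   [sg] in the exponent squares away against that of [sg * om], so one [K] serves both signs. *)
pose K := (ga ^+ 2 * Mu' + 1) / om0.
have K0 : 0 < K.
  by rewrite divr_gt0// ltr_wpDl// mulr_ge0 ?sqr_ge0.
pose P := `|A| + `|B|.
have P0 : 0 <= P by rewrite addr_ge0.
have gK : 0 < ga ^+ 2 + K ^+ 2 by rewrite addr_gt0// exprn_gt0.
(* Small enough for the second-order term to undo at most half of the first-order decrease
   [2 * (de * E)]. As [P] bounds |phi|, the net decrease is at least [c0]. *)
pose de := expR (- (K * P)) / (ga ^+ 2 + K ^+ 2).
have de0 : 0 < de by rewrite divr_gt0// expR_gt0.
pose c0 := de * expR (- (K * P)).
have c00 : 0 < c0 by rewrite mulr_gt0// expR_gt0.
(* [2 * kap * U phi] is at most [c0 / 2], so the decrease by [c0] leaves the relative margin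
   [kap]. *)
pose kap := c0 / (4 * UM).
have kap0 : 0 < kap by rewrite divr_gt0// mulr_gt0.
exists c0, kap, (Mu' + de * expR (K * P)); split => // sg sg1.
exists (fun x => sg * u x + de * expR (- (sg * K) * x)).
exists (fun x => sg * om x + de * (expR (- (sg * K) * x) * - (sg * K))).
move=> phi hphi; have [du hom hu hU hj] := hyp phi hphi.
set E := expR (- (sg * K) * phi).
have hP : `|phi| <= P.
  move: hphi => /andP[h1 h2]; rewrite ler_norml /P.
  have := ler_norm B; have := ler_norm (- A); rewrite normrN.
  have := normr_ge0 A; have := normr_ge0 B.
  by move=> *; apply/andP; split; lra.
have hx : `|- (sg * K) * phi| <= K * P.
  by rewrite normrM normrN normrM sg1 mul1r (gtr0_norm K0) ler_wpM2l// ltW.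
have E1 : expR (- (K * P)) <= E.
  by rewrite ler_expR; move: hx; rewrite ler_norml => /andP[].
have E2 : E <= expR (K * P).
  by rewrite ler_expR; move: hx; rewrite ler_norml => /andP[].
have E0 : 0 < E by exact: expR_gt0.
have hc0 : c0 <= de * E by rewrite ler_wpM2l// ltW.
have sg2 : sg ^+ 2 = 1 by rewrite -(real_normK (num_real sg)) sg1 expr1n.
split.
- apply: (isD_eq (isD_add (isD_scale sg du) (isD_scale de
    (isD_expR (isD_scale (- (sg * K)) (isD_id phi)))))).
  by rewrite mulr1.
- by rewrite lerD2l.
- rewrite (le_trans (ler_normD _ _))// lerD//.
    by rewrite normrM sg1 mul1r (le_trans hu).
  by rewrite normrM !gtr0_norm// ler_wpM2l// ltW.
have hs : ga ^+ 2 * (sg * u phi) - K * om phi <= -1.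
  have h1 : ga ^+ 2 * (sg * u phi) <= ga ^+ 2 * Mu'.
    rewrite ler_wpM2l ?sqr_ge0// (le_trans (ler_norm _))//.
    by rewrite normrM sg1 mul1r (le_trans hu).
  have h2 : K * om0 <= K * om phi by rewrite ler_wpM2l// ltW.
  have h3 : K * om0 = ga ^+ 2 * Mu' + 1 by rewrite /K divfK// gt_eqF.
  lra.
have hd : de * E * (ga ^+ 2 + K ^+ 2) <= 1.
  have -> : 1 = de * expR (K * P) * (ga ^+ 2 + K ^+ 2).
    rewrite /de mulrAC divfK ?gt_eqF// -expRD addrC subrr expR0//.
  by rewrite ler_pM2r// ler_pM2l.
have key : (ga * (sg * u phi + de * E)) ^+ 2 + (sg * om phi + de * (E * - (sg * K))) ^+ 2 =
   2 * U phi + 2 * (de * E) * (ga ^+ 2 * (sg * u phi) - K * om phi) +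
     (de * E) * (de * E * (ga ^+ 2 + K ^+ 2)).
  rewrite -hj; transitivity (sg ^+ 2 * ((ga * u phi) ^+ 2 + om phi ^+ 2) +
     2 * (de * E) * (ga ^+ 2 * (sg * u phi) - sg ^+ 2 * K * om phi) +
     (de * E) * (de * E * (ga ^+ 2 + sg ^+ 2 * K ^+ 2))); first by ring.
  by rewrite sg2; ring.
have dE : 0 < de * E by rewrite mulr_gt0.
have k1 : 2 * (de * E) * (ga ^+ 2 * (sg * u phi) - K * om phi) <= 2 * (de * E) * -1.
  by rewrite ler_pM2l// mulr_gt0.
have k2 : (de * E) * (de * E * (ga ^+ 2 + K ^+ 2)) <= (de * E) * 1.
  by rewrite ler_pM2l.
have k3 : 2 * kap * U phi < c0.
  apply: (@le_lt_trans _ _ (2 * kap * UM)).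
    by rewrite ler_pM2l// mulr_gt0.
  have -> : 2 * kap * UM = c0 / 2 by rewrite /kap; field; rewrite gt_eqF.
  by rewrite ltr_pdivrMr// ltr_pMr// ltr1n.
rewrite -/E key; move: k1 k2; rewrite mulrN1 !mulr1; lra.
Qed.

End Slack.

(** * Lower bound for a branch that ends or starts at the origin *)

Section Collision.
Context {R : realType}.
Notation mu := (@lebesgue_measure R).
Implicit Types (r th : R -> R) (v : R -> R * R) (V : R * R -> R).

Lemma action_ge0 (a b : R) V (x v : R -> R * R) :
  (forall t, t \in `[a, b]%R -> (0 <= pot_ext V (x t))%E) -> (0 <= action V a b x v)%E.
Proof.
by move=> h; apply: integral_ge0 => t tab; rewrite adde_ge0 ?kinetic_ge0 ?h.
Qed.

Lemma action_subset (a b a' b' : R) V r th v : a <= b -> C1_punctured V ->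
  H1_path a b r th v -> a <= a' -> b' <= b ->
  (forall t, t \in `[a, b]%R -> (0 <= pot_ext V (polar (r t) (th t)))%E) ->
  (action V a' b' (fun t => polar (r t) (th t)) v <=
   action V a b (fun t => polar (r t) (th t)) v)%E.
Proof.
move=> ab hV h aa bb p0; apply: ge0_subset_integral => //.
- exact: lagrangian_measurable ab hV h.
- by move=> t tab; rewrite adde_ge0 ?kinetic_ge0 ?p0.
- exact: segment_sub.
Qed.

Lemma powR_small (F : set_system R) (r : R -> R) (ga M e : R) : Filter F ->
  r t @[t --> F] --> 0 -> (\forall t \near F, 0 <= r t) -> 0 < ga -> 0 <= M -> 0 < e ->
  \forall t \near F, r t `^ ga * M < e.
Proof.
move=> FF cr r0 ga0 M0 e0.
pose d := (e / (M + 1)) `^ ga^-1.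
have M1 : 0 < M + 1 by rewrite ltr_wpDl.
have q0 : 0 < e / (M + 1) by rewrite divr_gt0.
have d0 : 0 < d by rewrite powR_gt0.
have n1 : \forall t \near F, r t < d by exact: (cvgr_lt _ cr).
apply: filterS2 n1 r0 => t td rt.
have h : r t `^ ga < e / (M + 1).
  have -> : e / (M + 1) = d `^ ga by rewrite -powRrM mulVf ?gt_eqF// powRr1// ltW.
  by apply: gt0_ltr_powR => //; rewrite nnegrE// ltW.
apply: (@le_lt_trans _ _ (r t `^ ga * (M + 1))).
  by rewrite ler_wpM2l ?powR_ge0// lerDl.
by rewrite -ltr_pdivlMr.
Qed.

(** The calibration applies up to a time [t] close to the collision time [z], and its boundary term
    at [t] is at most r(t)^ga M, which tends to [0]. Allowing [z] to be either end covers the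
    incoming and the outgoing branch. *)
Lemma collision_calibration (a b y z ga M : R) V r th v (f f1 : R -> R) : a < b ->
  (z = a /\ y = b) \/ (z = b /\ y = a) -> 0 < ga -> 0 <= M ->
  C1_punctured V -> H1_path a b r th v ->
  (forall t, t \in `[a, b]%R -> (0 <= pot_ext V (polar (r t) (th t)))%E) ->
  r z = 0 ->
  (forall t, t \in `[a, b]%R -> t != z ->
    [/\ 0 < r t, is_derive (th t) 1 f (f1 (th t)), `|f (th t)| <= M &
    (r t `^ (ga - 1)) ^+ 2 * ((ga * f (th t)) ^+ 2 + f1 (th t) ^+ 2) <
      2 * V (polar (r t) (th t))]) ->
  ((r y `^ ga * f (th y))%:E <=
   action V a b (fun t => polar (r t) (th t)) v)%E.
Proof.
move=> ab zy ga0 M0 hV h p0 rz hyp.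
have ab' := ltW ab.
have cr := radius_continuous ab' h; have [r0 _ _ _] := h.
set Ac := action _ _ _ _ _.
have Ac0 : (0 <= Ac)%E by exact: action_ge0.
case EAc : Ac Ac0 => [x| |] Ac0'; [|by rewrite leey|by []].
rewrite lee_fin; rewrite leNgt; apply/negP => hlt.
have aab : a \in `[a, b]%R by rewrite in_itv/= lexx.
have bab : b \in `[a, b]%R by rewrite in_itv/= lexx andbT.
have e0 : 0 < r y `^ ga * f (th y) - x by rewrite subr_gt0.
have zab : z \in `[a, b]%R by case: zy => -[->].
have cz : r t @[t --> within `[a, b] (nbhs z)] --> (0 : R).
  by rewrite -rz; move/subspace_continuousP : cr; exact.
have nr : \forall t \near within `[a, b] (nbhs z), 0 <= r t.
  have : \forall t \near z, t \in `[a, b]%R -> 0 <= r t by apply: filterE => t; exact: r0.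
  by [].
have WF : Filter (within `[a, b] (nbhs z)) by exact: within_filter.
have [d /= d0 Hd] := powR_small WF cz nr ga0 M0 e0.
have [t [tab tz tzd]] : exists t, [/\ t \in `[a, b]%R, t != z & `|z - t| < d].
  case: zy => -[-> _].
    exists (Num.min b (a + d / 2)); split.
    - by rewrite in_itv/= le_min ab' ge_min lexx/= lerDl divr_ge0// ltW.
    - by rewrite gt_eqF// lt_min ab ltrDl divr_gt0.
    - rewrite ltr0_norm ?subr_lt0 ?lt_min ?ab ?ltrDl ?divr_gt0//.
      rewrite opprB ltrBlDr gt_min; apply/orP; right; lra.
  exists (Num.max a (b - d / 2)); split.
  - rewrite in_itv/= ge_max ab' le_max lexx/= gerBl.
    by rewrite divr_ge0// ltW.
  - by rewrite lt_eqF// gt_max ab ltrBlDr ltrDl divr_gt0.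
  - rewrite gtr0_norm; last by rewrite subr_gt0 gt_max ab ltrBlDr ltrDl divr_gt0.
    rewrite ltrBlDr -ltrBlDl lt_max; apply/orP; right; lra.
have Ht := Hd t tzd tab.
have [_ _ fM _] := hyp t tab tz.
have bound : `|r y `^ ga * f (th y) - r t `^ ga * f (th t)| <= x.
  rewrite -lee_fin -EAc.
  have sub s s' : a <= s -> s <= s' -> s' <= b -> (z < s \/ s' < z) ->
      (`|r s' `^ ga * f (th s') - r s `^ ga * f (th s)|%:E <= Ac)%E.
    move=> as_ ss sb zs.
    apply: (le_trans _ (action_subset ab' hV h as_ sb p0)).
    apply: (@calibration_le _ s s' ga V r th v f f1 ss hV (H1_path_sub as_ ss sb h)) => q.
    rewrite in_itv/= => /andP[sq qs].
    have qab : q \in `[a, b]%R by rewrite in_itv/= (le_trans as_ sq) (le_trans qs sb).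
    have qz : q != z.
      case: zs => zs; first by rewrite gt_eqF// (lt_le_trans zs).
      by rewrite lt_eqF// (le_lt_trans qs).
    by have [h1 h2 _ h3] := hyp q qab qz.
  move: tab; rewrite in_itv/= => /andP[at_ tb].
  case: zy => -[ez ey]; rewrite ey.
    by apply: sub => //; left; rewrite ez lt_neqAle at_ eq_sym -ez tz.
  rewrite distrC; apply: sub => //; right.
  by rewrite ez lt_neqAle tb -ez tz.
have hft : `|r t `^ ga * f (th t)| <= r t `^ ga * M.
  by rewrite normrM ger0_norm ?powR_ge0// ler_wpM2l// powR_ge0.
move: bound hft; rewrite !ler_norml => /andP[_ h1] /andP[_ h2]; lra.
Qed.

End Collision.

(** * Arcs of leaves and the comparison argument *)

Section Arc.
Context {R : realType}.
Notation mu := (@lebesgue_measure R).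
Implicit Types (U r th v w : R -> R) (V : R * R -> R).

(* The rescaled leaf [(lam r, th)] run at speed [lam `^ (- (1 + al / 2))] is
   again a zero-energy trajectory, along which the action is the variation of
   the Hamilton-Jacobi solution. *)
Lemma scaled_arc U (al lam eta s1 s2 : R) r th v w V :
  0 < al < 2 -> 0 < lam -> 0 <= eta -> (forall t, 0 <= U t) ->
  C1_punctured V -> (forall t, zero_energy_flow U al r th v w t) ->
  (forall s, Num.min s1 s2 <= s <= Num.max s1 s2 ->
     V (polar (lam * r s) (th s)) <= (1 + eta) * (U (th s) / (lam * r s) `^ al)) ->
  exists T ry thy vy Ay, [/\ T = lam `^ (1 + al / 2) * `|s2 - s1|,
    [/\ H1_path 0 T ry thy vy,
        mu.-integrable `[0, T] (fun t => pot_ext V (polar (ry t) (thy t))) &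
        action V 0 T (fun t => polar (ry t) (thy t)) vy = Ay%:E],
    ry 0 = lam * r s1 /\ thy 0 = th s1,
    ry T = lam * r s2 /\ thy T = th s2 &
    Ay <= (1 + eta) * `|lam `^ (1 - al / 2) *
      (r s2 `^ (1 - al / 2) * (v s2 / (1 - al / 2)) -
       r s1 `^ (1 - al / 2) * (v s1 / (1 - al / 2)))|].
Proof.
move=> /andP[al0 al2] lam0 eta0 U0 hV fl Vle.
have g0 : 0 < 1 - al / 2 by rewrite subr_gt0 ltr_pdivrMr// mul1r.
pose m := lam `^ (1 + al / 2).
have m0 : 0 < m by rewrite powR_gt0.
(* Orientation of the arc: its ends may come in either order on the leaf, and reversing time does
   not change the action. *)
pose e : R := if s1 <= s2 then 1 else -1.
have e2 : e ^+ 2 = 1 by rewrite /e; case: ifP => _; rewrite ?sqrrN expr1n.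
have e1 : `|e| = 1 by rewrite /e; case: ifP => _; rewrite ?normrN normr1.
have es : e * `|s2 - s1| = s2 - s1.
  rewrite /e; case: leP => s12.
    by rewrite mul1r ger0_norm// subr_ge0.
  by rewrite ltr0_norm ?subr_lt0// mulN1r opprK.
pose k := e / m; pose T := m * `|s2 - s1|.
have T0 : 0 <= T by rewrite mulr_ge0// ltW.
have kT : k * T = s2 - s1 by rewrite -es /k /T; field; rewrite gt_eqF.
pose S t := s1 + k * t.
have S0 : S 0 = s1 by rewrite /S mulr0 addr0.
have ST : S T = s2 by rewrite /S kT subrKC.
have dS (t : R) : is_derive t 1 S k.
  apply: (isD_eq (isD_add (isD_cst t s1) (isD_scale k (isD_id t)))).
  by rewrite mulr1 add0r.
have cS : continuous S by move=> t; exact: isD_continuous (dS t).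
have Sb t : t \in `[0, T]%R -> Num.min s1 s2 <= S t <= Num.max s1 s2.
  rewrite in_itv/= => /andP[t0 tT].
  have kt : k * t = e * (t / m) by rewrite /k; ring.
  have q0 : 0 <= t / m by rewrite divr_ge0// ltW.
  have q1 : t / m <= `|s2 - s1| by rewrite ler_pdivrMr// mulrC.
  move: es q1; rewrite /S kt /e; case: ifPn => [s12|]; last first.
    rewrite -ltNge => s21; rewrite ltr0_norm ?subr_lt0// => _ q1.
    rewrite (min_idPr (ltW s21)) (max_idPl (ltW s21)); apply/andP; split; lra.
  rewrite ger0_norm ?subr_ge0// => _ q1.
  rewrite (min_idPl s12) (max_idPr s12); apply/andP; split; lra.
have r0 s : 0 < r s by case: (fl s).
have dr (s : R) : is_derive s 1 r (v s * r s `^ (- (al / 2))) by case: (fl s).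
have dth (s : R) : is_derive s 1 th (w s * r s `^ (- (1 + al / 2))) by case: (fl s).
have dv (s : R) : is_derive s 1 v ((1 - al / 2) * w s ^+ 2 * r s `^ (- (1 + al / 2))).
  by case: (fl s).
have cw : continuous w by move=> s; case: (fl s) => _ _ _ _ [].
have hj s : v s ^+ 2 + w s ^+ 2 = 2 * U (th s) by case: (fl s) => _ _ _ _ [].
have cv : continuous v by move=> s; exact: isD_continuous (dv s).
have cp p : continuous (fun s => r s `^ p).
  by move=> s; exact: isD_continuous (isD_powR p (dr s) (r0 s)).
have cScomp (f : R -> R) : continuous f -> continuous (fun t => f (S t)).
  by move=> cf t; apply: continuous_comp; [exact: cS|exact: cf].
pose ry t := lam * r (S t); pose thy t := th (S t).
pose dry t := lam * (v (S t) * r (S t) `^ (- (al / 2)) * k).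
pose dthy t := w (S t) * r (S t) `^ (- (1 + al / 2)) * k.
have hdry (t : R) : is_derive t 1 ry (dry t).
  exact: (isD_scale lam (isD_comp (dS t) (dr (S t)))).
have hdthy (t : R) : is_derive t 1 thy (dthy t).
  exact: (isD_comp (dS t) (dth (S t))).
have ry0 t : 0 < ry t by rewrite mulr_gt0.
have cdry : continuous dry.
  move=> t; apply: cvgM; first exact: cvg_cst.
  apply: cvgM; last exact: cvg_cst.
  by apply: (cScomp (fun s => v s * r s `^ (- (al / 2)))) => s; apply: cvgM; [exact: cv|exact: cp].
have cdthy : continuous dthy.
  move=> t; apply: cvgM; last exact: cvg_cst.
  by apply: (cScomp (fun s => w s * r s `^ (- (1 + al / 2)))) => s; apply: cvgM; [exact: cw|exact: cp].
have hy : H1_path 0 T ry thy (polar_velocity ry dry thy dthy).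
  apply: H1_path_C1 => //; try exact: continuous_subspaceT.
  by move=> t _; split => //; exact: ltW.
have iy : mu.-integrable `[0, T] (fun t => pot_ext V (polar (ry t) (thy t))).
  by apply: (potential_integrable_pos T0 hV hy).
(* By zero energy [L] is the squared speed and twice the homogeneous potential, hence the Lagrangian
   of the homogeneous problem. It is also the derivative of [Psi], the Hamilton-Jacobi solution
   along the arc up to the sign [e]. *)
pose L t := m ^-1 * lam `^ (1 - al / 2) * ((v (S t) ^+ 2 + w (S t) ^+ 2) * r (S t) `^ (- al)).
have cL : continuous L.
  move=> t; apply: cvgM; first exact: cvg_cst.
  apply: (cScomp (fun s => (v s ^+ 2 + w s ^+ 2) * r s `^ (- al))) => s.
  apply: cvgM; last exact: cp.
  rewrite !expr2; under eq_fun do rewrite !expr2.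
  by apply: cvgD; apply: cvgM; [exact: cv|exact: cv|exact: cw|exact: cw].
pose psi s := r s `^ (1 - al / 2) * (v s / (1 - al / 2)).
have dpsi (s : R) : is_derive s 1 psi ((v s ^+ 2 + w s ^+ 2) * r s `^ (- al)).
  apply: (isD_eq (isD_mul (isD_powR (1 - al / 2) (dr s) (r0 s))
    (isD_mul (dv s) (isD_cst s (1 - al / 2)^-1)))).
  have [q0 q2 q3 q4 q5] := powR_halves al (r0 s).
  have rn : r s != 0 by rewrite gt_eqF.
  have -> : r s `^ (1 - al / 2 - 1) = (r s `^ (al / 2))^-1.
    by rewrite -powRN; congr (_ `^ _); ring.
  have -> : r s `^ (1 - al / 2) = r s / r s `^ (al / 2).
    by rewrite powRB ?rn ?implybT// powRr1// ltW.
  have -> : r s `^ (- al) = (r s `^ (al / 2))^-1 ^+ 2.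
    by rewrite powRN q2 exprVn.
  rewrite q4 q5 mulr0 addr0.
  set q := r s `^ (al / 2) in q0 *; have gn := lt0r_neq0 g0.
  set g := 1 - al / 2 in gn *; set x := r s in rn *; clearbody q g x.
  by field; rewrite q0 rn gn.
have mL : m^-1 * lam `^ (1 - al / 2) = lam `^ (- al).
  have lamn : lam != 0 by rewrite gt_eqF.
  rewrite /m -powRN -powRD ?lamn ?implybT//.
  by congr (_ `^ _); field.
have en t : dry t ^+ 2 + (ry t * dthy t) ^+ 2 = L t.
  have [q0 q2 q3 q4 q5] := powR_halves al (r0 (S t)).
  have [l0 l2 l3 l4 l5] := powR_halves al lam0.
  have rn : r (S t) != 0 by rewrite gt_eqF.
  have lamn : lam != 0 by rewrite gt_eqF.
  rewrite /L mL /dry /dthy /ry q4 q5 [r _ `^ (- al)]powRN q2 [lam `^ (- al)]powRN l2.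
  have -> : k = e / (lam * lam `^ (al / 2)).
    by rewrite /k /m powRD ?lamn ?implybT// powRr1// ltW.
  set q := r (S t) `^ (al / 2) in q0 *; set l := lam `^ (al / 2) in l0 *.
  set x := r (S t) in rn *; clearbody q l x.
  transitivity (e ^+ 2 * ((v (S t) ^+ 2 + w (S t) ^+ 2) / (l ^+ 2 * q ^+ 2))).
    by field; rewrite q0 l0 rn lamn.
  by rewrite e2; field; rewrite q0 l0.
have LV t : L t = 2 * (U (thy t) / (ry t) `^ al).
  rewrite /L mL hj /ry powRM ?(ltW lam0) ?(ltW (r0 _))// !powRN.
  have p1 : lam `^ al != 0 by rewrite gt_eqF// powR_gt0.
  have p2 : r (S t) `^ al != 0 by rewrite gt_eqF// powR_gt0.
  by rewrite /thy; field; rewrite p1 p2.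
have fin : action V 0 T (fun t => polar (ry t) (thy t)) (polar_velocity ry dry thy dthy) \is a fin_num.
  apply: integrable_fin_num => //; apply: integrableD => //.
  exact: kinetic_integrable hy.
exists T, ry, thy, (polar_velocity ry dry thy dthy), (fine (action V 0 T (fun t => polar (ry t) (thy t)) (polar_velocity ry dry thy dthy))).
split => //.
- by split => //; rewrite fineK.
- by rewrite /ry /thy S0.
- by rewrite /ry /thy ST.
rewrite -lee_fin fineK//.
pose Psi t := e * lam `^ (1 - al / 2) * psi (S t).
have dPsi (t : R) : is_derive t 1 Psi (L t).
  apply: (isD_eq (isD_scale (e * lam `^ (1 - al / 2)) (isD_comp (dS t) (dpsi (S t))))).
  transitivity (e ^+ 2 * L t); last by rewrite e2 mul1r.
  by rewrite /L /k; ring.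
have iL : mu.-integrable `[0, T] (EFin \o L).
  by apply: integrable_segment_continuous; exact: continuous_subspaceT.
(* The excess of [V] over the homogeneous potential affects only the potential half of [L], so the
   factor [1 + eta] on the whole of [L] absorbs it. *)
have h1 : (action V 0 T (fun t => polar (ry t) (thy t)) (polar_velocity ry dry thy dthy) <=
    \int[mu]_(t in `[0%R, T]) ((1 + eta)%:E * (L t)%:E))%E.
  apply: le_integral => //.
  - by apply: integrableD => //; exact: kinetic_integrable hy.
  - exact: integrableZl.
  - move=> t tT; rewrite inE/= in tT; rewrite /kinetic enorm_polar_velocity en.
    rewrite /pot_ext polar_eq0 gt_eqF ?ry0// -EFinM -EFinD lee_fin.
    have := Vle _ (Sb t tT); rewrite -/(ry t) -/(thy t).
    have : U (thy t) / ry t `^ al = L t / 2 by rewrite LV; field; rewrite gt_eqF// powR_gt0.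
    have L0 : 0 <= L t by rewrite LV mulr_ge0// divr_ge0// powR_ge0.
    have : 0 <= eta * L t by rewrite mulr_ge0.
    by move=> h -> h'; apply: (le_trans (lerD (lexx _) h')); lra.
apply: (le_trans h1).
rewrite integralZl// (integral_FTC T0 (fun t _ => dPsi t)); last exact: continuous_subspaceT.
rewrite -EFinM lee_fin ler_wpM2l ?addr_ge0//.
rewrite /Psi S0 ST -mulrBr -mulrA (le_trans (ler_norm _))//.
by rewrite normrM e1 mul1r.
Qed.

End Arc.

(** * Comparison with the homogeneous potential and balance of orders *)

Section Comparison.
Context {R : realType}.
Implicit Types (U : R -> R) (V W : R * R -> R).

(** [W] is negligible against r^(-al') with [al' < al], while the homogeneous part is at least Um
    r^(-al). For [r < 1] the first power is the smaller one, so the error is small relative to the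
    potential itself. *)
Lemma potential_comparison U (al Um : R) V W :
  (forall t, U (t + 2 * pi) = U t) -> 0 < Um -> (forall t, Um <= U t) ->
  (forall x : R * R, x != 0 -> V x = homog_pot U al x + W x) ->
  (exists2 alpha' : R, alpha' < al &
     enorm x `^ alpha' * (`|W x| + enorm x * enorm (grad W x))
       @[x --> (0 : R * R)^'] --> (0 : R)) ->
  forall eta : R, 0 < eta -> exists2 p, 0 < p & forall r a, 0 < r -> r < p ->
    `|V (polar r a) - U a / r `^ al| <= eta * (U a / r `^ al).
Proof.
move=> per Um0 hUm hVW [al' hal' hW] eta eta0.
have e0 : 0 < eta * Um by rewrite mulr_gt0.
have nW : \forall x \near (0 : R * R), x != 0 ->
    enorm x `^ al' * (`|W x| + enorm x * enorm (grad W x)) < eta * Um.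
  exact: (cvgr_lt _ hW).
have /nbhs_ballP[d /= d0 Hd] := nW.
exists (Num.min d 1); first by rewrite lt_min d0 ltr01.
move=> r a r0; rewrite lt_min => /andP[rd r1].
have x0 : polar r a != 0 by rewrite polar_eq0 gt_eqF.
rewrite hVW// homog_pot_polar// addrAC subrr add0r.
have small (c : R) : `|c| <= 1 -> `|0 - r * c| < d.
  move=> c1; rewrite sub0r normrN normrM (gtr0_norm r0).
  by apply: le_lt_trans rd; rewrite -[leRHS]mulr1 ler_wpM2l// ltW.
have hb : ball (0 : R * R) d (polar r a).
  by split; [apply: small; exact: cos_max|apply: small; exact: sin_max].
have := Hd (polar r a) hb x0; rewrite enorm_polar ?(ltW r0)//.
set w := `|W _|; set g := r * _ => h.
have g0 : 0 <= g by rewrite mulr_ge0 ?enorm_ge0// ltW.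
have p0 : 0 < r `^ al' by rewrite powR_gt0.
have p1 : 0 < r `^ al by rewrite powR_gt0.
have pp : r `^ al <= r `^ al'.
  by apply: ger_powR; rewrite ?r0 ?(ltW r1)// ltW.
have h1 : r `^ al' * w < eta * Um.
  by apply: le_lt_trans h; rewrite ler_wpM2l ?(ltW p0)// lerDl.
rewrite mulrA ler_pdivlMr//.
apply: (@le_trans _ _ (eta * Um)); last by rewrite ler_pM2l.
apply: le_trans (ltW h1); by rewrite mulrC ler_wpM2r// normr_ge0.
Qed.

(** [A] is the action of the colliding piece, [D] the increment |S(q) - S(p)|, [La] the factor
    lam^ga, [tau] and [T] the old and new durations, [C] the surgery constant. The cost of [tau] is
    bounded by a fraction [x] of [A] itself and absorbed on the left; the remaining errors stay
    below [d * La]. *)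
Lemma action_gap_contradiction (A D d La x eta C t0 S tau T : R) :
  D + d * La <= A -> A <= (1 + eta) * D + C * (tau + T) ->
  C * tau <= x * A -> C * T <= t0 * La -> D <= S * La -> 0 <= D ->
  0 <= x -> x < 1 -> 0 < La -> 0 <= eta -> 0 <= d ->
  eta * S + t0 + x * (S + d) < d -> False.
Proof.
move=> h1 h2 h3 h4 h5 D0 x0 x1 La0 eta0 d0 h6.
have k1 : (1 - x) * (D + d * La) <= (1 - x) * A.
  by rewrite ler_wpM2l// subr_ge0 ltW.
have k2 : eta * D <= eta * (S * La) by rewrite ler_wpM2l.
have k3 : x * (D + d * La) <= x * (S * La + d * La) by rewrite ler_wpM2l// lerD2r.
have k4 : (eta * S + t0 + x * (S + d)) * La < d * La by rewrite ltr_pM2r.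
lra.
Qed.

End Comparison.

Lemma powR_le (R : realType) (p x y : R) : 0 <= p -> 0 <= x -> x <= y ->
  x `^ p <= y `^ p.
Proof.
move=> p0 x0 xy; apply: ge0_ler_powR => //; rewrite nnegrE//.
exact: le_trans xy.
Qed.

Section SectorLeaf.
Context {R : realType}.
Implicit Types U : R -> R.

Lemma EVT_bound (f : R -> R) (a b : R) : a <= b -> continuous f ->
  exists M, forall s, a <= s <= b -> `|f s| <= M.
Proof.
move=> ab cf.
have c : {within `[a, b], continuous (fun s => `|f s|)}.
  apply: continuous_subspaceT => s; apply: cvg_norm; exact: cf.
by have [z _ h] := EVT_max ab c; exists `|f z| => s; exact: h.
Qed.

Lemma EVT_pos (f : R -> R) (a b : R) : a <= b -> continuous f ->
  (forall s, a <= s <= b -> 0 < f s) ->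
  exists2 m, 0 < m & forall s, a <= s <= b -> m <= f s.
Proof.
move=> ab cf f0.
have [z zab h] := EVT_min ab (continuous_subspaceT cf).
by exists (f z); [exact: f0|move=> s; exact: h].
Qed.

Lemma sector_leaf theta1 theta2 U thm thp (al A B : R) :
  calU theta1 theta2 U -> Theta theta1 theta2 thm -> Theta theta1 theta2 thp ->
  0 < al < 2 -> al = alpha_bar thm thp U ->
  Num.min thm thp < A -> A <= B -> B < Num.max thm thp ->
  exists r th v w sig s0 s1 gm gM om0 Mu,
  [/\ forall t, zero_energy_flow U al r th v w t,
      [/\ s0 < s1, 0 < gm, 0 < om0 & 0 <= Mu],
      forall s, s0 <= s <= s1 -> gm <= r s <= gM &
      forall phi, A <= phi <= B ->
       [/\ s0 <= sig phi <= s1, th (sig phi) = phi, {for phi, continuous sig},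
         is_derive phi 1 (fun x => v (sig x) / (1 - al / 2)) (w (sig phi)) &
         om0 <= w (sig phi) /\ `|v (sig phi) / (1 - al / 2)| <= Mu]].
Proof.
move=> hU Tm Tp hal eal mA AB BM.
(* The midpoints leave room on both sides: [sig] is differentiable only over the open interval
   between [a] and [b], which contains the closed [[A, B]]. *)
pose a := (Num.min thm thp + A) / 2; pose b := (B + Num.max thm thp) / 2.
have ma : Num.min thm thp < a by rewrite /a; lra.
have aA : a < A by rewrite /a; lra.
have Bb : B < b by rewrite /b; lra.
have bM : b < Num.max thm thp by rewrite /b; lra.
have ab : a < b by lra.
have [r [th [v [w [fl [s0 [s1 [s01 e0 e1 hw]]]]]]]] :=
  parabolic_sector hU Tm Tp hal eal ma ab bM.
have [sig hsig] := leaf_inverse hal s01 fl (fun s hs => (hw s hs).1).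
have cr : continuous r by move=> s; case: (fl s) => _ /isD_continuous.
have cv : continuous v by move=> s; case: (fl s) => _ _ _ /isD_continuous.
have cw : continuous w by move=> s; case: (fl s) => _ _ _ _ [].
have [gm gm0 hgm] := EVT_pos (ltW s01) cr (fun s _ => let: And5 h _ _ _ _ := fl s in h).
have [gM hgM] := EVT_bound (ltW s01) cr.
have [om0 om00 hom] := EVT_pos (ltW s01) cw (fun s hs => (hw s hs).1).
have [Mv hMv] := EVT_bound (ltW s01) cv.
exists r, th, v, w, sig, s0, s1, gm, gM, om0, (`|Mv| / `|1 - al / 2|).
split => //.
  by move=> s hs; rewrite hgm//= (le_trans (ler_norm _))// hgM.
move=> phi /andP[h1 h2].
have [hs eth cs dsig] : [/\ sig phi \in `]s0, s1[%R, th (sig phi) = phi,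
      {for phi, continuous sig} &
      is_derive phi 1 (fun x => v (sig x) / (1 - al / 2)) (w (sig phi))].
  by apply: hsig; rewrite e0 e1 (lt_le_trans aA h1) (le_lt_trans h2 Bb).
have hs' : s0 <= sig phi <= s1.
  by move: hs; rewrite in_itv/= => /andP[/ltW-> /ltW->].
split => //; split; first exact: hom.
by rewrite normrM normfV ler_wpM2r ?invr_ge0// (le_trans (hMv _ hs'))// ler_norm.
Qed.

End SectorLeaf.

(** * Lower bound for a piece that passes through the origin *)

Section LowerBound.
Context {R : realType}.
Implicit Types (r th : R -> R) (v : R -> R * R) (V : R * R -> R).

(** The piece may meet the origin many times. Only the part before the first collision and the part
    after the last one are estimated, by separate subsolutions [f] and [h]; what lies between has
    nonnegative action. *)
Lemma action_through_collision (a b c ga M : R) V r th v (f f1 h h1 : R -> R) :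
  a < c -> c < b -> 0 < ga -> 0 <= M ->
  C1_punctured V -> H1_path a b r th v ->
  (forall t, t \in `[a, b]%R -> (0 <= pot_ext V (polar (r t) (th t)))%E) ->
  r c = 0 -> 0 < r a -> 0 < r b ->
  (forall t, t \in `[a, b]%R -> 0 < r t ->
    [/\ is_derive (th t) 1 f (f1 (th t)), `|f (th t)| <= M &
    (r t `^ (ga - 1)) ^+ 2 * ((ga * f (th t)) ^+ 2 + f1 (th t) ^+ 2) <
      2 * V (polar (r t) (th t))]) ->
  (forall t, t \in `[a, b]%R -> 0 < r t ->
    [/\ is_derive (th t) 1 h (h1 (th t)), `|h (th t)| <= M &
    (r t `^ (ga - 1)) ^+ 2 * ((ga * h (th t)) ^+ 2 + h1 (th t) ^+ 2) <
      2 * V (polar (r t) (th t))]) ->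
  ((r a `^ ga * f (th a) + r b `^ ga * h (th b))%:E <=
   action V a b (fun t => polar (r t) (th t)) v)%E.
Proof.
move=> ac cb ga0 M0 hV hp p0 rc ra rb hf hh.
have ab : a <= b by exact: ltW (lt_trans ac cb).
have [r0 _ _ _] := hp.
have cr := radius_continuous ab hp.
have cNr (x y : R) : a <= x -> y <= b -> {within `[x, y], continuous (fun t => - r t)}.
  move=> ax yb t; apply: cvgN.
  by apply: (continuous_subspaceW _ cr); exact: segment_sub.
have Nra : - r a < 0 by rewrite oppr_lt0.
have Nrb : - r b < 0 by rewrite oppr_lt0.
have Nrc : 0 <= - r c by rewrite rc oppr0.
(* Collisions are the times at which [- r] reaches the level [0] from below. *)
have [c1 [ac1 c1c rc1 pos1]] := first_hit (ltW ac) (cNr _ _ (lexx a) (ltW cb)) Nra Nrc.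
have [c2 [cc2 c2b rc2 pos2]] := last_hit (ltW cb) (cNr _ _ (ltW ac) (lexx b)) Nrb Nrc.
have {}rc1 : r c1 = 0 by apply/eqP; rewrite -oppr_eq0 rc1.
have {}rc2 : r c2 = 0 by apply/eqP; rewrite -oppr_eq0 rc2.
have c1b : c1 <= b by exact: le_trans c1c (ltW cb).
have ac2 : a <= c2 by exact: le_trans (ltW ac) cc2.
have hp1 := H1_path_sub (lexx a) (ltW ac1) c1b hp.
have hp2 := H1_path_sub ac2 (ltW c2b) (lexx b) hp.
have hp3 := H1_path_sub (ltW ac1) c1b (lexx b) hp.
have sub1 := segment_sub (lexx a) c1b.
have sub2 := segment_sub ac2 (lexx b).
have sub3 := segment_sub (ltW ac1) (lexx b).
have A1 : ((r a `^ ga * f (th a))%:E <= action V a c1 (fun t => polar (r t) (th t)) v)%E.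
  apply: (@collision_calibration _ a c1 a c1 ga M V r th v f f1) => //.
  - by right.
  - by move=> t /sub1; exact: p0.
  - move=> t tac; have := tac; rewrite in_itv/= => /andP[at_ tc1] tn.
    have rt : 0 < r t by rewrite -oppr_lt0 pos1// lt_neqAle tn.
    by have [q1 q2 q3] := hf t (sub1 t tac) rt.
have A2 : ((r b `^ ga * h (th b))%:E <= action V c2 b (fun t => polar (r t) (th t)) v)%E.
  apply: (@collision_calibration _ c2 b b c2 ga M V r th v h h1) => //.
  - by left.
  - by move=> t /sub2; exact: p0.
  - move=> t tac; have := tac; rewrite in_itv/= => /andP[ct tb] tn.
    have rt : 0 < r t by rewrite -oppr_lt0 pos2// lt_neqAle eq_sym tn.
    by have [q1 q2 q3] := hh t (sub2 t tac) rt.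
rewrite EFinD; apply: (le_trans (leeD A1 A2)).
(* Passing from [[c2, b]] to [[c1, b]] adds the nonnegative action between the first and the last
   collision. *)
have A3 : (action V c2 b (fun t => polar (r t) (th t)) v <=
    action V c1 b (fun t => polar (r t) (th t)) v)%E.
  apply: (action_subset c1b hV hp3) => //; first exact: le_trans cc2.
  by move=> t /sub3; exact: p0.
apply: (le_trans (leeD (lexx _) A3)).
rewrite /action -(integral_segment_cat (ltW ac1) c1b)//.
exact: lagrangian_measurable ab hV hp.
Qed.

End LowerBound.

(** * Exclusion of collisions: constants, choice of the scale, contradiction *)

Theorem proposition1p5 (R : realType) (theta1 theta2 : R)
  (htheta : 0 <= theta1 /\ theta1 <= theta2 /\ theta2 < 2 * pi)
  (U : R -> R) (hU : calU theta1 theta2 U)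
  (thm thp : R) (hthm : Theta theta1 theta2 thm)
  (hthp : Theta theta1 theta2 thp) (hneq : thm <> thp)
  (alpha : R) (halpha : 0 < alpha < 2)
  (V W : R * R -> R)
  (hVW : forall x : R * R, x != 0 -> V x = homog_pot U alpha x + W x)
  (hV : C1_punctured V)
  (hW : exists2 alpha' : R, alpha' < alpha &
     enorm x `^ alpha' * (`|W x| + enorm x * enorm (grad W x))
       @[x --> (0 : R * R)^'] --> (0 : R))
  (hbar : alpha = alpha_bar thm thp U)
  (r1 phi1 r2 phi2 : R) (hr1 : 0 < r1) (hr2 : 0 < r2)
  (hphi1 : Num.min thm thp < phi1 < Num.max thm thp)
  (hphi2 : Num.min thm thp < phi2 < Num.max thm thp)
  (t1 t2 : R) (ht : t1 < t2) (r th : R -> R)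
  (hmin : bolza_minimizer V t1 t2 r1 phi1 r2 phi2 r th)
  (hsector : exists2 eps : R, 0 < eps &
     within_sector t1 t2 (Num.min thm thp + eps) (Num.max thm thp - eps) r th) :
  collisionless t1 t2 r.
Proof.
have [v hadm hopt] := hmin.
have [hpath [er1 eth1] [er2 eth2]] := hadm.
have [r0 cth _ _] := hpath.
have t12 := ltW ht.
have cr := radius_continuous t12 hpath.
have [t0 t0t rmin] := EVT_min t12 cr.
have [rt0|rt0] := ltP 0 (r t0); first by exists t0.
exfalso; have {rt0}rt0 : r t0 = 0 by apply/eqP; rewrite eq_le rt0 r0.
have {rmin t0t} [t10 t02] : t1 <= t0 /\ t0 <= t2.
  by move: t0t; rewrite in_itv/= => /andP[].
have [eps eps0 hsec] := hsector.
set A := Num.min thm thp + eps in hsec; set B := Num.max thm thp - eps in hsec.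
have AB : A <= B.
  have := hsec t1; rewrite in_itv/= lexx t12 er1 => /(_ isT hr1).
  by rewrite in_itv/= => /andP[]; exact: le_trans.
have mA : Num.min thm thp < A by rewrite ltrDl.
have BM : B < Num.max thm thp by rewrite ltrBlDr ltrDl.
have [rr [tt [vv [ww [sig [s0 [s1 [gm [gM [om0 [Mu [fl [s01 gm0 om00 Mu0] hg hsig]]]]]]]]]]]] :=
  sector_leaf hU hthm hthp halpha hbar mA AB BM.
have /andP[al0 al2] := halpha.
set ga := 1 - alpha / 2 in hsig.
have ga0 : 0 < ga by rewrite subr_gt0 ltr_pdivrMr// mul1r.
have [_ per Umin [_ Um0] _] := hU.
set Um := U theta1 in Umin Um0.
have U0 phi : 0 < U phi by exact: lt_le_trans (Umin phi).
have [UM hUM] := EVT_bound AB (calU_continuous hU).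
have UM0 : 0 < UM.
  apply: lt_le_trans (U0 A) (le_trans (ler_norm _) _).
  by apply: hUM; rewrite lexx.
pose u phi := vv (sig phi) / ga; pose om phi := ww (sig phi).
have hj phi : A <= phi <= B -> (ga * u phi) ^+ 2 + om phi ^+ 2 = 2 * U phi.
  move=> /hsig[_ eth _ _ _]; have [_ _ _ _ [e _]] := fl (sig phi).
  by rewrite eth in e; rewrite -e /u /om mulrC divfK// gt_eqF.
have [c0 [kap [M [c00 kap0 hsub]]]] : exists c0 kap M, [/\ 0 < c0, 0 < kap &
    forall sg : R, `|sg| = 1 -> exists f f1, forall phi, A <= phi <= B ->
      [/\ is_derive phi 1 f (f1 phi), sg * u phi + c0 <= f phi, `|f phi| <= M &
        (ga * f phi) ^+ 2 + f1 phi ^+ 2 < 2 * (1 - kap) * U phi]].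
  apply: (@strict_subsolutions _ A B ga om0 Mu UM u om U ga0 om00 UM0) => phi hphi.
  have [_ _ _ du [h1 h2]] := hsig phi hphi.
  split; [exact: du|exact: h1|exact: h2| |exact: hj].
  exact: le_trans (ler_norm _) (hUM _ hphi).
have AAB : A <= A <= B by rewrite lexx.
have M0 : 0 <= M.
  have [f [f1 h]] := hsub 1 (normr1 _); have [_ _ h' _] := h A AAB.
  exact: le_trans (normr_ge0 _) h'.
have gM0 : 0 < gM.
  have /andP[h1 h2] := hg s0 (introT andP (conj (lexx _) (ltW s01))).
  exact: lt_le_trans gm0 (le_trans h1 h2).
(* Saving per unit of lam^ga: each of the two branches contributes [c0] times the least radius
   factor on the leaf. [S1] below bounds |S(q) - S(p)| in the same unit. *)
pose d := 2 * c0 * gm `^ ga.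
have d0 : 0 < d by rewrite !mulr_gt0// powR_gt0.
pose S1 := 2 * (gM `^ ga * Mu).
have S10 : 0 <= S1 by rewrite !mulr_ge0// powR_ge0.
(* [kap] keeps the strict subsolutions valid for [V], [2^-1] preserves half of the homogeneous
   potential, and the last term limits the loss [eta * S1] to [d / 4]. *)
pose eta := Num.min kap (Num.min 2^-1 (d / (4 * (S1 + 1)))).
have eta0 : 0 < eta.
  by rewrite !lt_min kap0 invr_gt0 ltr0n/= divr_gt0// mulr_gt0// ltr_wpDl.
have eta_kap : eta <= kap by rewrite ge_min lexx.
have eta_half : eta <= 2^-1 by rewrite ge_min ge_min lexx/= orbT.
have eta_S : eta * S1 <= d / 4.
  have h : eta <= d / (4 * (S1 + 1)) by rewrite !ge_min lexx !orbT.
  apply: (@le_trans _ _ (d / (4 * (S1 + 1)) * (S1 + 1))).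
    by apply: ler_pM => //; [exact: ltW|rewrite lerDl].
  rewrite le_eqVlt; apply/orP; left; apply/eqP; field.
  by rewrite gt_eqF// ltr_wpDl.
have [p p0 hp] := potential_comparison per Um0 Umin hVW hW eta0.
have Vlow rho phi : 0 < rho -> rho < p ->
    (1 - eta) * (U phi / rho `^ alpha) <= V (polar rho phi).
  move=> h1 h2; have := hp rho phi h1 h2; rewrite ler_norml => /andP[h3 _].
  by rewrite mulrBl mul1r; move: h3; clear; lra.
have Vup rho phi : 0 < rho -> rho < p ->
    V (polar rho phi) <= (1 + eta) * (U phi / rho `^ alpha).
  move=> h1 h2; have := hp rho phi h1 h2; rewrite ler_norml => /andP[_ h3].
  by rewrite mulrDl mul1r; move: h3; clear; lra.
have V0 rho phi : 0 < rho -> rho < p -> 0 < V (polar rho phi).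
  move=> h1 h2; apply: lt_le_trans (Vlow rho phi h1 h2).
  rewrite mulr_gt0 ?divr_gt0 ?powR_gt0// subr_gt0.
  by apply: le_lt_trans eta_half _; rewrite invf_lt1 ?ltr1n.
have ptp rho phi : 0 <= rho -> rho < p -> (0 <= pot_ext V (polar rho phi))%E.
  rewrite /pot_ext polar_eq0; case: ifPn => [_ _ _|rn h1 h2]; first exact: leey.
  by rewrite lee_fin ltW// V0// lt_neqAle eq_sym rn.
have Vp : exists2 q, 0 < q & forall x : R * R, 0 < enorm x < q -> 0 <= V x.
  exists p => // x /andP[x0 xp].
  by rewrite -[x]polar_arg -?enorm_gt0// ltW// V0.
have ip := minimizer_potential_integrable hV ht hr1 hr2 hadm hopt Vp.
(* [G t] is the scale of the leaf through the point at time [t]. *)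
pose cl x := Num.max A (Num.min x B).
have clAB x : A <= cl x <= B.
  by rewrite le_max lexx ge_max AB ge_min lexx orbT.
have clE x : A <= x <= B -> cl x = x.
  by move=> /andP[h1 h2]; rewrite /cl (min_idPl h2) (max_idPr h1).
have ccl : continuous cl.
  move=> x; apply: (@continuous_max _ _ (fun=> A) (fun x => Num.min x B)).
    exact: cvg_cst.
  by apply: (@continuous_min _ _ (fun x => x) (fun=> B)); [exact: cvg_id|exact: cvg_cst].
(* Clamping the angle makes [gc] continuous and bounded on the whole line; at a collision [th] is
   arbitrary and may lie outside [[A, B]]. *)
pose gc x := rr (sig (cl x)).
have gcb x : gm <= gc x <= gM.
  by apply: hg; have [] := hsig _ (clAB x).
have gc0 x : 0 < gc x by have /andP[h _] := gcb x; exact: lt_le_trans h.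
have cgc : continuous gc.
  move=> x; have [_ _ csig _ _] := hsig _ (clAB x).
  have crr : {for sig (cl x), continuous rr} by case: (fl (sig (cl x))) => _ /isD_continuous.
  apply: (@continuous_comp _ _ _ (fun x => sig (cl x)) rr) => //.
  by apply: (@continuous_comp _ _ _ cl sig) => //; exact: ccl.
pose G t := r t / gc (th t).
have G0 t : t \in `[t1, t2]%R -> 0 <= G t.
  by move=> h; rewrite divr_ge0 ?r0// ltW.
have rG t : r t = G t * gc (th t) by rewrite /G divfK// gt_eqF.
have cG : {within `[t1, t2], continuous G}.
  apply: dist_within => t tt12 e e0.
  (* At a collision the angle may jump, but [gc >= gm] bounds [G] by [r / gm], so [G] still tends to
     [0]. *)
  have [rt|rt] := eqVneq (r t) 0.
    have eg0 : 0 < e * gm by rewrite mulr_gt0.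
    have [dl dl0 H] := within_dist cr tt12 eg0.
    exists dl => // s st sd; have := H s st sd.
    rewrite rt sub0r normrN ger0_norm ?r0// /G rt mul0r sub0r normrN => h.
    rewrite ger0_norm; last exact: G0.
    rewrite ltr_pdivrMr//; apply: (lt_le_trans h); rewrite ler_pM2l//.
    by have /andP[] := gcb (th s).
  have rt0' : 0 < r t by rewrite lt_neqAle eq_sym rt r0.
  have c1 : r s @[s --> within `[t1, t2] (nbhs t)] --> r t.
    by move/subspace_continuousP : cr; exact.
  have c2 : th s @[s --> within `[t1, t2] (nbhs t)] --> th t.
    apply/cvgrPdist_lt => e' e'0.
    have [dl dl0 H] := within_dist cth (conj tt12 rt0') e'0.
    have [dl' dl'0 H'] := within_dist cr tt12 rt0'.
    exists (Num.min dl dl') => /=; first by rewrite lt_min dl0.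
    move=> s /=; rewrite lt_min => /andP[sd sd'] st.
    apply: H sd; split => //; have := H' s st sd'.
    by rewrite ltr_norml => /andP[_]; clear; lra.
  have c3 : G s @[s --> within `[t1, t2] (nbhs t)] --> G t.
    apply: cvgM => //; apply: cvgV; first by rewrite gt_eqF.
    exact: (continuous_cvg _ (cgc (th t)) c2).
  have [dl /= dl0 H] := cvgr_dist_lt _ _ c3 _ e0.
  by exists dl => // s st sd; exact: H.
have G1 : 0 < G t1 by rewrite divr_gt0 ?er1.
have G2 : 0 < G t2 by rewrite divr_gt0 ?er2.
have Gt0 : G t0 = 0 by rewrite /G rt0 mul0r.
set L := t2 - t1; have L0 : 0 < L by rewrite subr_gt0.
pose Lg t := (kinetic v t + pot_ext V (polar (r t) (th t)))%E.
have iL : lebesgue_measure.-integrable `[t1, t2] Lg.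
  by apply: integrableD => //; exact: kinetic_integrable hpath.
pose Atot := fine (\int[lebesgue_measure]_(t in `[t1, t2]) `|Lg t|%E).
pose C := 2 * (fine (\int[lebesgue_measure]_(t in `[t1, t2]) kinetic v t) +
     fine (\int[lebesgue_measure]_(t in `[t1, t2]) `|pot_ext V (polar (r t) (th t))|%E))
     / L.
have C0 : 0 <= C.
  apply: divr_ge0; last exact: ltW.
  rewrite mulr_ge0// addr_ge0// fine_ge0//; apply: integral_ge0 => t _ //.
  exact: kinetic_ge0.
have Atot0 : 0 <= Atot by apply: fine_ge0; apply: integral_ge0.
(* On the piece to be replaced the potential is at least [Um / 2] divided by (lam gM)^alpha, so [C1]
   times lam^alpha times the action bounds the duration. *)
pose C1 := 2 * gM `^ alpha / Um.
have C10 : 0 <= C1 by rewrite divr_ge0 ?(ltW Um0)// mulr_ge0// powR_ge0.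
have s010 : 0 <= s1 - s0 by rewrite subr_ge0 ltW.
(* The bounds in the first group keep the replaced piece away from [t1] and [t2] and inside the disc
   of radius [p]. In the second, two make both durations at most [L / 2], as the surgery requires,
   with [Atot] as a bound on the action known beforehand; the other two settle the final
   inequality. *)
have [lam [lam0 [lG1 lG2 lp] [lT ltau lsum lone]]] : exists lam : R,
   [/\ 0 < lam, [/\ lam < G t1, lam < G t2 & lam * gM < p] &
     [/\ lam `^ (1 + alpha / 2) * (s1 - s0) < L / 2,
         lam `^ alpha * (C1 * Atot) < L / 2,
         lam `^ alpha * (C * (s1 - s0) + C * C1 * (S1 + d)) < d / 4 &
         lam `^ alpha * (C * C1) < 1]].
  have small (q k e : R) : 0 < q -> 0 <= k -> 0 < e ->
      \forall x \near (0 : R)^'+, x `^ q * k < e.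
    move=> q0 k0 e0; apply: powR_small => //.
    - by apply: cvg_at_right_filter; exact: cvg_id.
    - by near=> x.
  have n0 : \forall x \near (0 : R)^'+, 0 < x by near=> x.
  have lt (e : R) : 0 < e -> \forall x \near (0 : R)^'+, x < e.
    by move=> e0; near=> x; near: x; exact: nbhs_right_lt.
  have q1 : 0 < 1 + alpha / 2 by rewrite addr_gt0// divr_gt0.
  have hL : 0 < L / 2 by rewrite divr_gt0.
  have nT := small _ _ _ q1 s010 hL.
  have ntau := small _ _ _ al0 (mulr_ge0 C10 Atot0) hL.
  have k1 : 0 <= C * (s1 - s0) + C * C1 * (S1 + d).
    apply: addr_ge0; first exact: mulr_ge0.
    by apply: mulr_ge0; [exact: mulr_ge0|apply: addr_ge0 => //; exact: ltW].
  have hd : 0 < d / 4 by rewrite divr_gt0.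
  have nsum := small _ _ _ al0 k1 hd.
  have none := small _ _ _ al0 (mulr_ge0 C0 C10) ltr01.
  have np := lt _ (divr_gt0 p0 gM0).
  near (0 : R)^'+ => x; exists x; split.
  - by near: x.
  - split; first by near: x; exact: lt.
      by near: x; exact: lt.
    by rewrite -ltr_pdivlMr//; near: x.
  - by split; near: x.
pose La := lam `^ ga.
have La0 : 0 < La by rewrite powR_gt0.
have lal0 : 0 < lam `^ alpha by rewrite powR_gt0.
(* The exponent of the arc's duration is [ga + alpha], so this duration is of higher order than the
   saving [d * La]. *)
have lamE : lam `^ (1 + alpha / 2) = La * lam `^ alpha.
  rewrite /La -powRD; last by rewrite (gt_eqF lam0) implybT.
  by congr (_ `^ _); rewrite /ga; field.
have Glt : G t0 < lam by rewrite Gt0.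
have cGa : {within `[t1, t0], continuous G}.
  by apply: continuous_subspaceW cG; exact: segment_sub.
have cGb : {within `[t0, t2], continuous G}.
  by apply: continuous_subspaceW cG; exact: segment_sub.
have [a [t1a at0 Ga above]] := last_hit t10 cGa Glt (ltW lG1).
have [b [t0b bt2 Gb below]] := first_hit t02 cGb Glt (ltW lG2).
have {}t1a : t1 < a.
  rewrite lt_neqAle t1a andbT; apply/eqP => e.
  by move: lG1; rewrite e Ga ltxx.
have {}bt2 : b < t2.
  rewrite lt_neqAle bt2 andbT; apply/eqP => e.
  by move: lG2; rewrite -e Gb ltxx.
have ab : a < b by exact: lt_trans t0b.
have sub12 := segment_sub (ltW t1a) (ltW bt2).
have Gle t : t \in `[a, b]%R -> G t <= lam.
  rewrite in_itv/= => /andP[at_ tb]; have [tt0'|tt0'] := leP t t0.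
    move: at_; rewrite le_eqVlt => /predU1P[<-|at_]; first by rewrite Ga.
    exact/ltW/above.
  move: tb; rewrite le_eqVlt => /predU1P[->|tb]; first by rewrite Gb.
  by apply/ltW/below => //; exact: ltW.
have rle t : t \in `[a, b]%R -> r t <= lam * gM.
  move=> tab; rewrite rG; apply: ler_pM.
  - exact/G0/sub12.
  - exact: ltW.
  - exact: Gle.
  - by have /andP[] := gcb (th t).
have rp t : t \in `[a, b]%R -> r t < p.
  by move=> /rle h; exact: le_lt_trans h lp.
have pot0 t : t \in `[a, b]%R -> (0 <= pot_ext V (polar (r t) (th t)))%E.
  by move=> tab; apply: ptp; [exact/r0/sub12|exact: rp].
have sec t : t \in `[a, b]%R -> 0 < r t -> A <= th t <= B.
  by move=> /sub12 tab rt; have := hsec t tab rt; rewrite in_itv.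
have hab := H1_path_sub (ltW t1a) (ltW ab) (ltW bt2) hpath.
have ra : r a = lam * gc (th a) by rewrite rG Ga.
have rb : r b = lam * gc (th b) by rewrite rG Gb.
have ra0 : 0 < r a by rewrite ra mulr_gt0.
have rb0 : 0 < r b by rewrite rb mulr_gt0.
have aab : a \in `[a, b]%R by rewrite in_itv/= lexx ltW.
have bab : b \in `[a, b]%R by rewrite in_itv/= lexx ltW.
have pa := sec a aab ra0; have pb := sec b bab rb0.
set sa := sig (th a); set sb := sig (th b).
have {}ra : r a = lam * rr sa by rewrite ra /gc clE.
have {}rb : r b = lam * rr sb by rewrite rb /gc clE.
have [sas tsa _ _ [_ ua]] := hsig _ pa; have [sbs tsb _ _ [_ ub]] := hsig _ pb.
rewrite -/sa in sas tsa; rewrite -/sb in sbs tsb.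
have iLab : lebesgue_measure.-integrable `[a, b] Lg.
  by apply: integrable_segmentS iL; exact: ltW.
pose Ax := fine (action V a b (fun t => polar (r t) (th t)) v).
have AxE : action V a b (fun t => polar (r t) (th t)) v = Ax%:E.
  by rewrite fineK//; exact: integrable_fin_num iLab.
have AxA : Ax <= Atot.
  rewrite -lee_fin -AxE fineK; last first.
    by apply: integrable_fin_num => //; exact: integrable_abse.
  apply: (@le_trans _ _ (\int[lebesgue_measure]_(t in `[a, b]) `|Lg t|%E)%E).
    apply: le_integral => //; first exact: integrable_abse.
    by move=> t _; exact: lee_abs.
  apply: ge0_subset_integral => //.
  by apply: measurableT_comp => //; case/integrableP: iL.
(* The increment S(q) - S(p): both ends lie on the leaf of scale [lam], at the parameters [sa] and
   [sb]. *)
pose X := La * (rr sb `^ ga * u (th b) - rr sa `^ ga * u (th a)).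
have rr0 s : 0 < rr s by case: (fl s).
have lower : `|X| + d * La <= Ax.
  (* The subsolution near [- sg * u] serves the incoming branch and the one near [sg * u] the
     outgoing branch; the two signs together give the absolute value of [X]. *)
  have key sg : `|sg| = 1 -> sg * X + d * La <= Ax.
    move=> sg1; have [f [f1 hf]] := hsub (- sg) (etrans (normrN _) sg1).
    have [h [h1 hh]] := hsub sg sg1.
    have cond q q1 t : (forall phi, A <= phi <= B ->
        [/\ is_derive phi 1 q (q1 phi), `|q phi| <= M &
          (ga * q phi) ^+ 2 + q1 phi ^+ 2 < 2 * (1 - kap) * U phi]) ->
        t \in `[a, b]%R -> 0 < r t ->
        [/\ is_derive (th t) 1 q (q1 (th t)), `|q (th t)| <= M &
        (r t `^ (ga - 1)) ^+ 2 * ((ga * q (th t)) ^+ 2 + q1 (th t) ^+ 2) <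
          2 * V (polar (r t) (th t))].
      move=> hq tab rt; have [k1 k2 k3] := hq _ (sec t tab rt).
      split => //.
      have pr0 : 0 < r t `^ alpha by rewrite powR_gt0.
      (* The exponent is [2 * (ga - 1) = - alpha]: both sides of the inequality scale in the same
         way with the radius. *)
      have -> : (r t `^ (ga - 1)) ^+ 2 = (r t `^ alpha)^-1.
        rewrite expr2 -powRD; last by rewrite (gt_eqF rt) implybT.
        by rewrite -powRN; congr (_ `^ _); rewrite /ga; field.
      rewrite mulrC ltr_pdivrMr//; apply: (lt_le_trans k3).
      have := Vlow (r t) (th t) rt (rp t tab).
      rewrite mulrA ler_pdivrMr// => k4.
      have : (1 - kap) * U (th t) <= (1 - eta) * U (th t).
        by rewrite ler_pM2r// lerD2l lerN2.
      move: k4; clear; lra.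
    have cf : forall t, t \in `[a, b]%R -> 0 < r t -> _ := fun t => cond f f1 t
      (fun phi hphi => let: And4 k1 _ k2 k3 := hf phi hphi in And3 k1 k2 k3).
    have ch : forall t, t \in `[a, b]%R -> 0 < r t -> _ := fun t => cond h h1 t
      (fun phi hphi => let: And4 k1 _ k2 k3 := hh phi hphi in And3 k1 k2 k3).
    have := @action_through_collision _ a b t0 ga M V r th v f f1 h h1
      at0 t0b ga0 M0 hV hab pot0 rt0 ra0 rb0 cf ch.
    rewrite AxE lee_fin => low; apply: le_trans low.
    have [_ fa _ _] := hf _ pa; have [_ hb _ _] := hh _ pb.
    have gs s : s0 <= s <= s1 -> gm `^ ga <= rr s `^ ga.
      move=> /hg/andP[h3 _].
      exact: powR_le (ltW ga0) (ltW gm0) h3.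
    have pga s : (lam * rr s) `^ ga = La * rr s `^ ga.
      by rewrite powRM// ltW.
    rewrite ra rb !pga.
    have La_a : 0 <= La * rr sa `^ ga by rewrite mulr_ge0 ?powR_ge0.
    have La_b : 0 <= La * rr sb `^ ga by rewrite mulr_ge0 ?powR_ge0.
    have m1 : La * rr sa `^ ga * (- sg * u (th a) + c0) <= La * rr sa `^ ga * f (th a).
      by rewrite ler_wpM2l.
    have m2 : La * rr sb `^ ga * (sg * u (th b) + c0) <= La * rr sb `^ ga * h (th b).
      by rewrite ler_wpM2l.
    have m3 : La * c0 * gm `^ ga <= La * c0 * rr sa `^ ga.
      by rewrite ler_wpM2l ?gs// mulr_ge0 ?ltW.
    have m4 : La * c0 * gm `^ ga <= La * c0 * rr sb `^ ga.
      by rewrite ler_wpM2l ?gs// mulr_ge0 ?ltW.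
    apply: le_trans (lerD m1 m2); rewrite /X /d; move: m3 m4; clear; lra.
  have := key 1 (normr1 _); have := key (-1) (etrans (normrN _) (normr1 _)).
  rewrite mulN1r mul1r => k1 k2.
  have [X0|X0] := leP 0 X; [rewrite ger0_norm//|rewrite ltr0_norm//].
have Vle s : Num.min sa sb <= s <= Num.max sa sb ->
    V (polar (lam * rr s) (tt s)) <= (1 + eta) * (U (tt s) / (lam * rr s) `^ alpha).
  move=> /andP[h1 h2]; have /andP[k1 k2] := sas; have /andP[k3 k4] := sbs.
  have hs : s0 <= s <= s1.
    apply/andP; split.
      by apply: le_trans h1; rewrite le_min k1 k3.
    by apply: (le_trans h2); rewrite ge_max k2 k4.
  apply: Vup; first by rewrite mulr_gt0.
  by apply: le_lt_trans lp; rewrite ler_pM2l//; have /andP[] := hg s hs.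
have [T [ry [thy [vy [Ay [eT [hy iy Aye] [ery ethy] [erb ethb] hAy]]]]]] :=
  scaled_arc halpha lam0 (ltW eta0) (fun t => ltW (U0 t)) hV fl Vle.
have hAy' : Ay <= (1 + eta) * `|X| by exact: hAy.
have dsab : `|sb - sa| <= s1 - s0.
  move: sas sbs => /andP[k1 k2] /andP[k3 k4].
  by move: k1 k2 k3 k4; clear => *; rewrite ler_norml; apply/andP; split; lra.
have T0 : 0 <= T by rewrite eT mulr_ge0 ?powR_ge0.
have Tle : T <= lam `^ (1 + alpha / 2) * (s1 - s0).
  by rewrite eT ler_wpM2l ?powR_ge0.
have tau_le : b - a <= C1 * lam `^ alpha * Ax.
  have q0 : 0 < (lam * gM) `^ alpha by rewrite powR_gt0 ?mulr_gt0.
  have : ((Um / 2 / (lam * gM) `^ alpha)%:E * (b - a)%:E <= Ax%:E)%E.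
    rewrite -EFinM -integral_segment_cst; last exact: ltW.
    rewrite -AxE; apply: le_integral => //; first exact: integrable_segment_cst.
    move=> t; rewrite inE => tab.
    apply: (@le_trans _ _ (pot_ext V (polar (r t) (th t)))); last first.
      by rewrite leeDr// kinetic_ge0.
    rewrite /pot_ext polar_eq0; case: ifPn => [_|rn]; first exact: leey.
    have rt : 0 < r t by rewrite lt_neqAle eq_sym rn r0//; exact: sub12.
    rewrite lee_fin; apply: le_trans (Vlow _ _ rt (rp t tab)).
    rewrite mulrA; apply: ler_pM.
    - by rewrite divr_ge0// ltW.
    - by rewrite invr_ge0 ltW.
    - have u1 := Umin (th t); have u2 : 2^-1 <= 1 - eta by move: eta_half; clear; lra.
      rewrite mulrC; apply: ler_pM => //; exact: ltW.
    - rewrite lef_pV2 ?posrE ?powR_gt0 ?mulr_gt0//.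
      exact: powR_le (ltW al0) (ltW rt) (rle t tab).
  rewrite -EFinM lee_fin mulrAC ler_pdivrMr// mulrAC ler_pdivrMr// => h.
  rewrite /C1 -(ler_pM2l Um0); apply: (le_trans h).
  rewrite powRM ?(ltW lam0) ?(ltW gM0)// le_eqVlt; apply/orP; left; apply/eqP.
  by field; rewrite gt_eqF.
have Ax0 : 0 <= Ax.
  by apply: le_trans lower; rewrite addr_ge0// mulr_ge0 ?ltW.
have tauL : b - a <= L / 2.
  apply: (le_trans tau_le); apply: le_trans (ltW ltau).
  rewrite [C1 * _]mulrC -mulrA ler_pM2l// ler_wpM2l//.
have TL : T <= L / 2 by exact: le_trans Tle (ltW lT).
rewrite tsa in ethy; rewrite tsb in ethb.
have surg := minimizer_surgery hV hadm hopt ip t1a ab bt2 tauL T0 TL hy iy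
  (etrans ery (esym ra)) ethy (etrans erb (esym rb)) ethb Aye.
rewrite -/L -/C AxE lee_fin in surg.
have XS : `|X| <= S1 * La.
  have bnd s phi : s0 <= s <= s1 -> `|u phi| <= Mu -> `|rr s `^ ga * u phi| <= gM `^ ga * Mu.
    move=> /hg/andP[_ h1] h2; rewrite normrM (ger0_norm (powR_ge0 _ _)).
    apply: ler_pM; [exact: powR_ge0|exact: normr_ge0| |exact: h2].
    exact: powR_le (ltW ga0) (ltW (rr0 s)) h1.
  rewrite /X normrM (gtr0_norm La0) mulrC ler_pM2r//.
  apply: (le_trans (ler_normB _ _)).
  rewrite /S1 mulr_natl mulr2n; apply: lerD; exact: bnd.
(* The duration of the old piece costs at most the fraction lam^alpha C C1 of its action, that of
   the arc lam^alpha C (s1 - s0) times [La]. Together with [eta * S1] the errors stay below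
   [d / 2]. *)
apply: (@action_gap_contradiction R Ax `|X| d La (lam `^ alpha * (C * C1)) eta C
  (lam `^ alpha * (C * (s1 - s0))) S1 (b - a) T) => //.
- by apply: (le_trans surg); rewrite lerD2r.
- have -> : lam `^ alpha * (C * C1) * Ax = C * (C1 * lam `^ alpha * Ax) by ring.
  exact: ler_wpM2l.
- have -> : lam `^ alpha * (C * (s1 - s0)) * La = C * (lam `^ (1 + alpha / 2) * (s1 - s0)).
    by rewrite lamE; ring.
  exact: ler_wpM2l.
- by rewrite mulr_ge0 ?(ltW lal0)// mulr_ge0.
- exact: ltW.
- exact: ltW.
- move: lsum eta_S d0; clear; lra.
Unshelve. all: by end_near.
Qed.
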